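(* Let $x=(x_1,x_2)$ with $x_1>0$, let $r>0$, let $r_0=r$ and let $r_k,\ E(x,r_k),\ \Gamma(x,r)$ be as defined in the context. Let $w$ be Lipschitz continuous and assume $\int_{E(x,r_1)}w=0$. Then $$w(x)\le C\int_{\Gamma(x,r)}\left|\nabla_Aw(y)\right|\frac{\widehat d(x,y)}{\left|B(x,d(x,y))\right|}\,dy,\qquad \widehat d(x,y)\equiv\min\left\{d(x,y),\ \frac{1}{\left|F'(x_1+d(x,y))\right|}\right\},$$ where the constant $C$ does not depend on $x,r,w$.
   Context: Geometry. $f$ is an even function on $\mathbb{R}$ with $f(0)=0$, $f(x)=e^{-F(|x|)}$ for $0<|x|<R$, where $F$ is twice differentiable on $(0,R)$ and, for some constants $C\ge1$, $\varepsilon>0$: (1) $\lim_{x\to0^+}F(x)=+\infty$; (2) $F'<0$ and $F''>0$ on $(0,R)$; (3) $\frac1C|F'(r)|\le|F'(x)|\le C|F'(r)|$ for $\frac12r<x<2r<R$; (4) $\frac{1}{-xF'(x)}$ is increasing on $(0,R)$ and bounded by $\frac1\varepsilon$; (5) $\frac{F''(x)}{-F'(x)}\approx\frac1x$ on $(0,R)$. $d$ is the control metric of $dt^2=dx^2+\frac1{f(x)^2}dy^2$ in the plane, $B(x,r)$ its balls, $|\cdot|$ Lebesgue measure, and $\nabla_Aw=\left(\frac{\partial w}{\partial x_1},f(x_1)\frac{\partial w}{\partial x_2}\right)$. All radii are small enough that the arguments of $F$ lie in $(0,R)$. For $x_1,t>0$ let $h^*(x_1,t)=\int_{x_1}^{x_1+t}\frac{f(u)^2}{\sqrt{f(x_1+t)^2-f(u)^2}}\,du$.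 For $r>0$ let $r^*(x_1,r)\in(0,r)$ be the number such that the geodesic from $(x_1,x_2)$ with a vertical tangent at the boundary of $B(x,r)$ meets this boundary at first coordinate $x_1+r^*$, i.e. $r=\int_{x_1}^{x_1+r^*}\frac{f(x_1+r^* )}{\sqrt{f(x_1+r^* )^2-f(u)^2}}\,du$; let $h(x_1,r)=h^*(x_1,r^*(x_1,r))$. Define $r_0=r$ and, for $k\ge0$, $r_{k+1}=r^*(x_1,r_k)$ if $r_k\ge\frac{1}{|F'(x_1)|}$, $r_{k+1}=\frac12r_k$ if $r_k<\frac{1}{|F'(x_1)|}$. Define $$E(x,r_k)=\begin{cases}\{y:x_1+r_{k+1}\le y_1<x_1+r_k,\ |y_2-x_2|<h^*(x_1,y_1-x_1)\}&\text{if }r_k\ge\frac{1}{|F'(x_1)|},\\ \{y:x_1+r_{k+1}\le y_1<x_1+r_k,\ |y_2-x_2|<h(x_1,r_k)\}&\text{if }r_k<\frac{1}{|F'(x_1)|},\end{cases}$$ and $\Gamma(x,r)=\bigcup_{k=1}^\infty E(x,r_k)$. *)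

(* Defs.v *)
From HB Require Import structures.
From mathcomp Require Import all_boot all_order all_algebra.
From mathcomp Require Import all_classical all_reals all_analysis.

Set Implicit Arguments.
Unset Strict Implicit.
Unset Printing Implicit Defensive.

Import Order.TTheory GRing.Theory Num.Theory.
Import numFieldNormedType.Exports.

Local Open Scope classical_set_scope.
Local Open Scope ring_scope.

(* In [ring_scope], these would otherwise denote polynomial derivatives. *)
Local Notation "f ^` ()" := (derive1 f) : ring_scope.
Local Notation "f ^` ( n )" := (derive1n n f) : ring_scope.

(** Structural conditions on the degeneracy [f] and on [F = - ln f] near [0].
    [f] is unconstrained, apart from evenness, outside the interval (-Rmax, Rmax),
    and [F] outside (0, Rmax). In [geom_ratio], the relation "comparable to" is
    spelled out with its own constant; in [geom_incr], increasing is read in the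
    wide sense. *)
Record geometry (R : realType) (f F : R -> R) (Rmax C eps : R) : Prop :=
  Geometry {
  geom_Rmax : 0 < Rmax ;
  geom_C : 1 <= C ;
  geom_eps : 0 < eps ;
  geom_even : forall x : R, f (- x) = f x ;
  geom_f0 : f 0 = 0 ;
  geom_fE : forall x : R, 0 < `|x| -> `|x| < Rmax -> f x = expR (- F `|x|) ;
  geom_diff1 : forall x : R, 0 < x -> x < Rmax -> derivable F x 1 ;
  geom_diff2 : forall x : R, 0 < x -> x < Rmax -> derivable F^`() x 1 ;
  geom_lim : F x @[x --> 0^'+] --> +oo ;
  geom_dF : forall x : R, 0 < x -> x < Rmax -> F^`() x < 0 ;
  geom_ddF : forall x : R, 0 < x -> x < Rmax -> 0 < F^`(2) x ;
  geom_doubling : forall r x : R, r / 2 < x -> x < 2 * r -> 2 * r < Rmax ->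
    C^-1 * `|F^`() r| <= `|F^`() x| <= C * `|F^`() r| ;
  geom_incr : forall x y : R, 0 < x -> x <= y -> y < Rmax ->
    (- x * F^`() x)^-1 <= (- y * F^`() y)^-1 ;
  geom_bound : forall x : R, 0 < x -> x < Rmax -> (- x * F^`() x)^-1 <= eps^-1 ;
  geom_ratio : exists2 c, 0 < c & forall x : R, 0 < x -> x < Rmax ->
    c^-1 * x^-1 <= F^`(2) x / (- F^`() x) <= c * x^-1 }.

Section Metric.
Variables (R : realType) (f : R -> R).

(** The velocity [v] at [p] has length at most 1 for [dx^2 + f^-2 dy^2]. Testing
    against covectors avoids the division by [f], which vanishes on the vertical
    axis: there the condition forces [v.2 = 0]. *)
Definition subunit_vector (p v : R * R) : Prop :=
  forall xi : R * R,
    (v.1 * xi.1 + v.2 * xi.2) ^+ 2 <= xi.1 ^+ 2 + f p.1 ^+ 2 * xi.2 ^+ 2.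

Definition subunit_curve (T : R) (g : R -> R * R) : Prop :=
  [lipschitz g t | t in `[0, T]] /\
  {ae @lebesgue_measure R, forall t, 0 < t < T ->
    [/\ derivable (fst \o g) t 1, derivable (snd \o g) t 1 &
        subunit_vector (g t) ((fst \o g)^`() t, (snd \o g)^`() t)]}.

(** As soon as [f] is nonzero at one point, the set below is nonempty, so that
    [inf] is the true infimum: horizontal curves are always subunit, and one can
    move vertically where [f] does not vanish. *)
Definition control_dist (x y : R * R) : R :=
  inf [set T | 0 <= T /\
    exists g, [/\ subunit_curve T g, g 0 = x & g T = y]].

Definition control_ball (x : R * R) (r : R) : set (R * R) :=
  [set y | control_dist x y < r].

(** The partial derivatives are total functions, meaningful wherever [w] is
    differentiable, hence almost everywhere for Lipschitz [w]. *)
Definition norm_gradA (w : R * R -> R) (y : R * R) : R :=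
  Num.sqrt ((fun s => w (s, y.2))^`() y.1 ^+ 2
            + (f y.1 * (fun s => w (y.1, s))^`() y.2) ^+ 2).

End Metric.

Definition lebesgue2 (R : realType) :
    {measure set (measurableTypeR R * measurableTypeR R) -> \bar R} :=
  (@lebesgue_measure R \x @lebesgue_measure R)%E.

Section Geodesics.
Variables (R : realType) (f F : R -> R).

Definition hstar (x1 t : R) : R :=
  (\int[@lebesgue_measure R]_(u in `[x1, x1 + t])
     (f u ^+ 2 / Num.sqrt (f (x1 + t) ^+ 2 - f u ^+ 2)))%R.

(** Length of the geodesic starting at first coordinate [x1] up to the point,
    at first coordinate [x1 + t], where its tangent is vertical. *)
Definition geodesic_length (x1 t : R) : R :=
  (\int[@lebesgue_measure R]_(u in `[x1, x1 + t])
     (f (x1 + t) / Num.sqrt (f (x1 + t) ^+ 2 - f u ^+ 2)))%R.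

(** The default value 0 is only returned if no such point exists. The length is
    increasing in [t], so that there is at most one in the range considered. *)
Definition rstar (x1 r : R) : R :=
  xget 0 [set t | [/\ 0 < t, t < r & r = geodesic_length x1 t]].

Definition height (x1 r : R) : R := hstar x1 (rstar x1 r).

Definition next_radius (x1 s : R) : R :=
  if `|F^`() x1|^-1 <= s then rstar x1 s else s / 2.

Definition radius_seq (x1 r : R) (k : nat) : R := iter k (next_radius x1) r.

(** [Eset x (radius_seq x.1 r k)] is E(x, r_k): the next radius r_{k+1} only
    depends on r_k. *)
Definition Eset (x : R * R) (s : R) : set (R * R) :=
  [set y | [/\ x.1 + next_radius x.1 s <= y.1, y.1 < x.1 + s &
    `|y.2 - x.2| < if `|F^`() x.1|^-1 <= s then hstar x.1 (y.1 - x.1)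
                   else height x.1 s]].

Definition Gamma (x : R * R) (r : R) : set (R * R) :=
  \bigcup_(k in [set k | (1 <= k)%N]) Eset x (radius_seq x.1 r k).

Definition dhat (x y : R * R) : R :=
  Num.min (control_dist f x y) `|F^`() (x.1 + control_dist f x y)|^-1.

End Geodesics.

(* Main.v *)
(** The shell E(x, r_k) has width [l_k = r_k - r_{k+1}] and half height comparable to
    [f_k l_k], where [f_k = f (x_1 + r_{k+1})]. On it, [f] is comparable to [f_k] and
    [min(tau, 1 / |F'(x_1 + tau)|)] to [l_k], [tau] being the horizontal distance to [x];
    and [f_k l_k] is comparable to [f_{k+1} l_{k+1}]. Since a ball of radius [d] around [x]
    has measure at most [32 f (x_1 + d) min(d, 1 / |F'(x_1 + d)|)^2], the kernel is at
    least [c / (f_k l_k)] on the shell.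

    In each shell there is a vertical segment, and in the union of two consecutive shells
    a horizontal one crossing it, along which the integral of the derivative of [w] is at
    most the average over all parallel segments. By the bound on the kernel, [w]
    oscillates on these segments by at most a multiple of the integrals over the two
    shells. The segments form a chain from the first shell, where [w] is controlled
    because its mean vanishes, towards [x], and the sum of the oscillations is bounded by
    the integral over Gamma(x, r). *)
Require Import Defs.
From HB Require Import structures.
From mathcomp Require Import all_boot all_order all_algebra.
From mathcomp Require Import all_classical all_reals all_analysis.
From mathcomp Require Import measurable_realfun.
From mathcomp Require Import ring lra.
Set Implicit Arguments.
Unset Strict Implicit.
Unset Printing Implicit Defensive.
Import Order.TTheory GRing.Theory Num.Theory.
Import numFieldNormedType.Exports.
Local Open Scope classical_set_scope.
Local Open Scope ring_scope.

Local Notation "f ^` ()" := (derive1 f) : ring_scope.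
Local Notation "f ^` ( n )" := (derive1n n f) : ring_scope.

(** * The function F *)

(** Everything about [F] passes through the length 1 / |F'|, called [lam]. It is nondecreasing, at
    most x / eps, and grows at most like a power of the ratio of the arguments, while [f] grows by a
    bounded factor over a distance of order [lam]. This makes the quantities attached to a shell
    comparable, with constants free of x and r.

    The delicate point is that t = r*(x_1, s) is not small compared with 1 / |F'(x_1 + t)| when s >=
    1 / |F'(x_1)|. The bound on h* with the factor sqrt(2 t |F'(x_1)|) settles it: a short t would
    give a geodesic shorter than s.

    Consecutive vertical segments lie over disjoint ranges of y_1. The horizontal segment joining
    them therefore has to span two shells, and neighbouring half heights must be comparable.

    Neither the control distance nor its balls are shown to be measurable. Integrals of nonnegative
    functions and measures of sets are compared by monotonicity alone, and on each shell the
    integrand is replaced by a measurable minorant. *)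

Section RealGeometry.
Context {R : realType} (f F : R -> R) (Rmax C0 eps : R).
Hypothesis geom : geometry f F Rmax C0 eps.

(** The length scale of [f]: on (0, [Rmax]) the logarithmic derivative of [f] is - F' = 1 /
    [lam]. *)
Definition lam (x : R) : R := `|F^`() x|^-1.

Lemma normdF x : 0 < x -> x < Rmax -> `|F^`() x| = - F^`() x.
Proof. by move=> x0 xR; rewrite ltr0_norm// (geom_dF geom). Qed.

Lemma lam_gt0 x : 0 < x -> x < Rmax -> 0 < lam x.
Proof. by move=> x0 xR; rewrite invr_gt0 normr_gt0 lt_eqF// (geom_dF geom). Qed.

Lemma normdFE x : `|F^`() x| = (lam x)^-1.
Proof. by rewrite /lam invrK. Qed.

Lemma F_is_derive x : 0 < x -> x < Rmax -> is_derive x 1 F (F^`() x).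
Proof.
by move=> x0 xR; rewrite derive1E; apply/derivableP/(geom_diff1 geom).
Qed.

Lemma dF_is_derive x : 0 < x -> x < Rmax -> is_derive x 1 F^`() (F^`(2) x).
Proof.
move=> x0 xR; rewrite derive1nS derive1n1 derive1E.
by apply/derivableP/(geom_diff2 geom).
Qed.

Lemma F_continuous x : 0 < x -> x < Rmax -> {for x, continuous F}.
Proof.
move=> x0 xR; apply: differentiable_continuous; apply/derivable1_diffP.
exact: (geom_diff1 geom).
Qed.

Lemma dF_continuous x : 0 < x -> x < Rmax -> {for x, continuous F^`()}.
Proof.
move=> x0 xR; apply: differentiable_continuous; apply/derivable1_diffP.
exact: (geom_diff2 geom).
Qed.

Lemma within_continuous_pos (g : R -> R) x y : 0 < x -> y < Rmax ->
  (forall z, 0 < z -> z < Rmax -> {for z, continuous g}) ->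
  {within `[x, y], continuous g}.
Proof.
move=> x0 yR gc; apply: continuous_in_subspaceT => z.
rewrite inE/= in_itv/= => /andP[xz zy].
by apply: gc; [exact: lt_le_trans xz|exact: le_lt_trans yR].
Qed.

Lemma dF_ndecr x y : 0 < x -> x <= y -> y < Rmax -> F^`() x <= F^`() y.
Proof.
move=> x0; rewrite le_eqVlt => /predU1P[->//|xy] yR.
have [|z zxy E] := @MVT_segment R F^`() F^`(2) x y (ltW xy) _
  (within_continuous_pos x0 yR dF_continuous).
  move=> z; rewrite in_itv/= => /andP[xz zy].
  by apply: dF_is_derive; [exact: lt_trans xz|exact: lt_trans yR].
move: zxy; rewrite in_itv/= => /andP[xz zy].
rewrite -subr_ge0 E mulr_ge0 ?subr_ge0 ?(ltW xy)// ltW//.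
apply: (geom_ddF geom); first exact: lt_le_trans xz.
exact: le_lt_trans yR.
Qed.

Lemma lam_ndecr x y : 0 < x -> x <= y -> y < Rmax -> lam x <= lam y.
Proof.
move=> x0 xy yR.
have y0 := lt_le_trans x0 xy; have xR := le_lt_trans xy yR.
rewrite /lam lef_pV2 ?posrE ?normr_gt0 ?lt_eqF ?(geom_dF geom)//.
by rewrite !normdF// lerN2 dF_ndecr.
Qed.

Lemma lam_le x : 0 < x -> x < Rmax -> lam x <= x / eps.
Proof.
move=> x0 xR; have := geom_bound geom x0 xR.
rewrite mulNr -mulrN invfM -normdF// => H.
by rewrite -ler_pdivrMl.
Qed.

Lemma F_diff_ge x y : 0 < x -> x <= y -> y < Rmax ->
  (y - x) / lam y <= F x - F y.
Proof.
move=> x0 xy yR.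
have y0 := lt_le_trans x0 xy.
have [|z zxy E] := @MVT_segment R F F^`() x y xy _
  (within_continuous_pos x0 yR F_continuous).
  move=> z; rewrite in_itv/= => /andP[xz zy].
  by apply: F_is_derive; [exact: lt_trans xz|exact: lt_trans yR].
move: zxy; rewrite in_itv/= => /andP[xz zy].
rewrite -normdFE normdF// -(opprB (F y)) E -mulNr mulrC ler_wpM2r ?subr_ge0//.
rewrite lerN2 dF_ndecr//; exact: lt_le_trans xz.
Qed.

Lemma F_diff_le x y : 0 < x -> x <= y -> y < Rmax ->
  F x - F y <= (y - x) / lam x.
Proof.
move=> x0 xy yR.
have y0 := lt_le_trans x0 xy.
have [|z zxy E] := @MVT_segment R F F^`() x y xy _
  (within_continuous_pos x0 yR F_continuous).
  move=> z; rewrite in_itv/= => /andP[xz zy].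
  by apply: F_is_derive; [exact: lt_trans xz|exact: lt_trans yR].
move: zxy; rewrite in_itv/= => /andP[xz zy].
have xR := le_lt_trans xy yR.
rewrite -normdFE normdF// -(opprB (F y)) E -mulNr [leRHS]mulrC.
rewrite ler_wpM2r ?subr_ge0// lerN2 dF_ndecr//; exact: le_lt_trans yR.
Qed.

(** Once n + 1 is at least the constant c in F'' / (- F') <= c / z, the function - F'(z) z^(n+1) has
    a nonnegative derivative. Comparing its values at x and y gives lam y / lam x <= (y /
    x)^(n+1). *)
Lemma lam_growth : exists n : nat, forall x y M : R, 0 < x -> x <= y -> y < Rmax ->
  y <= M * x -> lam y <= M ^+ n * lam x.
Proof.
have [c c0 ratio] := geom_ratio geom.
have [n cn] : exists n : nat, c <= n.+1%:R.
  exists (Num.truncn c); exact/ltW/truncnS_gt.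
exists n.+1 => x y M x0 xy yR yMx.
have y0 := lt_le_trans x0 xy; have xR := le_lt_trans xy yR.
pose G := fun z : R => - F^`() z * z ^+ n.+1.
pose dG := fun z : R => - F^`() z * (n.+1%:R * z ^+ n) - F^`(2) z * z ^+ n.+1.
have dGP z : 0 < z -> z < Rmax -> is_derive z 1 G (dG z).
  move=> z0 zR; have := dF_is_derive z0 zR => H.
  have HX : is_derive z 1 (fun u : R => u ^+ n.+1) (n.+1%:R * z ^+ n).
    have -> : (fun u : R => u ^+ n.+1) = id ^+ n.+1 by rewrite exprfctE.
    by apply: (is_derive_eq (is_deriveX n.+1 (is_derive_id z 1))); rewrite /GRing.scale/= mulr1.
  apply: (is_derive_eq (is_deriveM (is_deriveN H) HX)).
  by rewrite /dG /GRing.scale/= mulrN [z ^+ n.+1 * _]mulrC.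
have cG z : 0 < z -> z < Rmax -> {for z, continuous G}.
  move=> z0 zR; apply: differentiable_continuous; apply/derivable1_diffP.
  exact: (ex_derive (is_derive := dGP z z0 zR)).
have [|z zxy E] := @MVT_segment R G dG x y xy _
  (within_continuous_pos x0 yR cG).
  move=> z; rewrite in_itv/= => /andP[xz zy].
  by apply: dGP; [exact: lt_trans xz|exact: lt_trans yR].
move: zxy; rewrite in_itv/= => /andP[xz zy].
have z0 := lt_le_trans x0 xz; have zR := le_lt_trans zy yR.
have GG : G x <= G y.
  rewrite -subr_ge0 E mulr_ge0//; [rewrite /dG subr_ge0|by rewrite subr_ge0].
  have /andP[_] := ratio z z0 zR.
  rewrite ler_pdivrMr; last by rewrite oppr_gt0 (geom_dF geom).
  move=> H; have dF0 := geom_dF geom z0 zR.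
  have H2 : F^`(2) z * z <= n.+1%:R * (- F^`() z).
    have := ler_wpM2r (ltW z0) H => /le_trans; apply.
    rewrite mulrAC divfK ?gt_eqF// ler_wpM2r// oppr_ge0 ltW//.
  rewrite exprS mulrA.
  have -> : - F^`() z * (n.+1%:R * z ^+ n) = n.+1%:R * (- F^`() z) * z ^+ n by ring.
  by rewrite ler_wpM2r// exprn_ge0// ltW.
have M0 : 0 < M by rewrite -(pmulr_lgt0 _ x0) (lt_le_trans y0).
move: GG; rewrite /G -!normdF// !normdFE => GG.
have lx := lam_gt0 x0 xR; have ly := lam_gt0 y0 yR.
have xn : 0 < x ^+ n.+1 by rewrite exprn_gt0.
have : y ^+ n.+1 <= M ^+ n.+1 * x ^+ n.+1.
  by rewrite -exprMn lerXn2r// nnegrE ?mulr_ge0// ltW.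
move: GG; rewrite (@ler_pdivrMl _ (lam x))// mulrA [_ * (lam y)^-1]mulrC -mulrA => GG H; move: GG.
rewrite (@ler_pdivlMl _ (lam y))// => GG.
rewrite -(ler_pM2r xn) (le_trans GG)// mulrAC mulrC ler_wpM2r ?(ltW lx)//.
Qed.
End RealGeometry.

(** * Integrals with a singular right endpoint *)

Section SingularFTC.
Context {R : realType}.
Notation mu := (@lebesgue_measure R).
Variables (G g : R -> R) (a' a b M : R).
Hypotheses (a'a : a' < a) (ab : a < b).
Hypothesis dG : forall x, a' < x -> x < b -> is_derive x 1 G (g x).
Hypothesis cg : forall x, a' < x -> x < b -> {for x, continuous g}.
Hypothesis g0 : forall x, a <= x -> x < b -> 0 <= g x.
Hypothesis GM : forall x, a <= x -> x < b -> G x <= M.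

Lemma measurable_of_continuous_itv : measurable_fun `[a, b[ g.
Proof.
apply: (@measurable_funS _ _ _ _ `]a', b[) => //.
  by apply: subset_itvr; rewrite bnd_simp.
apply: open_continuous_measurable_fun; first exact: itv_open.
by move=> x; rewrite inE/= in_itv/= => /andP[? ?]; exact: cg.
Qed.

(** The fundamental theorem applies on the intervals [[a, bn n]], which stay away from a possible
    singularity at [b], and monotone convergence passes to [[a, b[]. An upper bound of the primitive
    stands in for its limit at [b]; the room between [a'] and [a] provides a two-sided derivative at
    [a]. *)
Lemma integral_le_of_primitive : (\int[mu]_(x in `[a, b[) (g x)%:E <= (M - G a)%:E)%E.
Proof.
(* The shift to [n.+2] keeps [bn 0] strictly above [a]. *)
pose bn n := b - (b - a) / n.+2%:R.
have bnb n : bn n < b by rewrite /bn ltrBlDr ltrDl divr_gt0// subr_gt0.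
have abn n : a < bn n.
  rewrite /bn ltrBrDr -ltrBrDl -[ltRHS]mulr1 ltr_pM2l ?subr_gt0//.
  by rewrite invf_lt1// ltr1n.
pose S n := `[a, bn n]%classic : set R.
have US : \bigcup_n S n = `[a, b[%classic.
  apply/seteqP; split => x /=.
    by move=> [n _]; rewrite /S/= !in_itv/= => /andP[-> /le_lt_trans]; exact.
  rewrite in_itv/= => /andP[ax xb].
  have e0 : 0 < (b - x) / (b - a) by rewrite divr_gt0 ?subr_gt0.
  have [n _ ne] := near_infty_natSinv_lt (PosNum e0).
  have {}ne := ne n.+1 (leqnSn n).
  exists n => //; rewrite /S/= in_itv/= ax/= /bn lerBrDr -lerBrDl.
  by move: ne; rewrite /= ltr_pdivlMr ?subr_gt0// mulrC => /ltW.
have SE n : (\int[mu]_(x in S n) (g x)%:E <= (M - G a)%:E)%E.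
  rewrite (@continuous_FTC2 R g G)//.
  - by rewrite -EFinB lee_fin lerB// GM// ltW.
  - apply: continuous_in_subspaceT => z; rewrite inE/= in_itv/= => /andP[az zb].
    by apply: cg; [exact: lt_le_trans az|exact: le_lt_trans (bnb n)].
  - have cG x : a <= x -> x <= bn n -> {for x, continuous G}.
      move=> ax xb; apply: differentiable_continuous; apply/derivable1_diffP.
      apply: (@ex_derive _ _ _ _ _ _ _ (dG _ _)); first exact: lt_le_trans ax.
      exact: le_lt_trans (bnb n).
    split.
    + move=> x; rewrite in_itv/= => /andP[ax xb].
      apply: (@ex_derive _ _ _ _ _ _ _ (dG _ _)); first exact: lt_trans ax.
      exact: lt_trans (bnb n).
    + by apply: cvg_at_right_filter; apply: cG => //; exact: ltW.
    + by apply: cvg_at_left_filter; apply: cG => //; exact: ltW.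
  - move=> x; rewrite in_itv/= => /andP[ax xb].
    rewrite derive1E; apply: (@derive_val _ _ _ _ _ _ _ (dG _ _)).
      exact: lt_trans ax.
    exact: lt_trans (bnb n).
have mS n : measurable_fun (S n) (EFin \o g).
  apply/measurable_EFinP; apply: measurable_funS measurable_of_continuous_itv => //.
  by rewrite -US; exact: bigcup_sup.
rewrite -US.
have cvgS : (\int[mu]_(x in S n) (g x)%:E)%E @[n --> \oo] -->
    (\int[mu]_(x in \bigcup_n S n) (g x)%:E)%E.
  apply: (@ge0_nondecreasing_set_cvg_integral _ (measurableTypeR R) R S (EFin \o g) mu) => //.
  - move=> n m nm; apply/subsetPset => x; rewrite /S/= !in_itv/= => /andP[-> /le_trans].
    apply; rewrite /bn lerD2l lerN2 ler_wpM2l ?subr_ge0 ?(ltW ab)//.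
    by rewrite lef_pV2 ?posrE// ler_nat.
  - by move=> n; exact: measurable_itv.
  - move=> n x; rewrite /S/= in_itv/= => /andP[ax xb].
    by rewrite lee_fin g0// (le_lt_trans xb).
rewrite -(cvg_lim _ cvgS)//; apply: lime_le.
  by apply/cvg_ex; exists (\int[mu]_(x in \bigcup_n S n) (g x)%:E)%E.
by apply: nearW => n; exact: SE.
Qed.

End SingularFTC.

(** * Height and length of geodesics *)

Section GeodesicIntegrals.
Context {R : realType} (f F : R -> R) (Rmax C0 eps : R).
Hypothesis geom : geometry f F Rmax C0 eps.
Notation mu := (@lebesgue_measure R).
Notation lam := (lam F).

Lemma fE x : 0 < x -> x < Rmax -> f x = expR (- F x).
Proof. by move=> x0 xR; rewrite (geom_fE geom) ?gtr0_norm. Qed.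

Lemma f_gt0 x : 0 < x -> x < Rmax -> 0 < f x.
Proof. by move=> x0 xR; rewrite fE// expR_gt0. Qed.

Lemma f_lt x y : 0 < x -> x < y -> y < Rmax -> f x < f y.
Proof.
move=> x0 xy yR; have y0 := lt_trans x0 xy; have xR := lt_trans xy yR.
rewrite !fE// ltr_expR ltrN2 -subr_gt0.
rewrite (lt_le_trans _ (F_diff_ge geom x0 (ltW xy) yR))//.
by rewrite divr_gt0 ?subr_gt0// (lam_gt0 geom).
Qed.

Lemma f_le x y : 0 < x -> x <= y -> y < Rmax -> f x <= f y.
Proof.
by move=> x0; rewrite le_eqVlt => /predU1P[->//|xy] yR; exact/ltW/f_lt.
Qed.

Lemma fsq_le x y : 0 < x -> x <= y -> y < Rmax -> f x ^+ 2 <= f y ^+ 2.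
Proof.
move=> x0 xy yR; have y0 := lt_le_trans x0 xy; have xR := le_lt_trans xy yR.
by rewrite lerXn2r ?nnegrE ?(ltW (f_gt0 _ _))// f_le.
Qed.

Lemma f_ratio x y : 0 < x -> x <= y -> y < Rmax ->
  f y <= f x * expR ((y - x) / lam x).
Proof.
move=> x0 xy yR; have y0 := lt_le_trans x0 xy; have xR := le_lt_trans xy yR.
rewrite !fE// -expRD ler_expR -lerBlDl opprK addrC.
exact: (F_diff_le geom).
Qed.

Lemma f_decay x y : 0 < x -> x <= y -> y < Rmax ->
  f x <= f y * expR (- ((y - x) / lam y)).
Proof.
move=> x0 xy yR; have y0 := lt_le_trans x0 xy; have xR := le_lt_trans xy yR.
rewrite !fE// -expRD ler_expR -opprD lerN2 addrC -lerBrDr.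
exact: (F_diff_ge geom).
Qed.

Lemma f_is_derive x : 0 < x -> x < Rmax -> is_derive x 1 f (f x * - F^`() x).
Proof.
move=> x0 xR.
have nearf : {near x, (fun y => expR (- F y)) =1 f}.
  near=> y; rewrite fE//; near: y; [exact: lt_nbhsr|exact: lt_nbhsl].
apply: near_eq_is_derive nearf _; rewrite fE//.
apply: (@is_derive1_comp _ expR (fun y => - F y)).
exact: is_deriveN (F_is_derive geom x0 xR).
Unshelve. all: by end_near. Qed.

Lemma f_continuous x : 0 < x -> x < Rmax -> {for x, continuous f}.
Proof.
move=> x0 xR; apply: differentiable_continuous; apply/derivable1_diffP.
exact: (@ex_derive _ _ _ _ _ _ _ (f_is_derive x0 xR)).
Qed.

Section Fixed.
Variables (a t : R).
Hypotheses (a0 : 0 < a) (t0 : 0 < t) (atR : a + t < Rmax).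
Let b := a + t.
Let S u := Num.sqrt (f b ^+ 2 - f u ^+ 2).
Let H u := f u ^+ 2 / S u.
Let J u := f b / S u.

Lemma b_gt0 : 0 < b. Proof. by rewrite addr_gt0. Qed.
Lemma ab : a < b. Proof. by rewrite ltrDl. Qed.
Lemma fb_gt0 : 0 < f b. Proof. by rewrite f_gt0// b_gt0. Qed.

Lemma S2_gt0 u : 0 < u -> u < b -> 0 < f b ^+ 2 - f u ^+ 2.
Proof.
move=> u0 ub; have uR := lt_trans ub atR.
by rewrite subr_gt0 ltrXn2r ?nnegrE ?ltW ?f_gt0 ?f_lt// b_gt0.
Qed.

Lemma S_gt0 u : 0 < u -> u < b -> 0 < S u.
Proof. by move=> u0 ub; rewrite sqrtr_gt0 S2_gt0. Qed.

Lemma S_le u : 0 < u -> u < b -> S u <= f b.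
Proof.
move=> u0 ub; rewrite -[leRHS]ger0_norm ?(ltW fb_gt0)// -sqrtr_sqr.
by rewrite ler_wsqrtr// gerBl sqr_ge0.
Qed.

Lemma S2E u : 0 < u -> u < b -> f u ^+ 2 = f b ^+ 2 - S u ^+ 2.
Proof. by move=> u0 ub; rewrite sqr_sqrtr ?ltW ?S2_gt0//; ring. Qed.

Lemma S_is_derive u : 0 < u -> u < b ->
  is_derive u 1 S (- (f u ^+ 2 * - F^`() u / S u)).
Proof.
move=> u0 ub; have uR := lt_trans ub atR.
have Df := f_is_derive u0 uR.
have Dff : is_derive u 1 (fun z => f b ^+ 2 - f z ^+ 2) (- (2 * f u ^+ 2 * - F^`() u)).
  have -> : (fun z => f b ^+ 2 - f z ^+ 2) = (cst (f b ^+ 2) - f * f).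
    by apply/funext => z; rewrite /= expr2.
  apply: (is_derive_eq (is_deriveB (is_derive_cst _ _ _) (is_deriveM Df Df))).
  by rewrite /GRing.scale/=; ring.
have D := @is_derive1_comp R Num.sqrt (fun z => f b ^+ 2 - f z ^+ 2)
  _ _ _ (is_derive1_sqrt (S2_gt0 u0 ub)) Dff.
apply: (is_derive_eq D); rewrite -/(S u).
by have := S_gt0 u0 ub; move: (S u) => s s0; field; rewrite gt_eqF.
Qed.

Lemma S_continuous u : 0 < u -> u < b -> {for u, continuous S}.
Proof.
move=> u0 ub; apply: differentiable_continuous; apply/derivable1_diffP.
exact: (@ex_derive _ _ _ _ _ _ _ (S_is_derive u0 ub)).
Qed.

Lemma H_continuous u : 0 < u -> u < b -> {for u, continuous H}.
Proof.
move=> u0 ub; have uR := lt_trans ub atR.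
apply: cvgM; first by apply: cvgM; exact: f_continuous.
by apply: cvgV; [rewrite gt_eqF// S_gt0|exact: S_continuous].
Qed.

Lemma J_continuous u : 0 < u -> u < b -> {for u, continuous J}.
Proof.
move=> u0 ub; apply: cvgM; first exact: cvg_cst.
by apply: cvgV; [rewrite gt_eqF// S_gt0|exact: S_continuous].
Qed.

Lemma measurable_cont (g : R -> R) (x : R) : 0 < x -> x < b ->
  (forall u, 0 < u -> u < b -> {for u, continuous g}) ->
  measurable_fun `[x, b[ g.
Proof.
move=> x0 xb cg.
apply: (@measurable_of_continuous_itv R g 0) => //.
Qed.

Lemma H_ge0 u : 0 < u -> u < b -> 0 <= H u.
Proof. by move=> u0 ub; rewrite divr_ge0 ?sqr_ge0 ?ltW ?S_gt0. Qed.

Lemma J_ge1 u : 0 < u -> u < b -> 1 <= J u.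
Proof. by move=> u0 ub; rewrite ler_pdivlMr ?S_gt0// mul1r S_le. Qed.

Lemma H_le_J u : 0 < u -> u < b -> H u <= f b * J u.
Proof.
move=> u0 ub; rewrite mulrA ler_wpM2r ?invr_ge0 ?(ltW (S_gt0 _ _))//.
have uR := lt_trans ub atR.
by rewrite -expr2 fsq_le// ltW.
Qed.

Lemma H_ge_J u : a <= u -> u < b -> f a ^+ 2 / f b * J u <= H u.
Proof.
move=> au ub; have u0 := lt_le_trans a0 au.
have uR := lt_trans ub atR.
rewrite /J mulrA divfK ?gt_eqF ?fb_gt0//.
rewrite ler_wpM2r ?invr_ge0 ?(ltW (S_gt0 _ _))//.
by rewrite fsq_le.
Qed.

(** With s = [S u] and B = [f b], f(u)^2 = B^2 - s^2, so the difference of the two sides is (B - s)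
    / B; in [J_ge] it is (B - s)^2 / (2 s B). After integration, the excess of the length over [t]
    lies between h / (2 B) and h / B, h being the height. *)
Lemma J_le u : 0 < u -> u < b -> J u <= 1 + H u / f b.
Proof.
move=> u0 ub; rewrite /H S2E// /J.
have := S_gt0 u0 ub; have := S_le u0 ub; have := fb_gt0.
move: (S u) (f b) => s B B0 sB s0.
rewrite -subr_ge0 (_ : _ - _ = (B - s) / B); last by field; rewrite !gt_eqF.
by rewrite divr_ge0 ?subr_ge0// ltW.
Qed.

Lemma J_ge u : 0 < u -> u < b -> 1 + H u / (2 * f b) <= J u.
Proof.
move=> u0 ub; rewrite /H S2E// /J.
have := S_gt0 u0 ub; have := S_le u0 ub; have := fb_gt0.
move: (S u) (f b) => s B B0 sB s0.
rewrite -subr_ge0 (_ : _ - _ = (B - s) ^+ 2 / (2 * s * B)); last by field; rewrite !gt_eqF.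
by rewrite divr_ge0 ?sqr_ge0// !mulr_ge0// ltW.
Qed.

Lemma integral_H : (\int[mu]_(u in `[a, b[) (H u)%:E <=
  (lam b * Num.sqrt (f b ^+ 2 - f a ^+ 2))%:E)%E.
Proof.
(* [H <= lam b * (- S)'], as [lam] is nondecreasing and [- S' = H / lam]. *)
have lb := lam_gt0 geom b_gt0 atR.
pose g u := lam b * (f u ^+ 2 * - F^`() u / S u).
have cg u : 0 < u -> u < b -> {for u, continuous g}.
  move=> u0 ub; have uR := lt_trans ub atR.
  apply: cvgM; first exact: cvg_cst.
  apply: cvgM; last by apply: cvgV; [rewrite gt_eqF// S_gt0|exact: S_continuous].
  apply: cvgM; first by apply: cvgM; exact: f_continuous.
  by apply: cvgN; exact: (dF_continuous geom).
have g0 u : a <= u -> u < b -> 0 <= g u.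
  move=> au ub; have u0 := lt_le_trans a0 au; have uR := lt_trans ub atR.
  rewrite mulr_ge0 ?(ltW lb)// divr_ge0 ?ltW ?S_gt0// mulr_gt0 ?exprn_gt0 ?f_gt0//.
  by rewrite oppr_gt0 (geom_dF geom).
have Hg u : a <= u -> u < b -> H u <= g u.
  move=> au ub; have u0 := lt_le_trans a0 au; have uR := lt_trans ub atR.
  rewrite /g /H -(normdF geom)// normdFE [leRHS]mulrA ler_wpM2r ?invr_ge0 ?(ltW (S_gt0 _ _))//.
  rewrite mulrCA ler_pMr ?exprn_gt0 ?f_gt0//.
  rewrite ler_pdivlMr ?(lam_gt0 geom)// mul1r (lam_ndecr geom)// ltW//.
apply: (@le_trans _ _ (\int[mu]_(u in `[a, b[) (g u)%:E)%E).
  apply: ge0_le_integral => //.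
  - by move=> u /=; rewrite in_itv/= => /andP[au ub]; rewrite lee_fin H_ge0// (lt_le_trans a0).
  - by apply/measurable_EFinP; apply: measurable_cont => //; [exact: ab|exact: H_continuous].
  - by apply/measurable_EFinP; apply: measurable_cont => //; exact: ab.
  - by move=> u /=; rewrite in_itv/= => /andP[au ub]; rewrite lee_fin Hg.
have := @integral_le_of_primitive R (fun u => - (lam b * S u)) g 0 a b 0 a0 ab _ cg g0.
rewrite sub0r opprK; apply.
- move=> u u0 ub; apply: (is_derive_eq (is_deriveN (is_deriveZ (lam b) (S_is_derive u0 ub)))).
  by rewrite /g /GRing.scale/=; ring.
- move=> u au ub; rewrite oppr_le0 mulr_ge0 ?(ltW lb)//.
  by rewrite ltW// S_gt0// (lt_le_trans a0).
Qed.

Lemma integrable_H : mu.-integrable `[a, b[ (EFin \o H).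
Proof.
apply/integrableP; split.
  by apply/measurable_EFinP; apply: measurable_cont => //; [exact: ab|exact: H_continuous].
apply: (@le_lt_trans _ _ (\int[mu]_(u in `[a, b[) (H u)%:E)%E); last first.
  exact: le_lt_trans integral_H (ltry _).
rewrite le_eqVlt; apply/orP; left; apply/eqP; apply: eq_integral => u.
rewrite inE/= in_itv/= => /andP[au ub]; rewrite ger0_norm// H_ge0//.
exact: lt_le_trans a0 au.
Qed.

Lemma mu_ab x : x < b -> mu `[x, b[ = (b - x)%:E.
Proof. by move=> xb; rewrite lebesgue_measure_itv/= lte_fin xb. Qed.

Lemma integrable_cst_ab (c : R) : mu.-integrable `[a, b[ (EFin \o cst c).
Proof.
apply/integrableP; split; first by apply/measurable_EFinP; exact: measurable_cst.
by rewrite /= integral_cst//= mu_ab ?ab// -EFinM ltry.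
Qed.

Lemma integrable_1H (c : R) : mu.-integrable `[a, b[ (EFin \o (fun u => 1 + c * H u)).
Proof.
rewrite (_ : _ \o _ = (fun u => (cst 1 u)%:E + (c%:E * (H u)%:E))%E)//.
apply: integrableD => //; first exact: integrable_cst_ab.
by apply: integrableZl => //; exact: integrable_H.
Qed.

Lemma integrable_J : mu.-integrable `[a, b[ (EFin \o J).
Proof.
apply: le_integrable (integrable_1H (f b)^-1) => //.
  by apply/measurable_EFinP; apply: measurable_cont => //; [exact: ab|exact: J_continuous].
move=> u /=; rewrite in_itv/= => /andP[au ub]; have u0 := lt_le_trans a0 au.
rewrite !ger0_norm ?lee_fin.
- by rewrite mulrC J_le.
- by rewrite addr_ge0// mulr_ge0 ?H_ge0// invr_ge0 ltW// fb_gt0.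
- by rewrite (le_trans _ (J_ge1 u0 ub)).
Qed.

(** The denominator vanishes at the right endpoint; dropping this null set leaves a continuous
    integrand. *)
Lemma hstarE : hstar f a t = \int[mu]_(u in `[a, b[) H u.
Proof.
rewrite /hstar -/b Rintegral_itv_bndo_bndc//; exact: integrable_H.
Qed.

Lemma geodesic_lengthE : geodesic_length f a t = \int[mu]_(u in `[a, b[) J u.
Proof.
rewrite /geodesic_length -/b Rintegral_itv_bndo_bndc//; exact: integrable_J.
Qed.

Lemma hstar_le_lam_sqrt : hstar f a t <= lam b * Num.sqrt (f b ^+ 2 - f a ^+ 2).
Proof.
rewrite hstarE /Rintegral -lee_fin fineK; first exact: integral_H.
by apply: integrable_fin_num => //; exact: integrable_H.
Qed.

Lemma Rintegral_1H (c : R) :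
  (\int[mu]_(u in `[a, b[) (1 + c * H u))%R = t + c * hstar f a t.
Proof.
rewrite RintegralD//; last 2 first.
  exact: integrable_cst_ab.
  rewrite (_ : _ \o _ = (fun u => (c%:E * (H u)%:E))%E)//.
  by apply: integrableZl => //; exact: integrable_H.
rewrite RintegralZl//; last exact: integrable_H.
rewrite -hstarE; congr +%R.
by rewrite Rintegral_cst//= mu_ab ?ab//= mul1r /b addrAC subrr add0r.
Qed.

Lemma geodesic_length_le : geodesic_length f a t <= t + hstar f a t / f b.
Proof.
rewrite geodesic_lengthE mulrC -Rintegral_1H le_Rintegral//.
- exact: integrable_J.
- exact: integrable_1H.
- move=> u; rewrite /= in_itv/= => /andP[au ub].
  by rewrite [_ * H u]mulrC J_le// (lt_le_trans a0).
Qed.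

Lemma geodesic_length_ge : t + hstar f a t / (2 * f b) <= geodesic_length f a t.
Proof.
rewrite geodesic_lengthE [_ / (2 * f b)]mulrC -Rintegral_1H le_Rintegral//.
- exact: integrable_1H.
- exact: integrable_J.
- move=> u; rewrite /= in_itv/= => /andP[au ub].
  by rewrite [_ * H u]mulrC J_ge// (lt_le_trans a0).
Qed.

Lemma hstar_le_length : hstar f a t <= f b * geodesic_length f a t.
Proof.
rewrite geodesic_lengthE hstarE -RintegralZl//; last exact: integrable_J.
apply: le_Rintegral => //.
- exact: integrable_H.
- rewrite (_ : _ \o _ = (fun u => ((f b)%:E * (J u)%:E))%E)//.
  by apply: integrableZl => //; exact: integrable_J.
- move=> u; rewrite /= in_itv/= => /andP[au ub].
  by rewrite H_le_J// (lt_le_trans a0).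
Qed.

Lemma hstar_ge_length : f a ^+ 2 / f b * geodesic_length f a t <= hstar f a t.
Proof.
rewrite geodesic_lengthE hstarE -RintegralZl//; last exact: integrable_J.
apply: le_Rintegral => //.
- rewrite (_ : _ \o _ = (fun u => ((f a ^+ 2 / f b)%:E * (J u)%:E))%E)//.
  by apply: integrableZl => //; exact: integrable_J.
- exact: integrable_H.
- by move=> u; rewrite /= in_itv/= => /andP[au ub]; rewrite H_ge_J.
Qed.

(** On [[u0, b[] the integrand is at least f(u0)^2 / f(b), because [f] is nondecreasing and [S] is
    at most [f b]. The bound is useful when b - u0 is of order min(t, lam b), where f(u0) is still
    comparable to f(b). *)
Lemma hstar_ge_rect u0 : a <= u0 -> u0 < b -> (b - u0) * (f u0 ^+ 2 / f b) <= hstar f a t.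
Proof.
move=> au0 u0b; have u00 := lt_le_trans a0 au0; have u0R := lt_trans u0b atR.
rewrite hstarE /Rintegral -lee_fin fineK; last first.
  by apply: integrable_fin_num => //; exact: integrable_H.
have -> : ((b - u0) * (f u0 ^+ 2 / f b))%:E =
    (\int[mu]_(u in `[u0, b[) (f u0 ^+ 2 / f b)%:E)%E.
  by rewrite integral_cst//= mu_ab// -EFinM mulrC.
apply: (@le_trans _ _ (\int[mu]_(u in `[u0, b[) (H u)%:E)%E).
  apply: ge0_le_integral => //.
  - by move=> u _; rewrite lee_fin divr_ge0 ?sqr_ge0// ltW// fb_gt0.
  - by apply/measurable_EFinP; apply: measurable_cont => //; exact: H_continuous.
  move=> u /=; rewrite in_itv/= => /andP[ubu ub]; rewrite lee_fin.
  have uu0 := lt_le_trans u00 ubu.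
  have uR := lt_trans ub atR.
  apply: ler_pM; rewrite ?sqr_ge0 ?invr_ge0 ?(ltW fb_gt0)//.
    by rewrite fsq_le.
  by rewrite lef_pV2 ?posrE ?fb_gt0 ?S_gt0// S_le.
apply: ge0_subset_integral => //.
- by apply/measurable_EFinP; apply: measurable_cont => //; [exact: ab|exact: H_continuous].
- by move=> u /=; rewrite in_itv/= => /andP[au ub]; rewrite lee_fin H_ge0// (lt_le_trans a0).
- by apply: subset_itvr; rewrite bnd_simp.
Qed.

End Fixed.
End GeodesicIntegrals.

(** * The substitution u = a + t v *)

Section Affine.
Context {R : realType}.
Notation mu := (@lebesgue_measure R).

Let phi (a t : R) : measurableTypeR R -> measurableTypeR R := fun v => a + t * v.

Lemma measurable_phi a t : measurable_fun setT (phi a t).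
Proof.
by apply: measurable_funD => //; apply: measurable_funM.
Qed.

Let m (a t : R) (t0 : 0 < t) : {measure set (measurableTypeR R) -> \bar R} :=
  mscale (NngNum (ltW t0))
    (measure_function_pushforward__canonical__measure_function_Measure mu (measurable_phi a t)).

(** Lebesgue measure is determined by its values on the intervals []x, y]], and the pushforward
    under v -> a + t v, multiplied by t, has the same values there. *)
Lemma lebesgue_measure_affine (a t : R) (t0 : 0 < t) (A : set (measurableTypeR R)) :
  measurable A -> mu A = m a t0 A.
Proof.
move=> mA; rewrite (@lebesgue_measure_unique R (m a t0))// => X [[x y] _ <-]/=.
rewrite /m/= /mscale/= /pushforward/=.
rewrite (_ : _ @^-1` _ = `](x - a) / t, (y - a) / t]%classic); last first.
  apply/seteqP; split => v /=; rewrite !in_itv/= => /andP[xv vy]; apply/andP; split.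
  - by rewrite ltr_pdivrMr// ltrBlDl mulrC.
  - by rewrite ler_pdivlMr// lerBrDl mulrC.
  - by move: xv; rewrite ltr_pdivrMr// ltrBlDl mulrC.
  - by move: vy; rewrite ler_pdivlMr// lerBrDl mulrC.
rewrite !lebesgue_measure_itv/= !lte_fin ltr_pM2r ?invr_gt0// ltrD2r.
case: ifPn => _; last by rewrite mule0.
by rewrite -!EFinB -EFinM; congr EFin; field; rewrite gt_eqF.
Qed.

Lemma integral_affine (a t : R) (g : R -> R) : 0 < t ->
  measurable_fun `[a, a + t[ g -> (forall x, a <= x -> x < a + t -> 0 <= g x) ->
  (\int[mu]_(x in `[a, (a + t)%R[) (g x)%:E =
   t%:E * \int[mu]_(v in `[0%R, 1%R[) (g (a + t * v))%:E)%E.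
Proof.
move=> t0 mg g0.
have mE : measurable_fun (`[a, a + t[%classic : set (measurableTypeR R)) (fun x : R => (g x)%:E).
  exact/measurable_EFinP.
have gE : forall x : measurableTypeR R, `[a, a + t[%classic x -> (0 <= (g x)%:E)%E.
  by move=> x /=; rewrite in_itv/= => /andP[ax xt]; rewrite lee_fin g0.
rewrite (@eq_measure_integral _ (measurableTypeR R) R _ (m a t0)); last first.
  by move=> A mA _; rewrite -lebesgue_measure_affine.
rewrite ge0_integral_mscale//=.
congr (_ * _)%E.
have mp := measurable_phi a t.
rewrite ge0_integral_pushforward//; last first.
  by move=> y; rewrite inE => /gE.
rewrite (_ : _ @^-1` _ = `[0, 1[%classic)//.
apply/seteqP; split => v /=; rewrite !in_itv/= /phi.
  by rewrite lerDl pmulr_rge0// ltrD2l gtr_pMr.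
by rewrite lerDl pmulr_rge0// ltrD2l gtr_pMr.
Qed.

(** This is the dominating function for the rescaled integrands; its primitive - 2 K sqrt(1 - v) is
    bounded above by 0. *)
Lemma integrable_invsqrt (K : R) : 0 <= K ->
  mu.-integrable `[0, 1[ (EFin \o (fun v : R => K / Num.sqrt (1 - v))).
Proof.
move=> K0.
have D (v : R) : v < 1 -> is_derive v 1 (fun v : R => Num.sqrt (1 - v))
  (- (2 * Num.sqrt (1 - v))^-1).
  move=> v1.
  have Dl : is_derive v 1 (fun z : R => 1 - z) (-1).
    by apply: (is_derive_eq (is_deriveB (is_derive_cst (1 : R) v 1) (is_derive_id v 1)));
      rewrite sub0r.
  have s0 : 0 < 1 - v by rewrite subr_gt0.
  apply: (is_derive_eq (@is_derive1_comp R Num.sqrt (fun z => 1 - z) _ _ _ (is_derive1_sqrt s0)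
    Dl)).
  by rewrite mulrN1.
have S0 (v : R) : v < 1 -> 0 < Num.sqrt (1 - v) by move=> v1; rewrite sqrtr_gt0 subr_gt0.
have cg (v : R) : -1 < v -> v < 1 -> {for v, continuous (fun v : R => K / Num.sqrt (1 - v))}.
  move=> _ v1; apply: cvgM; first exact: cvg_cst.
  apply: cvgV; first by rewrite gt_eqF// S0.
  suff : {for v, continuous (fun z : R => Num.sqrt (1 - z))} by [].
  apply: differentiable_continuous; apply/derivable1_diffP.
  exact: (@ex_derive _ _ _ _ _ _ _ (D v v1)).
have g0 (v : R) : 0 <= v -> v < 1 -> 0 <= K / Num.sqrt (1 - v).
  by move=> _ v1; rewrite divr_ge0// ltW// S0.
have N10 : -1 < 0 :> R by rewrite ltrN10.
apply/integrableP; split.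
  apply/measurable_EFinP; exact: measurable_of_continuous_itv N10 cg.
rewrite (_ : (\int[mu]_(x in _) _)%E = (\int[mu]_(v in `[0%R, 1%R[)
  (K / Num.sqrt (1 - v))%:E)%E); last first.
  apply: eq_integral => v; rewrite inE/= in_itv/= => /andP[v0 v1].
  by rewrite ger0_norm// g0.
have dG : forall x : R, -1 < x -> x < 1 -> is_derive x 1 (fun v : R => - (2 * K)
  * Num.sqrt (1 - v)) (K / Num.sqrt (1 - x)).
  move=> v _ v1; apply: (is_derive_eq (is_deriveZ (- (2 * K)) (D v v1))).
  by rewrite /GRing.scale/=; field; rewrite gt_eqF// S0.
have GM : forall x : R, 0 <= x -> x < 1 -> - (2 * K) * Num.sqrt (1 - x) <= 0.
  by move=> v _ v1; rewrite mulNr oppr_le0 !mulr_ge0// ltW// S0.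
apply: (le_lt_trans (integral_le_of_primitive N10 ltr01 dG cg g0 GM)).
by rewrite ltry.
Qed.

End Affine.

(** Infinite values of [X] are no exception, since [fine] sends both infinities to 0. *)
Lemma fine_mulr {R : realType} (t : R) (X : \bar R) : 0 < t ->
  fine (t%:E * X)%E = t * fine X.
Proof.
move=> t0; case: X => [x||] //=.
  by rewrite gt0_muley ?lte_fin//= mulr0.
by rewrite gt0_muleNy ?lte_fin//= mulr0.
Qed.

(** * Dependence on the turning point, and existence of r* *)

Section Continuity.
Context {R : realType} (f F : R -> R) (Rmax C0 eps : R).
Hypothesis geom : geometry f F Rmax C0 eps.
Notation mu := (@lebesgue_measure R).
Notation lam := (lam F).
Variables (a : R).
Hypotheses (a0 : 0 < a).

Let j (t v : R) := f (a + t) / Num.sqrt (f (a + t) ^+ 2 - f (a + t * v) ^+ 2).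
Let hh (t v : R) := f (a + t * v) ^+ 2 / Num.sqrt (f (a + t) ^+ 2 - f (a + t * v) ^+ 2).

Lemma scaled_pos t v : 0 < t -> 0 <= v -> v < 1 -> 0 < a + t * v /\ a + t * v < a + t.
Proof.
by move=> t0 v0 v1; rewrite ltr_wpDr ?mulr_ge0 ?(ltW t0)// ltrD2l gtr_pMr.
Qed.

Lemma geodesic_length_scaled t : 0 < t -> a + t < Rmax ->
  geodesic_length f a t = t * \int[mu]_(v in `[0%R, 1%R[) j t v.
Proof.
move=> t0 atR; rewrite (geodesic_lengthE geom a0 t0 atR) /Rintegral integral_affine//.
- exact: fine_mulr.
- by apply: (measurable_cont a0 _ (J_continuous geom atR)) => //; rewrite ltrDl.
- move=> x ax xat; have x0 := lt_le_trans a0 ax.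
  exact: le_trans ler01 (J_ge1 geom a0 t0 atR x0 xat).
Qed.

Lemma hstar_scaled t : 0 < t -> a + t < Rmax ->
  hstar f a t = t * \int[mu]_(v in `[0%R, 1%R[) hh t v.
Proof.
move=> t0 atR; rewrite (hstarE geom a0 t0 atR) /Rintegral integral_affine//.
- exact: fine_mulr.
- by apply: (measurable_cont a0 _ (H_continuous geom atR)) => //; rewrite ltrDl.
- move=> x ax xat; have x0 := lt_le_trans a0 ax.
  exact: (H_ge0 geom atR x0 xat).
Qed.

(** The number m = t0 / lam (a + T) bounds t / lam (a + t) from below for all t in [t0, T]. Hence
    f(a + t v) is at most f(a + t) exp(- m (1 - v)). Using exp(z) >= 1 + z, and m (1 - v) <= m in
    the denominator, the difference of squares is at least f(a + t)^2 (1 - v) 2 m / (1 + 2 m). The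
    singularity is thus that of 1 / sqrt(1 - v), uniformly in t. *)
Lemma length_density_le t0 T t v : 0 < t0 -> t0 <= t -> t <= T -> a + T < Rmax -> 0 <= v -> v < 1 ->
  j t v <= Num.sqrt ((1 + 2 * (t0 / lam (a + T))) / (2 * (t0 / lam (a + T)))) / Num.sqrt (1 - v).
Proof.
move=> t00 t0t tT aTR v0 v1.
have tp := lt_le_trans t00 t0t.
have atT : a + t <= a + T by rewrite lerD2l.
have atR := le_lt_trans atT aTR.
have [p0 pl] := scaled_pos tp v0 v1.
have at0 : 0 < a + t := lt_trans p0 pl.
have lT : 0 < lam (a + T) by rewrite (lam_gt0 geom)// (lt_le_trans at0).
have lt' := lam_gt0 geom at0 atR.
have fb := f_gt0 geom at0 atR.
set m := t0 / lam (a + T); have m0 : 0 < m by rewrite divr_gt0.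
set x := t * (1 - v) / lam (a + t).
have x0 : 0 < x by rewrite divr_gt0// mulr_gt0// subr_gt0.
have mx : m * (1 - v) <= x.
  have v1' : 0 <= 1 - v by rewrite subr_ge0 ltW.
  rewrite /m /x mulrAC; apply: ler_pM.
  - by rewrite mulr_ge0// ltW.
  - by rewrite invr_ge0 ltW.
  - by rewrite ler_wpM2r.
  - by rewrite lef_pV2// (lam_ndecr geom).
have fa : f (a + t * v) <= f (a + t) * expR (- x).
  have := f_decay geom p0 (ltW pl) atR.
  by rewrite (_ : a + t - (a + t * v) = t * (1 - v)) //; ring.
have fa0 := f_gt0 geom p0 (lt_trans pl atR).
have y0 : 0 < m * (1 - v) by rewrite mulr_gt0// subr_gt0.
have y1 : m * (1 - v) <= m by rewrite ger_pMr// gerBl.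
have d0 : 0 < 1 + 2 * m by rewrite addr_gt0// mulr_gt0.
have d1 : 0 < 1 + 2 * (m * (1 - v)) by rewrite addr_gt0// mulr_gt0.
have dx : 0 < 1 + 2 * x by rewrite addr_gt0// mulr_gt0.
have key : f (a + t) ^+ 2 * (2 * m / (1 + 2 * m) * (1 - v)) <=
   f (a + t) ^+ 2 - f (a + t * v) ^+ 2.
  have e2 : f (a + t * v) ^+ 2 <= f (a + t) ^+ 2 * (1 + 2 * x)^-1.
    apply: (@le_trans _ _ ((f (a + t) * expR (- x)) ^+ 2)).
      by rewrite lerXn2r ?nnegrE ?mulr_ge0 ?expR_ge0 ?(ltW fa0) ?(ltW fb).
    rewrite exprMn ler_wpM2l ?sqr_ge0// -expRM_natl mulrN expRN.
    rewrite lef_pV2 ?posrE ?expR_gt0//.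
    exact: expR_ge1Dx.
  rewrite lerBrDr -lerBrDl (le_trans e2)// -[X in _ <= X - _]mulr1 -mulrBr.
  rewrite ler_wpM2l ?sqr_ge0//.
  apply: (@le_trans _ _ (1 + 2 * (m * (1 - v)))^-1).
    by rewrite lef_pV2 ?posrE// lerD2l ler_pM2l.
  rewrite -subr_ge0.
  rewrite (_ : _ - _ = (2 * m * (1 - v)) * (2 * m - 2 * (m * (1 - v))) / ((1 + 2 * m)
    * (1 + 2 * (m * (1 - v))))); last first.
    by field; rewrite !gt_eqF.
  rewrite divr_ge0//; last by rewrite mulr_ge0 ?ltW.
  apply: mulr_ge0; first by rewrite -mulrA mulr_ge0// ltW.
  by rewrite subr_ge0 ler_pM2l.
have c0 : 0 < 2 * m / (1 + 2 * m) by apply: divr_gt0 => //; apply: mulr_gt0.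
have v10 : 0 < 1 - v by rewrite subr_gt0.
rewrite /j.
have -> : Num.sqrt ((1 + 2 * m) / (2 * m)) / Num.sqrt (1 - v) =
    f (a + t) / Num.sqrt (f (a + t) ^+ 2 * (2 * m / (1 + 2 * m) * (1 - v))).
  rewrite (sqrtrM _ (sqr_ge0 (f (a + t)))) (sqrtrM _ (ltW c0)) sqrtr_sqr (ger0_norm (ltW fb)).
  rewrite -(invf_div (2 * m)) sqrtrV ?(ltW c0)//.
  field.
  by rewrite !gt_eqF ?sqrtr_gt0.
rewrite ler_wpM2l ?(ltW fb)// lef_pV2 ?posrE ?sqrtr_gt0.
- by rewrite ler_wsqrtr.
- by apply: lt_le_trans key; apply: mulr_gt0; [exact: exprn_gt0|exact: mulr_gt0].
- by apply: mulr_gt0; [exact: exprn_gt0|exact: mulr_gt0].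
Qed.

Lemma continuous_affine (v : R) : continuous (fun t : R => a + t * v).
Proof.
by move=> t; apply: cvgD; [exact: cvg_cst|apply: cvgM; [exact: cvg_id|exact: cvg_cst]].
Qed.

Lemma continuous_f_affine (v t : R) : 0 < a + t * v -> a + t * v < Rmax ->
  {for t, continuous (fun t : R => f (a + t * v))}.
Proof.
move=> p0 pR; apply: (@continuous_comp _ _ _ (fun t : R => a + t * v) f).
  exact: continuous_affine.
exact: (f_continuous geom).
Qed.

Lemma continuous_denom v t : 0 <= v -> v < 1 -> 0 < t -> a + t < Rmax ->
  {for t, continuous (fun t => (Num.sqrt (f (a + t) ^+ 2 - f (a + t * v) ^+ 2))^-1)}.
Proof.
move=> v0 v1 t0 atR; have [p0 pl] := scaled_pos t0 v0 v1.
have s0 := S_gt0 geom atR p0 pl.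
apply: cvgV; first by rewrite gt_eqF.
apply: (@continuous_comp _ _ _ (fun t => f (a + t) ^+ 2 - f (a + t * v) ^+ 2) Num.sqrt);
  last exact: sqrt_continuous.
have := @continuous_f_affine v t p0 (lt_trans pl atR).
have := @continuous_f_affine 1 t; rewrite mulr1 => /(_ (lt_trans p0 pl) atR).
under [X in {for t, continuous X} -> _]eq_fun do rewrite mulr1.
by move=> c1 cv; apply: cvgB; apply: cvgM.
Qed.

Lemma continuous_length_density t v : 0 <= v -> v < 1 -> 0 < t -> a + t < Rmax ->
  {for t, continuous (j ^~ v)}.
Proof.
move=> v0 v1 t0 atR; have [p0 pl] := scaled_pos t0 v0 v1.
apply: cvgM; last exact: continuous_denom.
have := @continuous_f_affine 1 t; rewrite mulr1 => /(_ (lt_trans p0 pl) atR).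
by under [X in {for t, continuous X} -> _]eq_fun do rewrite mulr1.
Qed.

Lemma continuous_height_density t v : 0 <= v -> v < 1 -> 0 < t -> a + t < Rmax ->
  {for t, continuous (hh ^~ v)}.
Proof.
move=> v0 v1 t0 atR; have [p0 pl] := scaled_pos t0 v0 v1.
apply: cvgM; last exact: continuous_denom.
by have := @continuous_f_affine v t p0 (lt_trans pl atR) => c; apply: cvgM.
Qed.

(* The substitution [u = a + t v] makes the domain of integration independent of [t],
   with an integrable bound locally uniform in [t]. *)
Lemma continuous_scaled (g : R -> R -> R) (t : R) :
  0 < t -> a + t < Rmax ->
  (forall t v, 0 <= v -> v < 1 -> 0 < t -> a + t < Rmax -> {for t, continuous (g ^~ v)}) ->
  (forall t, 0 < t -> a + t < Rmax -> measurable_fun (`[0, 1[%classic : set R) (g t)) ->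
  (forall t0 T, 0 < t0 -> 0 < T -> a + T < Rmax -> exists2 K, 0 <= K &
     forall t v, t0 <= t -> t <= T -> 0 <= v -> v < 1 -> `|g t v| <= K / Num.sqrt (1 - v)) ->
  {for t, continuous (fun t : R => t * \int[mu]_(v in `[0%R, 1%R[) g t v)}.
Proof.
move=> t0 atR cg mg bg.
pose T := (t + (Rmax - a)) / 2.
have tT : t < T by rewrite /T ltr_pdivlMr//; lra.
have aTR : a + T < Rmax by rewrite /T -ltrBrDl ltr_pdivrMr//; lra.
have T0 := lt_trans t0 tT.
have t2 : 0 < t / 2 by rewrite divr_gt0.
have [C Cge0 HC] := bg (t / 2) T t2 T0 aTR.
apply: cvgM; first exact: cvg_id.
have H := @continuity_under_integral R _ (measurableTypeR R) mu g `[0, 1[ (measurable_itv _)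
  (t / 2) T.
have tI : t \in `]t / 2, T[%classic by rewrite inE/= in_itv/= tT andbT; lra.
have dom u : `]t / 2, T[%classic u -> [/\ 0 < u, a + u < Rmax, t / 2 <= u & u <= T].
  rewrite /= in_itv/= => /andP[tu uT]; split => //; try exact: ltW.
    exact: lt_trans tu.
  by rewrite (lt_trans _ aTR)// ltrD2l.
apply: (H _ _ (fun v => C / Num.sqrt (1 - v))) tI => //.
- move=> u /dom[u0 uR tu uT]; apply: le_integrable (integrable_invsqrt Cge0) => //.
    by apply/measurable_EFinP; exact: mg.
  move=> v; rewrite /= in_itv/= => /andP[v0 v1]; rewrite lee_fin.
  by rewrite [leRHS]ger0_norm ?HC// divr_ge0// sqrtr_ge0.
- apply: aeW => v; rewrite /= in_itv/= => /andP[v0 v1] u.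
  by rewrite inE => /dom[u0 uR _ _]; exact: cg.
- exact: integrable_invsqrt.
- move=> u /dom[u0 uR tu uT]; apply: aeW => v; rewrite /= in_itv/= => /andP[v0 v1].
  exact: HC.
Qed.

Lemma length_density_le_unif t0 T : 0 < t0 -> a + T < Rmax -> exists2 K, 0 <= K &
  forall t v, t0 <= t -> t <= T -> 0 <= v -> v < 1 -> `|j t v| <= K / Num.sqrt (1 - v).
Proof.
move=> t00 aTR; eexists; last first.
  move=> t v t0t tT v0 v1.
  have tp := lt_le_trans t00 t0t.
  have atR : a + t < Rmax by rewrite (le_lt_trans _ aTR)// lerD2l.
  have [p0 pl] := scaled_pos tp v0 v1.
  rewrite ger0_norm; first exact: (@length_density_le t0 T).
  exact: le_trans ler01 (J_ge1 geom a0 tp atR p0 pl).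
exact: sqrtr_ge0.
Qed.

Lemma measurable_comp_affine t (g : R -> R) : 0 < t ->
  measurable_fun `[a, a + t[ g ->
  measurable_fun (`[0, 1[%classic : set R) (fun v => g (a + t * v)).
Proof.
move=> t0 mg; apply: (measurable_comp (F := `[a, a + t[%classic : set R)) => //.
  move=> _ /= [v + <-]; rewrite /= !in_itv/= => /andP[v0 v1].
  by rewrite lerDl pmulr_rge0// v0 ltrD2l gtr_pMr.
by apply: measurable_funD => //; apply: measurable_funM.
Qed.

Lemma geodesic_length_continuous t : 0 < t -> a + t < Rmax ->
  {for t, continuous (geodesic_length f a)}.
Proof.
move=> t0 atR.
have nt : {near t, (fun t => t * \int[mu]_(v in `[0%R, 1%R[) j t v) =1 geodesic_length f a}.
  near=> u; rewrite geodesic_length_scaled//; near: u; first exact: lt_nbhsr.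
  have : t < Rmax - a by rewrite ltrBrDl.
  by move=> /lt_nbhsl; apply: filterS => u; rewrite ltrBrDl.
suff H : {for t, continuous (fun t : R => t * \int[mu]_(v in `[0%R, 1%R[) j t v)}.
  rewrite /prop_for /continuous_at (geodesic_length_scaled t0 atR).
  by apply: cvg_trans H; exact: near_eq_cvg.
apply: continuous_scaled t0 atR continuous_length_density _ _.
- move=> {nt t}t t0 atR.
  apply: (@measurable_comp_affine t (fun u => f (a + t) / Num.sqrt (f (a + t) ^+ 2 - f u ^+ 2)) t0).
  by apply: (measurable_cont a0 _ (J_continuous geom atR)) => //; rewrite ltrDl.
- by move=> ? ? ? _ ?; exact: length_density_le_unif.
Unshelve. all: by end_near. Qed.

Lemma hstar_continuous t : 0 < t -> a + t < Rmax ->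
  {for t, continuous (hstar f a)}.
Proof.
move=> t0 atR.
have nt : {near t, (fun t => t * \int[mu]_(v in `[0%R, 1%R[) hh t v) =1 hstar f a}.
  near=> u; rewrite hstar_scaled//; near: u; first exact: lt_nbhsr.
  have : t < Rmax - a by rewrite ltrBrDl.
  by move=> /lt_nbhsl; apply: filterS => u; rewrite ltrBrDl.
suff H : {for t, continuous (fun t : R => t * \int[mu]_(v in `[0%R, 1%R[) hh t v)}.
  rewrite /prop_for /continuous_at (hstar_scaled t0 atR).
  by apply: cvg_trans H; exact: near_eq_cvg.
apply: continuous_scaled t0 atR continuous_height_density _ _.
- move=> {nt t}t t0 atR.
  apply: (@measurable_comp_affine t (fun u => f u ^+ 2 / Num.sqrt (f (a + t) ^+ 2 - f u ^+ 2)) t0).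
  by apply: (measurable_cont a0 _ (H_continuous geom atR)) => //; rewrite ltrDl.
- move=> u T u0 T0 aTR; have [K K0 HK] := @length_density_le_unif u T u0 aTR.
  have aT0 : 0 < a + T by rewrite addr_gt0.
  have fT := f_gt0 geom aT0 aTR.
  exists (f (a + T) * K); first by rewrite mulr_ge0// ltW.
  move=> z v uz zT v0 v1; have z0 := lt_le_trans u0 uz.
  have azT : a + z <= a + T by rewrite lerD2l.
  have azR : a + z < Rmax by rewrite (le_lt_trans azT).
  have [p0 pl] := scaled_pos z0 v0 v1.
  rewrite ger0_norm; last exact: (H_ge0 geom azR p0 pl).
  apply: (le_trans (H_le_J geom azR p0 pl)); rewrite -mulrA.
  apply: ler_pM.
  - by rewrite ltW// (f_gt0 geom)// (lt_trans p0).
  - exact: le_trans ler01 (J_ge1 geom a0 z0 azR p0 pl).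
  - by rewrite (f_le geom)// (lt_trans p0).
  - exact: le_trans (ler_norm _) (HK z v uz zT v0 v1).
Unshelve. all: by end_near. Qed.

Lemma hstar_gt0 t : 0 < t -> a + t < Rmax -> 0 < hstar f a t.
Proof.
move=> t0 atR; have at0 : 0 < a + t by rewrite addr_gt0.
have aa : a < a + t by rewrite ltrDl.
apply: lt_le_trans (hstar_ge_rect geom a0 t0 atR (lexx _) aa).
rewrite addrAC subrr add0r mulr_gt0// divr_gt0 ?exprn_gt0 ?(f_gt0 geom)//.
exact: lt_trans atR.
Qed.

Lemma geodesic_length_gt t : 0 < t -> a + t < Rmax -> t < geodesic_length f a t.
Proof.
move=> t0 atR; apply: lt_le_trans (geodesic_length_ge geom a0 t0 atR).
have at0 : 0 < a + t by rewrite addr_gt0.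
by rewrite ltrDl divr_gt0 ?hstar_gt0 ?mulr_gt0 ?(f_gt0 geom).
Qed.

Lemma hstar_le_lam_f t : 0 < t -> a + t < Rmax ->
  hstar f a t <= lam (a + t) * f (a + t).
Proof.
move=> t0 atR; have at0 : 0 < a + t by rewrite addr_gt0.
rewrite (le_trans (hstar_le_lam_sqrt geom a0 t0 atR))//.
rewrite ler_wpM2l ?(ltW (lam_gt0 geom _ _))//.
by apply: (S_le geom a0 t0 atR) => //; rewrite ltrDl.
Qed.

(** From f(a) >= f(a + t) exp(- t / lam a) and exp(- 2 z) >= 1 - 2 z one gets f(a + t)^2 - f(a)^2 <=
    (2 t / lam a) f(a + t)^2. Unlike [hstar_le_lam_f], this makes the ratio of height to f(a + t)
    small for small [t], which the existence of r* and the lower bound on it both rest on. *)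
Lemma hstar_le_sqrt t : 0 < t -> a + t < Rmax ->
  hstar f a t <= lam (a + t) * f (a + t) * Num.sqrt (2 * t / lam a).
Proof.
move=> t0 atR; have at0 : 0 < a + t by rewrite addr_gt0.
have aR : a < Rmax by rewrite (lt_trans _ atR)// ltrDl.
have fb := f_gt0 geom at0 atR; have la := lam_gt0 geom a0 aR.
rewrite (le_trans (hstar_le_lam_sqrt geom a0 t0 atR))// -mulrA.
rewrite ler_wpM2l ?(ltW (lam_gt0 geom _ _))//.
rewrite -[X in X * _]ger0_norm ?(ltW fb)// -sqrtr_sqr -sqrtrM ?sqr_ge0//.
rewrite ler_wsqrtr//.
have fa : f (a + t) * expR (- (t / lam a)) <= f a.
  have aat : a <= a + t by rewrite lerDl ltW.
  have := f_ratio geom a0 aat atR.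
  by rewrite (_ : a + t - a = t) ?expRN ?ler_pdivrMr ?expR_gt0//; ring.
have e1 : 1 - 2 * t / lam a <= expR (- (t / lam a)) ^+ 2.
  rewrite -expRM_natl; apply: le_trans (expR_ge1Dx _).
  by rewrite mulrN mulrA.
have fa2 : f (a + t) ^+ 2 * (1 - 2 * t / lam a) <= f a ^+ 2.
  apply: (@le_trans _ _ ((f (a + t) * expR (- (t / lam a))) ^+ 2)).
    by rewrite exprMn ler_wpM2l ?sqr_ge0.
  by rewrite lerXn2r ?nnegrE ?mulr_ge0 ?expR_ge0 ?(ltW fb) ?(ltW (f_gt0 geom _ _)).
lra.
Qed.

(** Intermediate value theorem: the length exceeds s at t = s, and is at most s at a suitable small
    t1. *)
Lemma rstar_exists s : 0 < s -> a + s < Rmax ->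
  exists t, [/\ 0 < t, t < s & s = geodesic_length f a t].
Proof.
move=> s0 asR; have as0 : 0 < a + s by rewrite addr_gt0.
have aR : a < Rmax by rewrite (lt_trans _ asR)// ltrDl.
have la := lam_gt0 geom a0 aR; have ls := lam_gt0 geom as0 asR.
(* The two bounds on [t1] make each term of t1 + h / f at most s / 2: the first directly, the second
   because sqrt(2 t1 / lam a) <= sqrt q = s / (2 lam (a + s)). *)
pose q := (s / (2 * lam (a + s))) ^+ 2.
have q0 : 0 < q by rewrite exprn_gt0// divr_gt0// mulr_gt0.
pose t1 := Num.min (s / 2) (lam a / 2 * q).
have t10 : 0 < t1 by rewrite lt_min !divr_gt0//= mulr_gt0// divr_gt0.
have t1s : t1 <= s / 2 by rewrite ge_min lexx.
have t1q : t1 <= lam a / 2 * q by rewrite ge_min lexx orbT.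
have t1s' : t1 < s by lra.
have at1 : a + t1 <= a + s by rewrite lerD2l ltW.
have at1R := le_lt_trans at1 asR.
have at10 : 0 < a + t1 by rewrite addr_gt0.
have f1 := f_gt0 geom at10 at1R.
have L1 : geodesic_length f a t1 <= s.
  apply: le_trans (geodesic_length_le geom a0 t10 at1R) _.
  have H : hstar f a t1 / f (a + t1) <= s / 2.
    rewrite ler_pdivrMr// (le_trans (hstar_le_sqrt t10 at1R))// mulrAC ler_wpM2r ?(ltW f1)//.
    apply: (@le_trans _ _ (lam (a + s) * Num.sqrt q)).
      apply: ler_pM; rewrite ?sqrtr_ge0 ?(ltW (lam_gt0 geom _ _))//.
        exact: (lam_ndecr geom).
      rewrite ler_wsqrtr// ler_pdivrMr//; lra.
    rewrite sqrtr_sqr ger0_norm ?divr_ge0 ?mulr_ge0 ?(ltW ls) ?(ltW s0)//.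
    by rewrite le_eqVlt; apply/orP; left; apply/eqP; field; rewrite gt_eqF.
  lra.
have Ls := geodesic_length_gt s0 asR.
have cL : {within `[t1, s], continuous (geodesic_length f a)}.
  apply: continuous_in_subspaceT => u; rewrite inE/= in_itv/= => /andP[u1 us].
  apply: geodesic_length_continuous; first exact: lt_le_trans u1.
  by rewrite (le_lt_trans _ asR)// lerD2l.
have [|c] := IVT (ltW t1s') cL (v := s).
  by rewrite ge_min L1 le_max (ltW Ls) orbT.
rewrite in_itv/= => /andP[c1 cs] Lc; exists c; split => //.
  exact: lt_le_trans c1.
rewrite lt_neqAle cs andbT; apply/eqP => E; move: Ls; rewrite -{2}E Lc.
by rewrite ltxx.
Qed.

Lemma rstarP s : 0 < s -> a + s < Rmax ->
  [/\ 0 < rstar f a s, rstar f a s < s & s = geodesic_length f a (rstar f a s)].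
Proof.
move=> s0 asR; rewrite /rstar.
by have [t Ht] := rstar_exists s0 asR; case: xgetP => [u _ //|/(_ t)].
Qed.

End Continuity.

(** * Lipschitz functions on the line *)

Section MeasurableLimit.
Context {R : realType} d (T : measurableType d).
Variable q : T -> R -> R.
Hypothesis mq : forall h, h != 0 -> measurable_fun setT (q ^~ h).
Hypothesis cq : forall s h, h != 0 -> {for h, continuous (q s)}.

Let ratn (i : nat) : R := ratr (odflt 0 (unpickle i : option rat)).

(** Indices outside the punctured interval impose no condition, among them those that code no
    rational and get [ratn i = 0]. *)
Let E (n m i j : nat) : set T :=
  if [&& 0 < `|ratn i|, `|ratn i| < m.+1%:R^-1, 0 < `|ratn j| & `|ratn j| < m.+1%:R^-1]
  then [set s | `|q s (ratn i) - q s (ratn j)| <= n.+1%:R^-1] else setT.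

(* The Cauchy condition for [q s] at 0, which by continuity may be tested on
   rational increments only. *)
Let A : set T := \bigcap_n \bigcup_m \bigcap_i \bigcap_j E n m i j.

Lemma measurable_close_at n m i j : measurable (E n m i j).
Proof.
rewrite /E; case: ifPn => [/and4P[i0 _ j0 _]|_]; last exact: measurableT.
rewrite normr_gt0 in i0; rewrite normr_gt0 in j0.
have mf : measurable_fun setT (fun s => `|q s (ratn i) - q s (ratn j)|).
  by apply: measurableT_comp => //; apply: measurable_funB; exact: mq.
rewrite -[X in measurable X]setTI.
rewrite (_ : [set s | _] = (fun s => `|q s (ratn i) - q s (ratn j)|) @^-1` `]-oo, n.+1%:R^-1]).
  by apply: mf => //; exact: measurable_itv.
by apply/seteqP; split => s /=; rewrite in_itv.
Qed.

Lemma measurable_cauchy : measurable A.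
Proof.
apply: bigcapT_measurable => n; apply: bigcupT_measurable => m.
by apply: bigcapT_measurable => i; apply: bigcapT_measurable => j; exact: measurable_close_at.
Qed.

Lemma rat_approx s h (del eta : R) : 0 < eta -> 0 < `|h| -> `|h| < del ->
  exists i, [/\ 0 < `|ratn i|, `|ratn i| < del & `|q s h - q s (ratn i)| < eta].
Proof.
move=> eta0 h0 hdel.
have hn0 : h != 0 by rewrite -normr_gt0.
have : \forall y \near h, [/\ 0 < `|y|, `|y| < del & `|q s h - q s y| < eta].
  near=> y; split.
  - near: y; have := @norm_continuous R R^o h.
    by move=> /(@cvgr_gt R) /(_ _ h0); exact.
  - near: y; have := @norm_continuous R R^o h.
    by move=> /(@cvgr_lt R) /(_ _ hdel); exact.
  - near: y; have := @cq s h hn0; move=> /cvgrPdist_lt /(_ _ eta0); exact.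
move=> /nbhs_ballP[e /= e0 He].
have [|p] := @rat_in_itvoo R h (h + e); first by rewrite ltrDl.
rewrite in_itv/= => /andP[hp ph].
exists (pickle p); rewrite /ratn pickleK/=; apply: He.
by rewrite /ball/= ltr0_norm ?subr_lt0// opprB ltrBlDl.
Unshelve. all: by end_near. Qed.

Lemma cauchyP s : A s <-> cvg (q s h @[h --> 0^']).
Proof.
split=> [As|/cvg_cauchy /cauchy_ballP cs n _].
  apply/cauchy_cvgP/cauchy_ballP => e e0.
  have [n _ ne] : \forall n \near \oo, n.+1%:R^-1 < e.
    exact: (near_infty_natSinv_lt (PosNum e0)).
  have {ne} ne := ne n (leqnn n).
  have [m _ Hm] := As n I.
  have H h h' : 0 < `|h| -> `|h| < m.+1%:R^-1 -> 0 < `|h'| -> `|h'| < m.+1%:R^-1 ->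
      `|q s h - q s h'| <= n.+1%:R^-1.
    move=> h0 hm h'0 h'm; apply/ler_addgt0Pr => eta eta0.
    have eta2 : 0 < eta / 2 by rewrite divr_gt0.
    have [i [i0 im ie]] := rat_approx s eta2 h0 hm.
    have [j [j0 jm je]] := rat_approx s eta2 h'0 h'm.
    have := Hm i I j I; rewrite /E i0 im j0 jm/= => Hij.
    rewrite (_ : q s h - q s h' = (q s h - q s (ratn i)) +
      ((q s (ratn i) - q s (ratn j)) - (q s h' - q s (ratn j)))); last by ring.
    rewrite (le_trans (ler_normD _ _))// (le_trans (lerD (lexx _) (ler_normB _ _)))//.
    rewrite addrCA; apply: lerD => //; rewrite [leRHS]splitr; apply: lerD; exact: ltW.
  have D : 0^' [set h : R | 0 < `|h| /\ `|h| < m.+1%:R^-1].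
    exists m.+1%:R^-1 => /=; first by rewrite invr_gt0.
    by move=> h /= + hn0; rewrite /ball/= sub0r normrN normr_gt0.
  pose U := q s @` [set h : R | 0 < `|h| /\ `|h| < m.+1%:R^-1].
  have DU : (q s h @[h --> 0^']) U.
    by apply: filterS D => h ?; exists h.
  exists (U, U) => //= -[_ _] /= [[h [? ?] <-] [h' [? ?] <-]].
  by rewrite /ball/= (le_lt_trans _ ne)// H.
have n0 : (0 : R) < n.+1%:R^-1 by rewrite invr_gt0.
have [[U V] /= [[e1 /= e10 U1] [e2 /= e20 V1]] UV] := cs _ n0.
have e0 : 0 < Num.min e1 e2 by rewrite lt_min e10.
have [m _ me] : \forall m \near \oo, m.+1%:R^-1 < Num.min e1 e2.
  exact: (near_infty_natSinv_lt (PosNum e0)).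
exists m => // i _ j _; rewrite /E; case: ifPn => // /and4P[i0 im j0 jm] /=.
have {me}:= me m (leqnn m); rewrite lt_min => /andP[me1 me2].
apply: ltW; apply: (UV (_, _)); split => /=.
- by apply: U1; rewrite -?normr_gt0//= /ball/= sub0r normrN (lt_trans im).
- by apply: V1; rewrite -?normr_gt0//= /ball/= sub0r normrN (lt_trans jm).
Qed.

(** On the measurable set [A] where the limit exists, it is the pointwise limit along the increments
    1 / (n + 1). Off [A], [lim] returns its default value and is constant. *)
Lemma measurable_lim_dnbhs0 :
  measurable_fun setT (fun s => lim (q s h @[h --> 0^'])).
Proof.
rewrite -(setUv A); apply/measurable_funU; [exact: measurable_cauchy|apply: measurableC;
  exact: measurable_cauchy|].
split.
  apply: (@measurable_fun_cvg _ _ _ _ (fun n s => q s n.+1%:R^-1)).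
    move=> m; apply: measurable_funS (mq _) => //.
  move=> s /cauchyP cs; move/cvgr_dnbhsP : (cs); apply.
  split => [n|]; first by rewrite invr_neq0.
  exact: cvg_harmonic.
apply: (@eq_measurable_fun _ _ _ _ _ (cst point)); last exact: measurable_cst.
by move=> s; rewrite inE => nAs; rewrite dvgP// => /cauchyP.
Qed.

End MeasurableLimit.

Lemma measurable_derive1 {R : realType} (g : R -> R) :
  continuous g -> measurable_fun setT (derive1 g).
Proof.
move=> cg; apply: (@measurable_lim_dnbhs0 R _ R
  (fun s h => h^-1 *: (g (h + s) - g s))).
  move=> h _; apply: measurable_funM => //; apply: measurable_funB.
    apply: (@measurableT_comp _ _ _ _ _ _ g) => //.
      exact: continuous_measurable_fun.
    exact: measurable_funD.
  exact: continuous_measurable_fun.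
move=> s h h0; apply: cvgZ; first exact: cvgV.
apply: cvgB; last exact: cvg_cst.
apply: (@continuous_comp _ _ _ (fun h => h + s) g); last exact: cg.
by apply: cvgD; [exact: cvg_id|exact: cvg_cst].
Qed.

(** * Lipschitz functions as integrals of their derivatives *)

Section LipschitzFTC.
Context {R : realType}.
Notation mu := (@lebesgue_measure R).
Variables (phi : R -> R) (L : R).
Hypothesis L_gt0 : 0 < L.
Hypothesis phiL : forall x y, `|phi x - phi y| <= L * `|x - y|.

Lemma lipschitz_continuous (g : R -> R) K : 0 <= K ->
  (forall x y, `|g x - g y| <= K * `|x - y|) -> continuous g.
Proof.
move=> K0 gK x; apply/cvgrPdist_le => e e0; near=> y.
rewrite (le_trans (gK _ _))//.
have : `|x - y| <= e / (K + 1).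
  near: y; have /cvgrPdist_le : id y @[y --> x] --> x by exact: cvg_id.
  by apply; rewrite divr_gt0// ltr_wpDl.
have K1 : 0 < K + 1 by rewrite ltr_wpDl.
rewrite ler_pdivlMr// mulrC => H; apply: le_trans H.
by rewrite ler_wpM2r// lerDl.
Unshelve. all: by end_near. Qed.

Lemma phi_continuous : continuous phi.
Proof. exact: lipschitz_continuous (ltW L_gt0) phiL. Qed.

(* The Stieltjes measures of [psi] and [chi] add up to [2 L mu], so that both have
   a density. *)
Let psi (x : R) := phi x + L * x.
Let chi (x : R) := L * x - phi x.

Lemma psi_nd : nondecreasing psi.
Proof.
move=> x y xy; rewrite /psi -subr_ge0.
have := le_trans (ler_norm _) (phiL x y); rewrite ler0_norm ?subr_le0//.
lra.
Qed.

Lemma chi_nd : nondecreasing chi.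
Proof.
move=> x y xy; rewrite /chi -subr_ge0.
have := le_trans (ler_norm _) (phiL y x); rewrite ger0_norm ?subr_ge0//.
lra.
Qed.

Lemma psi_rc : right_continuous psi.
Proof.
apply: right_continuousW => x; apply: cvgD; first exact: phi_continuous.
by apply: cvgM; [exact: cvg_cst|exact: cvg_id].
Qed.

Lemma chi_rc : right_continuous chi.
Proof.
apply: right_continuousW => x; apply: cvgB; last exact: phi_continuous.
by apply: cvgM; [exact: cvg_cst|exact: cvg_id].
Qed.

HB.instance Definition _ := isCumulative.Build R _ R psi psi_nd psi_rc.
HB.instance Definition _ := isCumulative.Build R _ R chi chi_nd chi_rc.

Let mpsi : {measure set (measurableTypeR R) -> \bar R} :=
  lebesgue_stieltjes_measure psi.
Let mchi : {measure set (measurableTypeR R) -> \bar R} :=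
  lebesgue_stieltjes_measure chi.

Lemma mpsi_itv a b : a <= b -> mpsi `]a, b]%classic = (psi b - psi a)%:E.
Proof.
move=> ab; rewrite /mpsi/= /lebesgue_stieltjes_measure/=.
rewrite /measure_extension/= measurable_mu_extE/=; last exact: is_ocitv.
by rewrite wlength_itv_bnd.
Qed.

Lemma mchi_itv a b : a <= b -> mchi `]a, b]%classic = (chi b - chi a)%:E.
Proof.
move=> ab; rewrite /mchi/= /lebesgue_stieltjes_measure/=.
rewrite /measure_extension/= measurable_mu_extE/=; last exact: is_ocitv.
by rewrite wlength_itv_bnd.
Qed.

Let K := L + L.
Lemma K_gt0 : 0 < K.
Proof. by rewrite /K addr_gt0. Qed.

Let Kinv_ge0 : 0 <= K^-1.
Proof. by rewrite invr_ge0 ltW// K_gt0. Qed.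

Let mK : {measure set (measurableTypeR R) -> \bar R} :=
  mscale (NngNum Kinv_ge0) (measure_add mpsi mchi).

Lemma mKE A : mK A = ((K^-1)%:E * (mpsi A + mchi A))%E.
Proof.
rewrite (_ : mK A = ((K^-1)%:E * measure_add mpsi mchi A)%E)//.
by rewrite measure_addE.
Qed.

Lemma mu_mK (A : set (measurableTypeR R)) : measurable A -> mu A = mK A.
Proof.
apply: lebesgue_measure_unique => X [[a b] _ <-]/=.
have [ab|ba] := leP a b; last first.
  by rewrite set_itv_ge ?measure0// -leNgt bnd_simp ltW.
rewrite lebesgue_measure_itv/= lte_fin.
have -> : (if a < b then (b%:E - a%:E)%E else 0%E) = (b - a)%:E.
  by case: ltgtP ab => // <- _; rewrite subrr.
rewrite -[RHS]/(mK `]a, b]%classic) mKE mpsi_itv// mchi_itv//=.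
rewrite -EFinD -EFinM; congr EFin; rewrite /psi /chi.
have := K_gt0; rewrite /K => K0.
by field; rewrite gt_eqF.
Qed.

Lemma mpsi_dominates : mpsi `<< mu.
Proof.
apply/null_content_dominatesP => A mA; move=> /eqP.
rewrite [X in X == _](mu_mK mA) mKE mule_eq0 eqe gt_eqF/= ?invr_gt0 ?K_gt0//.
by rewrite padde_eq0 ?measure_ge0// => /andP[/eqP].
Qed.

(** The Stieltjes measure of [psi], restricted to []a, b]], is finite and dominated by [mu].
    Radon-Nikodym gives it a density [g1], and h = g1 - L is the density sought for phi = psi - L x.
    Lebesgue differentiation of the primitive of [g1] identifies h with the derivative of [phi]
    almost everywhere. *)
Lemma lipschitz_density a b : a < b ->
  exists h : R -> R, [/\ mu.-integrable `]a, b] (EFin \o h),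
    (\int[mu]_(x in `]a, b]) (h x)%:E = (phi b - phi a)%:E)%E &
    {ae mu, forall x, a < x < b -> derivable phi x 1 /\ phi^`()%classic x = h x}].
Proof.
move=> ab.
have mab : measurable (`]a, b]%classic : set (measurableTypeR R)).
  exact: measurable_itv.
have fab : (mpsi `]a, b]%classic < +oo)%E by rewrite mpsi_itv ?(ltW ab)// ltry.
pose nu : {finite_measure set (measurableTypeR R) -> \bar R} := mfrestr mab fab.
have nuE A : nu A = mpsi (A `&` `]a, b]%classic) by [].
have numu : nu `<< mu.
  apply/null_content_dominatesP => A mA A0; rewrite nuE.
  have /null_content_dominatesP := mpsi_dominates; apply.
    exact: measurableI.
  by apply/eqP; rewrite -measure_le0 -[leRHS]A0 le_measure ?inE//; exact: measurableI.
have [g [g0 gfin gint gE]] := radon_nikodym_sigma_finite numu.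
pose g1 : R -> R := fine \o g.
have gg1 : EFin \o g1 = g by apply/funext => x /=; rewrite /g1/= fineK.
have g1int : mu.-integrable setT (EFin \o g1) by rewrite gg1.
have G x : a <= x -> x <= b -> (\int[mu]_(t in [set` `]-oo, x]]) (g1 t))%R = psi x - psi a.
  move=> ax xb; rewrite /Rintegral -/(EFin \o g1) gg1 -gE; last exact: measurable_itv.
  rewrite nuE (_ : _ `&` _ = `]a, x]%classic) ?mpsi_itv//.
  apply/seteqP; split => y /=; rewrite !in_itv/=; first by case=> -> /andP[->].
  by move=> /andP[-> yx]; split=> //; rewrite (le_trans yx).
pose h (x : R) : R := g1 x - L.
have locg : locally_integrable setT g1.
  by apply: open_integrable_locally => //; exact: openT.
have cL : mu.-integrable `]a, b] (EFin \o cst L).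
  apply/integrableP; split; first by apply/measurable_EFinP; exact: measurable_cst.
  rewrite /= integral_cst//= lebesgue_measure_itv/= lte_fin ab -EFinB -EFinM.
  by rewrite ltry.
have g1ab : mu.-integrable `]a, b] (EFin \o g1).
  by apply: integrableS g1int => //; exact: measurableT.
exists h; split.
- rewrite (_ : EFin \o h = (fun x : R => (g1 x)%:E - L%:E)%E)//.
  exact: integrableB.
- rewrite (_ : (fun x => (h x)%:E) = (fun x : R => (g1 x)%:E - L%:E)%E)//.
  rewrite integralB_EFin//= -/(EFin \o g1) gg1 -gE// nuE setIid mpsi_itv ?(ltW ab)//.
  rewrite integral_cst//= lebesgue_measure_itv/= lte_fin ab.
  by rewrite -!(EFinB, EFinM); congr EFin; rewrite /psi; ring.
- have := @FTC1Ny R g1 _ locg.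
  have H y : mu.-integrable `]-oo, y] (EFin \o g1).
    by apply: integrableS g1int => //; exact: measurableT.
  move=> /(_ H); apply: filterS; first exact: (ae_filter_ringOfSetsType mu).
  move=> x [dG G'x] /andP[ax xb].
  set F := (fun x : R => _) in dG G'x.
  have near_phi : {near x, (fun y => F y + (psi a - L * y)) =1 phi}.
    near=> y.
    have [ay yb] : a <= y /\ y <= b.
      by split; apply: ltW; near: y; [exact: lt_nbhsr|exact: lt_nbhsl].
    by rewrite /F G// /psi; ring.
  have dF : is_derive x 1 F (g1 x) by rewrite -G'x derive1E; exact/derivableP.
  have dlin : is_derive x 1 (fun y : R => psi a - L * y) (- L).
    have dL : is_derive x 1 (fun y : R => L * y) L.
      by apply: (is_derive_eq (is_deriveZ L (is_derive_id x 1))); rewrite /GRing.scale/= mulr1.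
    by apply: (is_derive_eq (is_deriveB (is_derive_cst (psi a) x 1) dL)); rewrite sub0r.
  have Dphi : is_derive x 1 phi (h x).
    exact: near_eq_is_derive near_phi (is_deriveD dF dlin).
  by split; [exact: ex_derive|rewrite derive1E derive_val].
Unshelve. all: by end_near. Qed.
End LipschitzFTC.

Lemma lipschitz_le_integral {R : realType} (phi : R -> R) (L : R) :
  (forall x y, `|phi x - phi y| <= L * `|x - y|) ->
  forall a b, a <= b ->
  (`|phi b - phi a|%:E <= \int[@lebesgue_measure R]_(x in `[a, b]) `|phi^`()%classic x|%:E)%E.
Proof.
move=> phiL a b; rewrite le_eqVlt => /predU1P[<-|ab].
  by rewrite subrr normr0; apply: integral_ge0 => x _; rewrite lee_fin.
have L0 : 0 <= L by have := phiL 1 0; rewrite subr0 normr1 mulr1; apply: le_trans.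
have L1 : 0 < L + 1 by rewrite ltr_wpDl.
have phiL1 x y : `|phi x - phi y| <= (L + 1) * `|x - y|.
  by rewrite (le_trans (phiL x y))// ler_wpM2r// lerDl.
have [h [hint hE dh]] := lipschitz_density L1 phiL1 ab.
have mphi' : measurable_fun setT (phi^`()%classic).
  by apply: measurable_derive1; exact: phi_continuous phiL1.
rewrite -abse_EFin -hE.
rewrite -(@integral_itv_obnd_cbnd R a (BRight b)); last first.
  by apply/measurable_EFinP; apply: measurableT_comp => //; apply: measurable_funS mphi'.
apply: (le_trans (le_abse_integral _ _ _)) => //.
  by move/integrableP : hint => [].
rewrite -(@integral_itv_bndo_bndc R (BRight a) b); last first.
  apply: measurableT_comp => //.
  by move/integrableP : hint => [mh _]; apply: measurable_funS mh => //; exact: subset_itv_oo_oc.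
rewrite -(@integral_itv_bndo_bndc R (BRight a) b); last first.
  by apply/measurable_EFinP; apply: measurableT_comp => //; apply: measurable_funS mphi'.
apply: ae_ge0_le_integral => //.
- apply: measurableT_comp => //.
  by move/integrableP : hint => [mh _]; apply: measurable_funS mh => //; exact: subset_itv_oo_oc.
- by apply/measurable_EFinP; apply: measurableT_comp => //; apply: measurable_funS mphi'.
- move: dh; apply: filterS; first exact: (ae_filter_ringOfSetsType (@lebesgue_measure R)).
  move=> x H; rewrite /= in_itv/= => /H[_ ->]; exact: lexx.
Qed.

(** * The control distance and its balls *)

Section ControlDistance.
Context {R : realType} (f : R -> R).
Notation mu := (@lebesgue_measure R).

(* The polygon from [x] running horizontally to the column [c], vertically to
   the height of [y], and horizontally to [y]; [ramp s] has slope 1 after [s]. *)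
Let ramp (s t : R) : R := Num.max 0 (t - s).

Lemma ramp_lip s t u : `|ramp s t - ramp s u| <= `|t - u|.
Proof.
rewrite /ramp; case: (leP 0 (t - s)) => ts; case: (leP 0 (u - s)) => us.
- by rewrite (_ : _ - _ = t - u)//; ring.
- rewrite subr0 ger0_norm// (le_trans _ (ler_norm _))//; lra.
- rewrite sub0r normrN ger0_norm// distrC (le_trans _ (ler_norm _))//; lra.
- by rewrite subrr normr0.
Qed.

Lemma ramp_derive (s t : R) : t != s -> is_derive t 1 (ramp s) (if s < t then 1 else 0 : R).
Proof.
move=> ts; case: ifPn => st.
  have H : {near t, (fun u => u - s) =1 ramp s}.
    near=> u; rewrite /ramp max_r// subr_ge0 ltW//; near: u; exact: lt_nbhsr.
  apply: near_eq_is_derive H _.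
  by apply: (is_derive_eq (is_deriveB (is_derive_id t (1 : R)) (is_derive_cst s t 1)));
    rewrite subr0.
have {st ts} ts : t < s by rewrite lt_neqAle ts leNgt.
have H : {near t, (fun u => 0) =1 ramp s}.
  near=> u; rewrite /ramp max_l// subr_le0 ltW//; near: u; exact: lt_nbhsl.
by apply: near_eq_is_derive H _; exact: is_derive_cst.
Unshelve. all: by end_near. Qed.

(* Constant, except for the slope [k] between times [s] and [s']. *)
Let seg (k s s' t : R) : R := k * (ramp s t - ramp s' t).

Lemma seg_derive (k s s' t : R) : s <= s' -> t != s -> t != s' ->
  is_derive t 1 (seg k s s') (if s < t < s' then k else 0 : R).
Proof.
move=> ss' ts ts'.
apply: (is_derive_eq (is_deriveZ k (is_deriveB (ramp_derive ts) (ramp_derive ts')))).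
rewrite /GRing.scale/=; case: (ltP s t) => st /=.
  case: (ltP s' t) => s't; last by rewrite lt_neqAle ts' s't/= subr0 mulr1.
  by rewrite [t < s']ltNge (ltW s't)/= subrr mulr0.
by rewrite ltNge (le_trans st ss')/= subrr mulr0.
Qed.

Lemma seg_lip (k s s' t u : R) : `|seg k s s' t - seg k s s' u| <= `|k| * 2 * `|t - u|.
Proof.
rewrite /seg -mulrBr normrM -mulrA ler_wpM2l//.
rewrite (_ : _ - _ = (ramp s t - ramp s u) - (ramp s' t - ramp s' u)); last by ring.
rewrite (le_trans (ler_normB _ _))// mulr_natl mulr2n lerD//; exact: ramp_lip.
Qed.

Lemma seg_before (k s s' t : R) : t <= s -> s <= s' -> seg k s s' t = 0.
Proof.
move=> ts ss'; rewrite /seg /ramp !max_l ?subrr ?mulr0// subr_le0//.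
exact: le_trans ss'.
Qed.

Lemma seg_after (k s s' t : R) : s <= s' -> s' <= t -> seg k s s' t = k * (s' - s).
Proof.
move=> ss' s't; rewrite /seg /ramp !max_r ?subr_ge0//; first by congr (_ * _); ring.
exact: le_trans s't.
Qed.

Lemma seg_sgr (d s s' t : R) : s' = s + `|d| -> s' <= t ->
  seg (Num.sg d) s s' t = d.
Proof.
move=> -> st; rewrite seg_after ?lerDl//.
by rewrite addrAC subrr add0r -numEsg.
Qed.

Lemma normr_sg_le1 (z : R) : `|Num.sg z| <= 1.
Proof. by rewrite normr_sg; case: (z != 0). Qed.

(** The horizontal sides are run at speed 1 and the vertical one, at the column [c], at speed [f c],
    which explains the three travel times. The corner times form a finite, hence negligible, set on
    which nothing is checked. *)
Lemma control_path (x y : R * R) (c : R) : 0 < f c ->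
  exists g, [/\ subunit_curve f (`|c - x.1| + `|y.2 - x.2| / f c + `|y.1 - c|) g,
    g 0 = x & g (`|c - x.1| + `|y.2 - x.2| / f c + `|y.1 - c|) = y].
Proof.
move=> fc0.
have [T1 T1E] : exists z : R, z = `|c - x.1| by eexists.
have [T2 T2E] : exists z : R, z = T1 + `|y.2 - x.2| / f c by eexists.
have [T3 T3E] : exists z : R, z = T2 + `|y.1 - c| by eexists.
have T10 : 0 <= T1 by rewrite T1E.
have T12 : T1 <= T2 by rewrite T2E lerDl divr_ge0// ltW.
have T23 : T2 <= T3 by rewrite T3E lerDl.
pose g1 := fun t : R => x.1 + (seg (Num.sg (c - x.1)) 0 T1 t + seg (Num.sg (y.1 - c)) T2 T3 t).
pose g2 := fun t : R => x.2 + seg (Num.sg (y.2 - x.2) * f c) T1 T2 t.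
exists (fun t => (g1 t, g2 t)); rewrite -T1E -T2E -T3E; split; last first.
- rewrite /g1 /g2.
  rewrite (seg_sgr (d := c - x.1)) ?add0r// ?(le_trans T12)// (seg_sgr (d := y.1 - c))//.
  rewrite seg_after// (_ : T2 - T1 = `|y.2 - x.2| / f c); last by rewrite T2E; ring.
  have -> : Num.sg (y.2 - x.2) * f c * (`|y.2 - x.2| / f c) = y.2 - x.2.
    by rewrite [RHS]numEsg; field; rewrite gt_eqF.
  case: y {T2E T3E g1 g2} => y1 y2 /=; congr pair; ring.
- rewrite /g1 /g2 !seg_before ?addr0//; last by rewrite (le_trans T10).
  by case: x {T1E T2E g1 g2}.
split.
  apply: (@klipschitzW _ _ _ (2 + 2 + `|f c| * 2)).
    by apply: (@globally_properfilter _ _ (0, 0)); split;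
      rewrite /= in_itv/= lexx (le_trans T10)// (le_trans T12).
  move=> [t u] /= _; rewrite prod_normE/= ge_max; apply/andP; split.
    apply: (@le_trans _ _ ((2 + 2) * `|t - u|)); last first.
      by rewrite ler_wpM2r// lerDl mulr_ge0.
    rewrite /g1 (_ : _ - _ = (seg (Num.sg (c - x.1)) 0 T1 t - seg (Num.sg (c - x.1)) 0 T1 u) +
      (seg (Num.sg (y.1 - c)) T2 T3 t - seg (Num.sg (y.1 - c)) T2 T3 u)); last by ring.
    rewrite (le_trans (ler_normD _ _))// mulrDl lerD// (le_trans (seg_lip _ _ _ _ _))//.
      by rewrite ler_wpM2r// ler_piMl// normr_sg_le1.
    by rewrite ler_wpM2r// ler_piMl// normr_sg_le1.
  apply: (@le_trans _ _ ((`|f c| * 2) * `|t - u|)); last first.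
    by rewrite ler_wpM2r// lerDr.
  rewrite /g2 (_ : _ - _ = (seg (Num.sg (y.2 - x.2) * f c) T1 T2 t - seg (Num.sg (y.2 - x.2)
    * f c) T1 T2 u)); last by ring.
  rewrite (le_trans (seg_lip _ _ _ _ _))// ler_wpM2r// ler_wpM2r// normrM.
  by rewrite ler_piMl// normr_sg_le1.
have neg : mu.-negligible ([set 0; T1; T2; T3] : set (measurableTypeR R)).
  exists [set 0; T1; T2; T3]; split => //.
    by do 3![apply: measurableU => //]; exact: measurable_set1.
  apply: countable_lebesgue_measure0; apply: finite_set_countable.
  by rewrite !finite_setU; do !split; exact: finite_set1.
move: neg; apply: negligibleS.
move=> t /=; apply: contra_notP => tT /andP[t0 tT3].
have tT1 : t != T1 by apply/eqP => E; apply: tT; left; left; right.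
have tT2 : t != T2 by apply/eqP => E; apply: tT; left; right.
have tn3 : t != T3 by rewrite lt_eqF.
have tn0 : t != 0 by rewrite gt_eqF.
have D1 : is_derive t 1 g1 ((if 0 < t < T1 then Num.sg (c - x.1) else 0) +
    (if T2 < t < T3 then Num.sg (y.1 - c) else 0)).
  apply: (is_derive_eq (is_deriveD (is_derive_cst x.1 t (1 : R))
    (is_deriveD (seg_derive _ T10 tn0 tT1) (seg_derive _ T23 tT2 tn3)))).
  by rewrite add0r.
have D2 : is_derive t 1 g2 (if T1 < t < T2 then Num.sg (y.2 - x.2) * f c else 0).
  apply: (is_derive_eq (is_deriveD (is_derive_cst x.2 t (1 : R)) (seg_derive _ T12 tT1 tT2))).
  by rewrite add0r.
rewrite (_ : fst \o _ = g1)// (_ : snd \o _ = g2)//.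
split; [exact: ex_derive|exact: ex_derive|].
rewrite !derive1E !derive_val t0/= tT3 andbT => xi /=.
have sgsq (z : R) : Num.sg z ^+ 2 <= 1 by rewrite sqr_sg; case: (z != 0).
have sq0 : 0 <= f (g1 t) ^+ 2 * xi.2 ^+ 2 by rewrite mulr_ge0// sqr_ge0.
have [tlt1|t1lt] := ltP t T1.
  have -> : (T2 < t) = false by apply/negbTE; rewrite -leNgt ltW// (lt_le_trans tlt1).
  have -> : (T1 < t) = false by apply/negbTE; rewrite -leNgt ltW.
  rewrite /=.
  rewrite addr0 mul0r addr0 exprMn.
  apply: (@le_trans _ _ (xi.1 ^+ 2)); last by rewrite lerDl.
  by rewrite ler_piMl ?sqr_ge0.
have {t1lt} t1lt : T1 < t by rewrite lt_neqAle eq_sym tT1.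
have [tlt2|t2lt] := ltP t T2.
  have -> : (T2 < t) = false by apply/negbTE; rewrite -leNgt ltW.
  rewrite t1lt/= !add0r mul0r add0r.
  have -> : g1 t = c.
    rewrite /g1 (seg_sgr (d := c - x.1)) ?add0r ?(ltW t1lt)//.
    by rewrite (seg_before _ (ltW tlt2) T23); ring.
  rewrite !exprMn (le_trans _ (_ : f c ^+ 2 * xi.2 ^+ 2 <= _))//; last by rewrite lerDr sqr_ge0.
  by rewrite ler_wpM2r ?sqr_ge0// ler_piMl ?sqr_ge0.
have {t2lt} t2lt : T2 < t by rewrite lt_neqAle eq_sym tT2.
rewrite t2lt andbF mul0r addr0 add0r exprMn.
apply: (@le_trans _ _ (xi.1 ^+ 2)); last by rewrite lerDl.
by rewrite ler_piMl ?sqr_ge0.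
Qed.

End ControlDistance.

Section ControlDistanceBounds.
Context {R : realType} (f : R -> R).
Notation mu := (@lebesgue_measure R).

Lemma lipschitz_ex (V W : normedModType R) (g : V -> W) (A : set V) :
  [lipschitz g x | x in A] ->
  exists2 M, 0 <= M & forall x y, A x -> A y -> `|g x - g y| <= M * `|x - y|.
Proof.
move=> /pinfty_ex_gt0[M M0 HM]; exists M; first exact: ltW.
by move=> x y Ax Ay; exact: (HM (x, y)).
Qed.

Lemma control_dist_le (x y : R * R) (c : R) : 0 < f c ->
  control_dist f x y <= `|c - x.1| + `|y.2 - x.2| / f c + `|y.1 - c|.
Proof.
move=> fc0; apply: ge_inf.
  by exists 0 => T [].
split; first by rewrite !addr_ge0// divr_ge0// ltW.
exact: control_path.
Qed.

Lemma control_dist_curve (x y : R * R) (c r : R) : 0 < f c -> control_dist f x y < r ->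
  exists T g, [/\ 0 <= T, T < r, subunit_curve f T g, g 0 = x & g T = y].
Proof.
move=> fc0 dr.
have [|T [T0 [g [sg g0 gT]]] Tr] := @inf_lt _ [set T | 0 <= T /\
    exists g, [/\ subunit_curve f T g, g 0 = x & g T = y]] r _ dr.
  have [g Hg] := control_path x y fc0.
  exists (`|c - x.1| + `|y.2 - x.2| / f c + `|y.1 - c|); split; last by exists g.
  by rewrite !addr_ge0// divr_ge0// ltW.
by exists T, g.
Qed.

(** [phi] is Lipschitz on [[0, T]] only. Composed with the clamp [cl] it becomes Lipschitz on the
    whole line with the same derivative inside the interval, so that [lipschitz_le_integral]
    applies. *)
Lemma displacement_le (phi b : R -> R) (T M : R) : 0 <= M ->
  (forall s u, 0 <= s -> s <= T -> 0 <= u -> u <= T -> `|phi s - phi u| <= M * `|s - u|) ->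
  {ae mu, forall t, 0 < t < T -> derivable phi t 1 /\ `|phi^`() t| <= b t} ->
  measurable_fun setT b -> (forall t, 0 <= b t) ->
  forall s u, 0 <= s -> s <= u -> u <= T ->
  (`|phi u - phi s|%:E <= \int[mu]_(t in `[s, u]) (b t)%:E)%E.
Proof.
move=> M0 phiM dphi mb b0 s u s0 su uT.
have T0 : 0 <= T by rewrite (le_trans s0)// (le_trans su).
pose cl (t : R) := Num.max 0 (Num.min t T).
have clid t : 0 <= t -> t <= T -> cl t = t.
  by move=> t0 tT; rewrite /cl min_l// max_r.
have cl0 t : 0 <= cl t by rewrite /cl le_max lexx.
have clT t : cl t <= T by rewrite /cl ge_max T0 ge_min lexx orbT.
have cl_lip t v : `|cl t - cl v| <= `|t - v|.
  wlog tv : t v / t <= v => [H|].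
    by case: (leP t v) => [/H//|/ltW /H]; rewrite distrC [leRHS]distrC.
  rewrite ler0_norm ?ler0_norm ?subr_le0//.
    rewrite /cl; case: (leP t T) => tT; case: (leP v T) => vT.
    - by case: (leP 0 t) => t0; case: (leP 0 v) => v0; lra.
    - by case: (leP 0 t) => t0; case: (leP 0 T) => v0; lra.
    - lra.
    - lra.
  rewrite /cl ge_max le_max lexx/= le_max; apply/orP; right.
  by rewrite le_min ge_min tv/= ge_min lexx orbT.
pose psi t := phi (cl t).
have psiM t v : `|psi t - psi v| <= M * `|t - v|.
  by rewrite (le_trans (phiM _ _ _ _ _ _))// ler_wpM2l.
have mpsi' : measurable_fun setT (psi^`()).
  by apply: measurable_derive1; apply: (lipschitz_continuous M0); exact: psiM.
have := lipschitz_le_integral psiM su.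
rewrite /psi !clid//; last 2 first.
  exact: (le_trans su).
  exact: (le_trans s0).
move=> /le_trans; apply; rewrite -/psi.
have [<-|su'] := eqVneq s u; first by rewrite !set_itv1 !integral_set1.
have mE (g : R -> R) (D : set R) : measurable_fun setT g -> measurable_fun D (fun t => (g t)%:E).
  by move=> mg; apply/measurable_EFinP; apply: measurable_funS mg.
have mpsin : measurable_fun setT (fun t => `|psi^`() t|) by exact: measurableT_comp.
rewrite -!(@integral_itv_obnd_cbnd R s (BRight u)); try by exact: mE.
rewrite -!(@integral_itv_bndo_bndc R (BRight s) u); try by exact: mE.
apply: ae_ge0_le_integral => //; try by exact: mE.
  by move=> t _; rewrite lee_fin.
move: dphi; apply: filterS; first exact: (ae_filter_ringOfSetsType mu).
move=> t H; rewrite /= in_itv/= => /andP[st tu].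
have t0 : 0 < t by rewrite (le_lt_trans s0).
have tT : t < T by rewrite (lt_le_trans tu).
have [|dt bt] := H; first by rewrite t0.
suff -> : psi^`() t = phi^`() t by rewrite lee_fin.
rewrite !derive1E; apply: near_eq_derive.
near=> z; rewrite /psi clid//; apply: ltW; near: z; [exact: lt_nbhsr|exact: lt_nbhsl].
Unshelve. all: by end_near. Qed.

Lemma subunit_curve_fst T g : subunit_curve f T g ->
  forall s u, 0 <= s -> s <= u -> u <= T -> `|(g u).1 - (g s).1| <= u - s.
Proof.
move=> [/lipschitz_ex[M M0 gM] dg] s u s0 su uT.
have H : {ae mu, forall t, 0 < t < T -> derivable (fst \o g) t 1 /\ `|(fst \o g)^`() t| <= cst 1 t}.
  move: dg; apply: filterS; first exact: (ae_filter_ringOfSetsType mu).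
  move=> t Ht /Ht[d1 _ sv]; split => //.
  have := sv (1, 0); rewrite /= !mulr0 addr0 mulr1 expr0n/= mulr0 addr0 expr1n.
  by move=> H1; rewrite -ler_sqr ?nnegrE// real_normK ?num_real// expr1n.
have gM1 v z : 0 <= v -> v <= T -> 0 <= z -> z <= T ->
    `|(fst \o g) v - (fst \o g) z| <= M * `|v - z|.
  move=> v0 vT z0 zT; apply: le_trans (gM v z _ _).
  - by rewrite prod_normE le_max lexx.
  - by rewrite /= in_itv/= v0.
  - by rewrite /= in_itv/= z0.
have := displacement_le M0 gM1 H (measurable_cst _) (fun=> ler01) s0 su uT.
rewrite /= integral_cst//= mul1e lebesgue_measure_itv/= lte_fin.
case: ltP => [_|us]; first by rewrite -EFinB lee_fin.
rewrite lee_fin => /le_trans; apply; by rewrite subr_ge0.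
Qed.

(** Tested against the covector (0, 1), the subunit condition bounds the vertical speed by |f| at
    the first coordinate; [b] is a measurable majorant of it that can be integrated. *)
Lemma subunit_curve_snd T g b : subunit_curve f T g ->
  (forall t, 0 <= t -> t <= T -> `|f (g t).1| <= b t) ->
  measurable_fun setT b -> (forall t, 0 <= b t) -> 0 <= T ->
  (`|(g T).2 - (g 0).2|%:E <= \int[mu]_(t in `[0%R, T]) (b t)%:E)%E.
Proof.
move=> [/lipschitz_ex[M M0 gM] dg] fb mb b0 T0.
have H : {ae mu, forall t, 0 < t < T -> derivable (snd \o g) t 1 /\ `|(snd \o g)^`() t| <= b t}.
  move: dg; apply: filterS; first exact: (ae_filter_ringOfSetsType mu).
  move=> t Ht tT; have [_ d2 sv] := Ht tT; split => //.
  move: tT => /andP[t0 tT]; apply: le_trans (fb t (ltW t0) (ltW tT)).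
  have := sv (0, 1); rewrite /= !mulr0 add0r mulr1 expr0n/= add0r expr1n mulr1.
  by move=> H1; rewrite -ler_sqr ?nnegrE// !real_normK ?num_real.
have gM1 v z : 0 <= v -> v <= T -> 0 <= z -> z <= T ->
    `|(snd \o g) v - (snd \o g) z| <= M * `|v - z|.
  move=> v0 vT z0 zT; apply: le_trans (gM v z _ _).
  - by rewrite prod_normE le_max lexx orbT.
  - by rewrite /= in_itv/= v0.
  - by rewrite /= in_itv/= z0.
exact: displacement_le M0 gM1 H mb b0 _ _ (lexx 0) T0 (lexx T).
Qed.

(** The column [c] ensures that some subunit curve joins the two points; over an empty set of times,
    [inf] would be 0. *)
Lemma control_dist_ge (x y : R * R) (c : R) : 0 < f c -> `|y.1 - x.1| <= control_dist f x y.
Proof.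
move=> fc0; apply/ler_addgt0Pr => e e0.
have [|T [g [T0 Tr sg g0 gT]]] := @control_dist_curve x y c (control_dist f x y + e) fc0.
  by rewrite ltrDl.
have := subunit_curve_fst sg (lexx 0) T0 (lexx T).
by rewrite gT g0 subr0 => /le_trans; apply; exact: ltW.
Qed.

End ControlDistanceBounds.

(** * Monotonicity of integrals and measures without measurability *)

Section MonotoneIntegral.
Local Open Scope ereal_scope.
Import HBNNSimple.

(** The integral of a nonnegative function is the supremum over the nonnegative simple functions
    below it, and enlarging the function enlarges this family. *)
Lemma ge0_le_integral_nonmeasurable d (T : measurableType d) (R : realType)
    (mu : {measure set T -> \bar R}) (D : set T) (g1 g2 : T -> \bar R) :
  (forall x, D x -> 0 <= g1 x) -> (forall x, D x -> g1 x <= g2 x) ->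
  \int[mu]_(x in D) g1 x <= \int[mu]_(x in D) g2 x.
Proof.
move=> g10 g12; rewrite !ge0_integralE//; last first.
  by move=> x Dx; rewrite (le_trans (g10 x Dx))// g12.
apply: ge_ereal_sup => _ /= [h hg <-]; apply: ereal_sup_ubound.
exists h => // x; rewrite (le_trans (hg x))//.
rewrite /patch; case: ifPn => // xD; apply: g12; exact: set_mem.
Qed.

Lemma lebesgue_measure_le (R : realType) (A B : set R) : A `<=` B ->
  (@lebesgue_measure R A <= @lebesgue_measure R B).
Proof. by move=> AB; exact: le_mu_ext. Qed.

Lemma lebesgue2_xsection (R : realType) (A : set (R * R)) :
  lebesgue2 R A = \int[@lebesgue_measure R]_u (@lebesgue_measure R (xsection A u)).
Proof. by []. Qed.

Lemma lebesgue2_rect (R : realType) (A B : set R) : measurable A -> measurable B ->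
  lebesgue2 R (A `*` B) = @lebesgue_measure R A * @lebesgue_measure R B.
Proof. by move=> mA mB; exact: product_measure1E. Qed.

(** The product measure of any set is the integral of the measures of its vertical sections, and
    Lebesgue measure is monotone on all sets as an outer measure. This allows control balls as
    arguments. *)
Lemma lebesgue2_le (R : realType) (A B : set (R * R)) : A `<=` B ->
  lebesgue2 R A <= lebesgue2 R B.
Proof.
move=> AB; rewrite !lebesgue2_xsection; apply: ge0_le_integral_nonmeasurable => u _.
  exact: mu_ext_ge0.
by apply: lebesgue_measure_le; exact: le_xsection.
Qed.

End MonotoneIntegral.

(** * The measure of control balls *)

Section BallMeasure.
Context {R : realType} (f F : R -> R) (Rmax C0 eps : R).
Hypothesis geom : geometry f F Rmax C0 eps.
Notation mu := (@lebesgue_measure R).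
Notation lam := (lam F).

Variables (x : R * R) (rho : R).
Let a := x.1.
Let b := a + rho.
Hypotheses (a0 : 0 < x.1) (rho0 : 0 < rho) (bR : x.1 + rho < Rmax).

Lemma ball_b_gt0 : 0 < b. Proof. by rewrite addr_gt0. Qed.
Lemma ball_fb_gt0 : 0 < f b. Proof. by rewrite (f_gt0 geom)// ball_b_gt0. Qed.
Lemma ball_lb_gt0 : 0 < lam b. Proof. by rewrite (lam_gt0 geom)// ball_b_gt0. Qed.
Lemma ball_fa_gt0 : 0 < f x.1.
Proof. by rewrite (f_gt0 geom)// (lt_trans _ bR)// ltrDl. Qed.

Lemma f_norm (u : R) : f u = f `|u|.
Proof. by case: (leP 0 u) => u0; [rewrite ger0_norm|rewrite ltr0_norm// (geom_even geom)]. Qed.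

(** Curves in the ball may cross or touch the vertical axis, so [f] has to be controlled there too:
    evenness and f(0) = 0 extend the decay. *)
Lemma f_decay_norm u v : `|u| <= v -> v <= b ->
  `|f u| <= f b * expR (- ((b - v) / lam b)).
Proof.
move=> uv vb; rewrite f_norm.
have [u0|u0] := eqVneq `|u| 0.
  rewrite u0 (geom_f0 geom) normr0 mulr_ge0 ?expR_ge0//; exact: ltW ball_fb_gt0.
have {}u0 : 0 < `|u| by rewrite lt_neqAle eq_sym u0 /=.
have ub := le_trans uv vb.
rewrite ger0_norm; last by rewrite ltW// (f_gt0 geom)// (le_lt_trans ub).
rewrite (le_trans (f_decay geom u0 ub bR))// ler_wpM2l ?(ltW ball_fb_gt0)//.
rewrite ler_expR lerN2 ler_wpM2r ?invr_ge0 ?(ltW ball_lb_gt0)//.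
by rewrite lerB.
Qed.

Lemma ball_curve y : control_ball f x rho y ->
  exists T g, [/\ 0 <= T, T < rho, subunit_curve f T g, g 0 = x & g T = y].
Proof. by move=> ?; apply: (control_dist_curve ball_fa_gt0). Qed.

Lemma ball_fst y : control_ball f x rho y -> `|y.1 - a| < rho.
Proof.
move=> /ball_curve[T [g [T0 Tr sg g0 gT]]].
have := subunit_curve_fst sg (lexx 0) T0 (lexx T).
by rewrite gT g0 subr0 => /le_lt_trans; apply.
Qed.

Lemma ball_fst_norm y : control_ball f x rho y -> `|y.1| < b.
Proof.
move=> /ball_fst; rewrite !ltr_norml => /andP[H1 H2].
rewrite /b; apply/andP; split; last by rewrite -ltrBlDl.
have := a0; rewrite -/a; lra.
Qed.

Lemma ball_snd_le y : control_ball f x rho y -> `|y.2 - x.2| <= rho * f b.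
Proof.
move=> /ball_curve[T [g [T0 Tr sg g0 gT]]].
have bound t : 0 <= t -> t <= T -> `|f (g t).1| <= cst (f b) t.
  move=> t0 tT; have gt : `|(g t).1| <= b.
    have := subunit_curve_fst sg (lexx 0) t0 tT; rewrite g0 subr0 => H.
    have -> : (g t).1 = x.1 + ((g t).1 - x.1) by ring.
    rewrite (le_trans (ler_normD _ _))// (gtr0_norm a0) lerD2l.
    by rewrite (le_trans H)// (le_trans tT)// ltW.
  have := f_decay_norm gt (lexx b); rewrite subrr mul0r oppr0 expR0 mulr1.
  exact.
have := subunit_curve_snd sg bound (measurable_cst _) (fun=> ltW ball_fb_gt0) T0.
rewrite gT g0 /= integral_cst//= lebesgue_measure_itv/= lte_fin.
case: ltP => [T0'|_]; last first.
  by rewrite mule0 lee_fin => /le_trans; apply; rewrite mulr_ge0 ?(ltW rho0)// ltW// ball_fb_gt0.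
rewrite -EFinB -EFinM lee_fin subr0 => /le_trans; apply.
by rewrite mulrC ler_wpM2r ?(ltW ball_fb_gt0)// ltW.
Qed.

(** A curve ending far to the left of [b] stays where [f] is small. One part of the decay is
    integrated in time and yields the factor 2 lam b; the other part, in b - |y.1|, is kept so that
    the height of the ball can be integrated over y.1. *)
Lemma ball_snd_decay y : control_ball f x rho y ->
  `|y.2 - x.2| <= 2 * lam b * f b * expR (- ((b - `|y.1|) / (4 * lam b))).
Proof.
move=> /ball_curve[T [g [T0 Tr sg g0 gT]]].
have lb := ball_lb_gt0; have fb := ball_fb_gt0.
set E := expR (- ((b - `|y.1|) / (4 * lam b))).
pose G t := 2 * lam b * f b * E * expR (- ((rho - t) / (2 * lam b))).
pose bd t := f b * E * expR (- ((rho - t) / (2 * lam b))).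
have bd0 t : 0 <= bd t by rewrite !mulr_ge0 ?expR_ge0// ltW.
have G0 t : 0 <= G t by rewrite !mulr_ge0 ?expR_ge0// ltW.
have dl t : is_derive t (1 : R) (fun t : R => - ((rho - t) / (2 * lam b))) (2 * lam b)^-1.
  have -> : (fun t : R => - ((rho - t) / (2 * lam b))) = (fun t => (2 * lam b)^-1 * (t - rho)).
    by apply/funext => z; field; rewrite gt_eqF.
  apply: (is_derive_eq (is_deriveZ _ (is_deriveB (is_derive_id t (1 : R))
    (is_derive_cst rho t 1)))).
  by rewrite subr0 /GRing.scale/= mulr1.
have dE t : is_derive t (1 : R) (fun t : R => expR (- ((rho - t) / (2 * lam b))))
  (expR (- ((rho - t) / (2 * lam b))) / (2 * lam b)).
  exact: (is_derive1_comp (is_derive_expR _) (dl t)).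
have dG (t : R) : is_derive t 1 G (bd t).
  apply: (is_derive_eq (is_deriveZ (2 * lam b * f b * E) (dE t))).
  by rewrite /GRing.scale/= /bd; field; rewrite gt_eqF.
have cbd : continuous bd.
  move=> t; apply: cvgM; first exact: cvg_cst.
  suff : {for t, continuous (fun t : R => expR (- ((rho - t) / (2 * lam b))))} by [].
  apply: differentiable_continuous; apply/derivable1_diffP.
  exact: (@ex_derive _ _ _ _ _ _ _ (dE t)).
(* [v3] averages [v1] and [v2] with weights 3/4 and 1/4, so that [f] decays both in
   [rho - t] and in [b - |y.1|]. *)
have bound t : 0 <= t -> t <= T -> `|f (g t).1| <= bd t.
  move=> t0 tT.
  have v1 : `|(g t).1| <= a + t.
    have := subunit_curve_fst sg (lexx 0) t0 tT; rewrite g0 subr0 => H.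
    have -> : (g t).1 = x.1 + ((g t).1 - x.1) by ring.
    by rewrite (le_trans (ler_normD _ _))// (gtr0_norm a0) lerD2l.
  have v2 : `|(g t).1| <= `|y.1| + (T - t).
    have := subunit_curve_fst sg t0 tT (lexx T); rewrite gT => H.
    have -> : (g t).1 = y.1 - (y.1 - (g t).1) by ring.
    by rewrite (le_trans (ler_normB _ _))// lerD2l.
  have v3 : `|(g t).1| <= (3 * (a + t) + (`|y.1| + (T - t))) / 4 by lra.
  have yb : `|y.1| <= a + T.
    have := subunit_curve_fst sg (lexx 0) T0 (lexx T); rewrite g0 gT subr0 => H.
    have -> : y.1 = x.1 + (y.1 - x.1) by ring.
    by rewrite (le_trans (ler_normD _ _))// (gtr0_norm a0) lerD2l.
  have v4 : (3 * (a + t) + (`|y.1| + (T - t))) / 4 <= b by rewrite /b; lra.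
  apply: (le_trans (f_decay_norm v3 v4)).
  rewrite /bd -mulrA ler_wpM2l ?(ltW fb)// /E -expRD ler_expR -opprD lerN2.
  rewrite -subr_ge0.
  have -> : (b - (3 * (a + t) + (`|y.1| + (T - t))) / 4) / lam b -
   ((b - `|y.1|) / (4 * lam b) + (rho - t) / (2 * lam b)) =
    (rho - T) / (4 * lam b).
    by rewrite /b; field; rewrite gt_eqF.
  by rewrite divr_ge0 ?mulr_ge0 ?(ltW lb)// subr_ge0 ltW.
have := subunit_curve_snd sg bound (continuous_measurable_fun cbd) bd0 T0.
rewrite gT g0; move: (T0); rewrite le_eqVlt => /predU1P[<-|T0'].
  rewrite set_itv1 integral_set1 lee_fin => /le_trans; apply.
  by rewrite !mulr_ge0 ?expR_ge0// ltW.
rewrite -(@integral_itv_bndo_bndc R (BLeft 0) T); last first.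
  apply/measurable_EFinP; apply: measurable_funS (continuous_measurable_fun cbd) => //.
have GM t : 0 <= t -> t < T -> G t <= 2 * lam b * f b * E.
  move=> _ tT; rewrite /G ler_piMr ?mulr_ge0 ?expR_ge0 ?(ltW fb) ?(ltW lb)//.
  rewrite -expR0 ler_expR oppr_le0 divr_ge0 ?mulr_ge0 ?(ltW lb)//.
  by rewrite subr_ge0 ltW// (lt_trans tT).
have := @integral_le_of_primitive R G bd (-1) 0 T _ (ltrN10 R) T0' (fun t _ _ => dG t)
  (fun t _ _ => cbd t) (fun t _ _ => bd0 t) GM.
move=> /[swap] /le_trans /[apply]; rewrite lee_fin => /le_trans; apply.
by rewrite gerBl.
Qed.

(** If rho <= lam b, the ball lies in a rectangle of area 4 f(b) rho^2. Otherwise the section over v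
    has length at most 4 lam f exp(- (b - |v|) / (4 lam)), with [lam] and [f] taken at b. The sum
    [E] of two exponentials replaces the one with |v| by a smooth function whose primitive [G] lies
    between -16 lam^2 f and 16 lam^2 f, whence 32. *)
Lemma ball_measure_le : (lebesgue2 R (control_ball f x rho) <=
  (32 * f b * Num.min rho (lam b) ^+ 2)%:E)%E.
Proof.
have lb := ball_lb_gt0; have fb := ball_fb_gt0.
have muI (c h : R) : 0 <= h -> mu `[c - h, c + h] = (2 * h)%:E.
  move=> h0; rewrite lebesgue_measure_itv/= lte_fin.
  case: ltP => [_|]; first by rewrite -EFinB; congr EFin; ring.
  move=> H; have -> : h = 0 by lra.
  by rewrite mulr0.
have [rl|lr] := leP rho (lam b).
  apply: (@le_trans _ _ (lebesgue2 R (`[a - rho, a + rho] `*` `[x.2 - rho * f b, x.2 + rho * f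
    b]))).
    apply: lebesgue2_le => y By; split => /=; rewrite in_itv/= -ler_distlC distrC.
      exact/ltW/ball_fst.
    exact: ball_snd_le.
  rewrite lebesgue2_rect//= !muI ?(ltW rho0) ?mulr_ge0 ?(ltW rho0) ?(ltW fb)//.
  rewrite -EFinM lee_fin -subr_ge0.
  rewrite (_ : _ - _ = 28 * f b * rho ^+ 2); last by ring.
  by rewrite !mulr_ge0 ?sqr_ge0// ltW.
pose E (v : R) := expR (- ((b - v) / (4 * lam b))) + expR (- ((b + v) / (4 * lam b))).
pose g v := 4 * lam b * f b * E v.
pose G v := 16 * lam b ^+ 2 * f b * (expR (- ((b - v) / (4 * lam b))) - expR (- ((b + v)
  / (4 * lam b)))).
have g0 v : 0 <= g v by rewrite /g /E !mulr_ge0 ?addr_ge0 ?expR_ge0// ltW.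
have dl1 (t : R) : is_derive t (1 : R) (fun t : R => expR (- ((b - t) / (4 * lam b))))
  (expR (- ((b - t) / (4 * lam b))) / (4 * lam b)).
  apply: (is_derive1_comp (is_derive_expR _)).
  have -> : (fun t : R => - ((b - t) / (4 * lam b))) = (fun t => (4 * lam b)^-1 * (t - b)).
    by apply/funext => z; field; rewrite gt_eqF.
  apply: (is_derive_eq (is_deriveZ _ (is_deriveB (is_derive_id t (1 : R)) (is_derive_cst b t 1)))).
  by rewrite subr0 /GRing.scale/= mulr1.
have dl2 (t : R) : is_derive t (1 : R) (fun t : R => expR (- ((b + t) / (4 * lam b))))
  (expR (- ((b + t) / (4 * lam b))) * - (4 * lam b)^-1).
  apply: (is_derive1_comp (is_derive_expR _)).
  have -> : (fun t : R => - ((b + t) / (4 * lam b))) = (fun t => - (4 * lam b)^-1 * (t + b)).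
    by apply/funext => z; field; rewrite gt_eqF.
  apply: (is_derive_eq (is_deriveZ _ (is_deriveD (is_derive_id t (1 : R)) (is_derive_cst b t 1)))).
  by rewrite addr0 /GRing.scale/= mulr1.
have dG (t : R) : is_derive t 1 G (g t).
  apply: (is_derive_eq (is_deriveZ (16 * lam b ^+ 2 * f b) (is_deriveB (dl1 t) (dl2 t)))).
  by rewrite /GRing.scale/= /g /E; field; rewrite gt_eqF.
have cg (t : R) : {for t, continuous g}.
  apply: cvgM; first exact: cvg_cst.
  apply: cvgD.
    suff : {for t, continuous (fun t : R => expR (- ((b - t) / (4 * lam b))))} by [].
    apply: differentiable_continuous; apply/derivable1_diffP.
    exact: (@ex_derive _ _ _ _ _ _ _ (dl1 t)).
  suff : {for t, continuous (fun t : R => expR (- ((b + t) / (4 * lam b))))} by [].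
  apply: differentiable_continuous; apply/derivable1_diffP.
  exact: (@ex_derive _ _ _ _ _ _ _ (dl2 t)).
have b0 := ball_b_gt0.
have GM t : - b <= t -> t < b -> G t <= 16 * lam b ^+ 2 * f b.
  move=> _ tb; rewrite /G ler_piMr ?mulr_ge0 ?sqr_ge0 ?(ltW fb) ?(ltW lb)//.
  rewrite lerBlDr (le_trans (_ : _ <= 1))//; last by rewrite lerDl expR_ge0.
  rewrite -expR0 ler_expR oppr_le0 divr_ge0 ?mulr_ge0 ?(ltW lb)//.
  by rewrite subr_ge0 ltW.
have GN : - (16 * lam b ^+ 2 * f b) <= G (- b).
  rewrite -[leLHS]mulrN1 /G ler_wpM2l ?mulr_ge0 ?sqr_ge0 ?(ltW fb) ?(ltW lb)//.
  by rewrite subrr mul0r oppr0 expR0 opprK lerBrDr addrC subrr expR_ge0.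
have Nb : - b < b by lra.
have bb : - b - 1 < - b by lra.
have H := @integral_le_of_primitive R G g (- b - 1) (- b) b (16 * lam b ^+ 2 * f b) bb Nb
  (fun t _ _ => dG t) (fun t _ _ => cg t) (fun t _ _ => g0 t) GM.
apply: (@le_trans _ _ (\int[mu]_(v in `[(- b)%R, b[) (g v)%:E)%E); last first.
  apply: le_trans H _; rewrite lee_fin; lra.
rewrite lebesgue2_xsection [leRHS]integral_mkcond.
apply: ge0_le_integral_nonmeasurable => v _; first exact: mu_ext_ge0.
rewrite patchE; case: ifPn => vb; last first.
  rewrite (_ : xsection _ _ = set0) ?measure0//; apply/seteqP; split => // w.
  rewrite /xsection/= inE => /ball_fst_norm/= vb'.
  move: vb; rewrite notin_setE/= in_itv/= => /negP; rewrite negb_and -!leNgt -ltNge.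
  move: vb'; rewrite ltr_norml => /andP[H1 H2] /orP[|]; lra.
set h := 2 * lam b * f b * expR (- ((b - `|v|) / (4 * lam b))).
have h0 : 0 <= h by rewrite /h !mulr_ge0 ?expR_ge0// ltW.
apply: (@le_trans _ _ (mu `[x.2 - h, x.2 + h])).
  apply: lebesgue_measure_le => w; rewrite /xsection/= inE => /ball_snd_decay/= Hw.
  by rewrite in_itv/= -ler_distlC distrC.
rewrite muI// lee_fin /h /g !mulrA (_ : 2 * 2 = 4)//; last by ring.
rewrite ler_wpM2l ?mulr_ge0 ?(ltW fb) ?(ltW lb)// /E.
case: (leP 0 v) => v0.
  by rewrite ger0_norm// lerDl expR_ge0.
by rewrite ltr0_norm// opprK lerDr expR_ge0.
Qed.

(** Moving vertically at the column of x and then horizontally reaches a small rectangle in time at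
    most 2 rho / 3. Together with the upper bound, this makes [fine] of the measure a genuine
    positive denominator. *)
Lemma ball_measure_gt0 : (0 < lebesgue2 R (control_ball f x rho))%E.
Proof.
have fa := ball_fa_gt0.
apply: (@lt_le_trans _ _ (lebesgue2 R (`[a, a + rho / 3] `*` `[x.2, x.2 + rho / 3 * f a]))).
  rewrite lebesgue2_rect//= !lebesgue_measure_itv/= !lte_fin !ltrDl.
  have r3 : 0 < rho / 3 by rewrite divr_gt0.
  rewrite r3 mulr_gt0// -!EFinB -EFinM lte_fin.
  by rewrite mulr_gt0//; rewrite addrAC subrr add0r// mulr_gt0.
apply: lebesgue2_le => y [/=]; rewrite !in_itv/= => /andP[ay ya] /andP[xy yx].
rewrite /control_ball/=.
apply: (le_lt_trans (control_dist_le x y fa)).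
rewrite subrr normr0 add0r !ger0_norm ?subr_ge0//.
have H : (y.2 - x.2) / f x.1 <= rho / 3.
  by rewrite ler_pdivrMr// -/a; lra.
rewrite -/a in H *; have := rho0; lra.
Qed.

End BallMeasure.

(** * The radii *)

Section Step.
Context {R : realType} (f F : R -> R) (Rmax C0 eps : R).
Hypothesis geom : geometry f F Rmax C0 eps.
Notation lam := (lam F).

(** The two regimes in the definition of [Eset] in one expression, so that the later estimates need
    not distinguish them. *)
Definition half_height (a s tau : R) : R :=
  if lam a <= s then hstar f a tau else height f a s.

(** As lam b <= b / eps and c1 <= eps / 2, a distance c1 lam b below b stays above b / 2, where
    [lam] has lost at most the factor M = 2^n of [lam_growth]. Over such a distance [f] varies by at
    most exp(M), and [hstar_ge_rect] at that distance gives exp(- 2 M) after squaring. *)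
Lemma hstar_ge_min : exists2 M : R, 1 <= M & exists c1 : R,
  [/\ 0 < c1, c1 <= 1,
  (forall a t, 0 < a -> 0 < t -> a + t < Rmax ->
    expR (- (2 * M)) * Num.min t (c1 * lam (a + t)) * f (a + t) <= hstar f a t) &
  (forall a t, 0 < a -> 0 < t -> a + t < Rmax -> t <= c1 * lam (a + t) ->
    lam (a + t) <= M * lam a)].
Proof.
have [n Hn] := lam_growth geom.
have eps0 := geom_eps geom.
exists (2 ^+ n); first by rewrite exprn_ege1// ler1n.
pose c1 := Num.min 1 (eps / 2).
have c10 : 0 < c1 by rewrite lt_min ltr01 divr_gt0.
have c11 : c1 <= 1 by rewrite ge_min lexx.
have c1e : c1 <= eps / 2 by rewrite ge_min lexx orbT.
have close b u : 0 < u -> u <= b -> b < Rmax -> b - u <= c1 * lam b -> lam b <= 2 ^+ n * lam u.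
  move=> u0 ub bR bu; apply: Hn => //.
  have b0 := lt_le_trans u0 ub.
  have : c1 * lam b <= eps / 2 * (b / eps).
    by apply: ler_pM => //; [exact: ltW|rewrite ltW// (lam_gt0 geom)|exact: (lam_le geom)].
  have -> : eps / 2 * (b / eps) = b / 2 by field; rewrite gt_eqF.
  lra.
exists c1; split => //.
- move=> a t a0 t0 atR; set b := a + t.
  have b0 : 0 < b by rewrite addr_gt0.
  have lb := lam_gt0 geom b0 atR.
  set m := Num.min t (c1 * lam b).
  have m0 : 0 < m by rewrite lt_min t0 mulr_gt0.
  have mt : m <= t by rewrite ge_min lexx.
  have mc : m <= c1 * lam b by rewrite ge_min lexx orbT.
  have au0 : a <= b - m by rewrite /b; lra.
  have u00 : 0 < b - m := lt_le_trans a0 au0.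
  have u0b : b - m < b by lra.
  have u0R := lt_trans u0b atR.
  have := hstar_ge_rect geom a0 t0 atR au0 u0b; rewrite -/b => /(le_trans _); apply.
  have -> : b - (b - m) = m by ring.
  rewrite mulrAC mulrC ler_wpM2l ?(ltW m0)//.
  have lu := lam_gt0 geom u00 u0R.
  have bu : lam b <= 2 ^+ n * lam (b - m) by apply: close => //; [exact: ltW|lra].
  have fr : f b <= f (b - m) * expR (2 ^+ n).
    apply: (le_trans (f_ratio geom u00 (ltW u0b) atR)).
    rewrite ler_wpM2l ?(ltW (f_gt0 geom _ _))// ler_expR ler_pdivrMr//.
    apply: le_trans bu; rewrite (_ : b - (b - m) = m); last by ring.
    by rewrite (le_trans mc)// ler_piMl// ltW.
  have fb := f_gt0 geom b0 atR; have fu := f_gt0 geom u00 u0R.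
  rewrite ler_pdivlMr// -mulrA -expr2.
  rewrite expRN ler_pdivrMl ?expR_gt0//.
  rewrite expRM_natl -exprMn lerXn2r ?nnegrE ?mulr_ge0 ?expR_ge0 ?(ltW fb) ?(ltW fu)//.
  by rewrite mulrC.
- move=> a t a0 t0 atR tc; apply: close => //; first by rewrite lerDl ltW.
  by rewrite addrAC subrr add0r.
Qed.

(* From [t + h / (2 f) <= s <= t + h / f], where [h = hstar f a t] and
   [f = f (a + t)], the step [s - t] is comparable to [h / f]. *)
Lemma step_bounds_large : exists2 A : R, 1 <= A & forall a s, 0 < a -> 0 < s -> a + s < Rmax ->
  lam a <= s -> let t := rstar f a s in
  forall tau, t <= tau -> tau <= s ->
  [/\ f (a + tau) <= A * f (a + t), s - t <= A * Num.min tau (lam (a + tau)),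
      Num.min tau (lam (a + tau)) <= A * (s - t),
      (s - t) * f (a + t) <= A * hstar f a tau &
      hstar f a tau <= A * ((s - t) * f (a + t))].
Proof.
have [n Hn] := lam_growth geom.
have eps0 := geom_eps geom.
have [M M1 [c1 [c10 c11 Hlow Hclose]]] := hstar_ge_min.
have M0 : 0 < M := lt_le_trans ltr01 M1.
(* [c2] bounds t / lam (a + t) from below, and [c3] then bounds (s - t) / lam (a + t) from below,
   through s - t >= h / (2 f). *)
pose c2 := Num.min c1 (8 * M ^+ 3)^-1.
have c20 : 0 < c2 by rewrite lt_min c10 invr_gt0 mulr_gt0// exprn_gt0.
have c2c1 : c2 <= c1 by rewrite ge_min lexx.
have c2M : c2 <= (8 * M ^+ 3)^-1 by rewrite ge_min lexx orbT.
pose E := expR (- (2 * M)).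
have E0 : 0 < E by rewrite expR_gt0.
pose c3 := E * c2 / 2.
have c30 : 0 < c3 by rewrite divr_gt0// mulr_gt0.
(* Since s - t <= lam (a + t) <= (a + t) / eps, passing from a + t to a + tau multiplies the
   argument by at most 1 + 1 / eps; [N] bounds the growth of [lam]. Over the same distance [f] grows
   by at most the factor e. *)
pose N := (1 + eps^-1) ^+ n.
have N0 : 0 < N by rewrite exprn_gt0// addr_gt0// invr_gt0.
pose e : R := expR 1.
have e0 : 0 < e by rewrite expR_gt0.
pose A := 1 + e + c2^-1 + N / c3 + (E * c2)^-1 + N * e / c3.
have p1 : 0 < c2^-1 by rewrite invr_gt0.
have p2 : 0 < N / c3 by rewrite divr_gt0.
have p3 : 0 < (E * c2)^-1 by rewrite invr_gt0 mulr_gt0.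
have p4 : 0 < N * e / c3 by rewrite divr_gt0// mulr_gt0.
have A1 : 1 <= A by rewrite /A; lra.
have Ae : e <= A by rewrite /A; lra.
have A2 : c2^-1 <= A by rewrite /A; lra.
have A3 : N / c3 <= A by rewrite /A; lra.
have A4 : (E * c2)^-1 <= A by rewrite /A; lra.
have A5 : N * e / c3 <= A by rewrite /A; lra.
exists A => // a s a0 s0 asR las t tau ttau taus.
have [t0 ts sL] := rstarP geom a0 s0 asR.
rewrite -/t in t0 ts sL.
have atR : a + t < Rmax by rewrite (lt_trans _ asR)// ltrD2l.
have aR : a < Rmax by rewrite (lt_trans _ atR)// ltrDl.
have b0 : 0 < a + t by rewrite addr_gt0.
have la := lam_gt0 geom a0 aR; have lb := lam_gt0 geom b0 atR.
have fb := f_gt0 geom b0 atR.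
have tau0 : 0 < tau by exact: lt_le_trans ttau.
have ataus : a + tau <= a + s by rewrite lerD2l.
have attau : a + t <= a + tau by rewrite lerD2l.
have atauR : a + tau < Rmax := le_lt_trans ataus asR.
have at0 : 0 < a + tau by rewrite addr_gt0.
have ltau := lam_gt0 geom at0 atauR.
have st_ub : s - t <= lam (a + t).
  have := geodesic_length_le geom a0 t0 atR; rewrite -sL => H.
  have : hstar f a t / f (a + t) <= lam (a + t).
    by rewrite ler_pdivrMr// (hstar_le_lam_f geom).
  lra.
(* A smaller t would be at most c1 lam (a + t), so lam (a + t) <= M lam a, and therefore t <= lam a
   / (8 M^2). Then h / f <= M lam a sqrt(2 t / lam a) <= lam a / 2, and s <= t + h / f <= 5 lam a /
   8 contradicts lam a <= s. *)
have t_lb : c2 * lam (a + t) <= t.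
  have [tc|ct] := leP t (c1 * lam (a + t)); last first.
    by rewrite (le_trans _ (ltW ct))// ler_wpM2r// ltW.
  have lba := Hclose a t a0 t0 atR tc.
  have := geodesic_length_le geom a0 t0 atR; rewrite -sL => H.
  have H2 : hstar f a t / f (a + t) <= M * lam a * Num.sqrt (2 * t / lam a).
    rewrite ler_pdivrMr// (le_trans (hstar_le_sqrt geom a0 t0 atR))// mulrAC.
    by rewrite ler_wpM2r ?(ltW fb)// ler_wpM2r ?sqrtr_ge0.
  rewrite leNgt; apply/negP => tlt.
  have tlt2 : t < (8 * M ^+ 2)^-1 * lam a.
    apply: (lt_le_trans tlt).
    apply: (@le_trans _ _ ((8 * M ^+ 3)^-1 * (M * lam a))).
      by apply: ler_pM => //; exact: ltW.
    rewrite le_eqVlt; apply/orP; left; apply/eqP; field.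
    by rewrite gt_eqF.
  have q : 2 * t / lam a <= ((2 * M)^-1) ^+ 2.
    rewrite ler_pdivrMr// (le_trans (_ : _ <= 2 * ((8 * M ^+ 2)^-1 * lam a)))//;
      first by rewrite ler_wpM2l// ltW.
    rewrite le_eqVlt; apply/orP; left; apply/eqP; field.
    by rewrite gt_eqF.
  have q2 : Num.sqrt (2 * t / lam a) <= (2 * M)^-1.
    rewrite (le_trans (_ : _ <= Num.sqrt ((2 * M)^-1 ^+ 2)))//; first by rewrite ler_wsqrtr.
    by rewrite sqrtr_sqr ger0_norm// invr_ge0 mulr_ge0// ltW.
  have H3 : M * lam a * Num.sqrt (2 * t / lam a) <= lam a / 2.
    apply: (@le_trans _ _ (M * lam a * (2 * M)^-1)).
      by rewrite ler_wpM2l// mulr_ge0 ?ltW.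
    by rewrite le_eqVlt; apply/orP; left; apply/eqP; field; rewrite gt_eqF.
  have H4 : (8 * M ^+ 2)^-1 * lam a <= lam a / 8.
    rewrite mulrC ler_wpM2l ?(ltW la)// lef_pV2 ?posrE ?mulr_gt0 ?exprn_gt0//.
    by rewrite ler_peMr// exprn_ege1.
  lra.
have min_lb : c2 * lam (a + t) <= Num.min t (c1 * lam (a + t)).
  by rewrite le_min t_lb ler_wpM2r// ltW.
have st_lb : c3 * lam (a + t) <= s - t.
  have := geodesic_length_ge geom a0 t0 atR; rewrite -sL => H.
  have : c3 * lam (a + t) <= hstar f a t / (2 * f (a + t)).
    rewrite ler_pdivlMr ?mulr_gt0//.
    apply: le_trans (Hlow a t a0 t0 atR).
    rewrite -/E mulrA ler_wpM2r ?(ltW fb)// /c3.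
    rewrite (_ : _ * 2 = E * (c2 * lam (a + t))); last by field.
    by rewrite ler_wpM2l ?(ltW E0).
  lra.
have lam_ub : lam (a + tau) <= N * lam (a + t).
  apply: Hn => //.
  have := lam_le geom b0 atR => H.
  have -> : (1 + eps^-1) * (a + t) = a + t + (a + t) / eps by field; rewrite gt_eqF.
  lra.
have lam_lb : lam (a + t) <= lam (a + tau) by apply: (lam_ndecr geom).
have f_ub : f (a + tau) <= e * f (a + t).
  rewrite mulrC (le_trans (f_ratio geom b0 attau atauR))// ler_wpM2l ?(ltW fb)//.
  by rewrite ler_expR ler_pdivrMr// mul1r; lra.
have f_lb : f (a + t) <= f (a + tau) by apply: (f_le geom).
have st0 : 0 < s - t by rewrite subr_gt0.
have lamst : lam (a + t) <= (s - t) / c3 by rewrite ler_pdivlMr// mulrC.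
split.
- by rewrite (le_trans f_ub)// ler_wpM2r// ltW.
- apply: (@le_trans _ _ (c2^-1 * (c2 * lam (a + t)))).
    by rewrite mulrA mulVf ?mul1r ?gt_eqF.
  apply: ler_pM => //; [exact: ltW|by rewrite mulr_ge0 ?ltW|].
  rewrite le_min (le_trans t_lb)//= (le_trans _ lam_lb)//.
  by rewrite ler_piMl ?(ltW lb)// (le_trans c2c1).
- apply: (@le_trans _ _ (N / c3 * (s - t))); last by rewrite ler_wpM2r// ltW.
  rewrite ge_min; apply/orP; right; rewrite (le_trans lam_ub)//.
  by rewrite -mulrA ler_wpM2l ?(ltW N0)// mulrC.
- have H := Hlow a tau a0 tau0 atauR.
  apply: (@le_trans _ _ (A * (E * Num.min tau (c1 * lam (a + tau)) * f (a + tau)))); last first.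
    by rewrite ler_wpM2l// (le_trans ler01).
  apply: (@le_trans _ _ ((E * c2)^-1 * (E * (c2 * lam (a + t)) * f (a + t)))).
    rewrite (_ : (E * c2)^-1 * _ = lam (a + t) * f (a + t)); last by field; rewrite !gt_eqF.
    by rewrite ler_wpM2r ?(ltW fb).
  apply: ler_pM => //; first exact: ltW.
    by rewrite !mulr_ge0 ?ltW.
  apply: ler_pM => //; [by rewrite !mulr_ge0 ?ltW|exact: ltW|].
  rewrite ler_wpM2l ?(ltW E0)// le_min (le_trans t_lb)//=.
  by apply: ler_pM => //; exact: ltW.
- rewrite (le_trans (hstar_le_lam_f geom a0 tau0 atauR))//.
  apply: (@le_trans _ _ (N * ((s - t) / c3) * (e * f (a + t)))).
    apply: ler_pM; rewrite ?(ltW ltau) ?(ltW (f_gt0 geom _ _))//.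
    by rewrite (le_trans lam_ub)// ler_wpM2l// ltW.
  rewrite (_ : N * _ * _ = N * e / c3 * ((s - t) * f (a + t))); last by field; rewrite gt_eqF.
  by rewrite ler_wpM2r// mulr_ge0 ?ltW.
Qed.

(* When [s < lam a], [f] varies by a factor at most [expR 1] on the interval from
   [a] to [a + s]. *)
Lemma step_bounds_small : exists2 A : R, 1 <= A & forall a s, 0 < a -> 0 < s -> a + s < Rmax ->
  s < lam a ->
  forall tau, s / 2 <= tau -> tau <= s ->
  [/\ f (a + tau) <= A * f (a + s / 2), s - s / 2 <= A * Num.min tau (lam (a + tau)),
      Num.min tau (lam (a + tau)) <= A * (s - s / 2),
      (s - s / 2) * f (a + s / 2) <= A * height f a s &
      height f a s <= A * ((s - s / 2) * f (a + s / 2))].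
Proof.
pose e : R := expR 1.
have e0 : 0 < e by rewrite expR_gt0.
pose A := 2 + 2 * e + e ^+ 2.
have A1 : 1 <= A by rewrite /A; have := sqr_ge0 e; lra.
have Ae : e <= A by rewrite /A; have := sqr_ge0 e; lra.
have A2e : 2 * e <= A by rewrite /A; have := sqr_ge0 e; lra.
have A2 : 2 <= A by rewrite /A; have := sqr_ge0 e; lra.
have Aee : e ^+ 2 <= A by rewrite /A; lra.
exists A => // a s a0 s0 asR sla tau stau taus.
have [t0 ts sL] := rstarP geom a0 s0 asR.
set t := rstar f a s in t0 ts sL *.
have s20 : 0 < s / 2 by rewrite divr_gt0.
have aR : a < Rmax by rewrite (lt_trans _ asR)// ltrDl.
have la := lam_gt0 geom a0 aR.
have fa := f_gt0 geom a0 aR.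
have sub u : 0 < u -> u <= s -> [/\ 0 < a + u, a + u < Rmax, f a <= f (a + u) & f (a + u)
  <= e * f a].
  move=> u0 us; have au0 : 0 < a + u by rewrite addr_gt0.
  have auR : a + u < Rmax by rewrite (le_lt_trans _ asR)// lerD2l.
  have aau : a <= a + u by rewrite lerDl ltW.
  split=> //; first exact: (f_le geom).
  rewrite mulrC (le_trans (f_ratio geom a0 aau auR))// ler_wpM2l ?(ltW fa)//.
  rewrite ler_expR addrAC subrr add0r ler_pdivrMr// mul1r.
  by rewrite (le_trans us)// ltW.
have tau0 : 0 < tau by exact: lt_le_trans stau.
have [atau0 atauR ftau1 ftau2] := sub tau tau0 taus.
have s2s : s / 2 <= s by lra.
have [as0 asR' fs1 fs2] := sub (s / 2) s20 s2s.
have [at0 atR ft1 ft2] := sub t t0 (ltW ts).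
have minE : Num.min tau (lam (a + tau)) = tau.
  apply/min_idPl; rewrite (le_trans taus)// (le_trans (ltW sla))//.
  by apply: (lam_ndecr geom) => //; rewrite lerDl ltW.
have ss : s - s / 2 = s / 2 by lra.
rewrite minE ss /height -/t; split.
- rewrite (le_trans ftau2)// (le_trans (_ : _ <= e * f (a + s / 2)))//.
    by rewrite ler_wpM2l ?(ltW e0).
  by rewrite ler_wpM2r// (le_trans (ltW fa)).
- by rewrite (le_trans stau)// ler_peMl// ltW.
- rewrite (le_trans taus)// (le_trans (_ : _ <= 2 * (s / 2)))//; first by lra.
  by rewrite ler_wpM2r// ltW.
(* Here the geodesic length is s itself, so the height lies between s f(a)^2 / f(a + t) and s f(a +
   t), both comparable to s f(a). *)
- have := hstar_ge_length geom a0 t0 atR; rewrite -sL => H.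
  apply: (@le_trans _ _ (A * (f a ^+ 2 / f (a + t) * s))); last first.
    by rewrite ler_wpM2l// (le_trans ler01).
  have ft0 := lt_le_trans fa ft1.
  apply: (@le_trans _ _ (s * (e * f a))).
    apply: ler_pM => //; [exact: ltW|exact: le_trans (ltW fa) fs1].
  apply: (@le_trans _ _ (e ^+ 2 * (f a ^+ 2 / (e * f a) * s))).
    rewrite le_eqVlt; apply/orP; left; apply/eqP; field.
    by rewrite !gt_eqF.
  apply: ler_pM => //; first exact: sqr_ge0.
    by rewrite mulr_ge0 ?divr_ge0 ?sqr_ge0 ?mulr_ge0 ?ltW.
  rewrite ler_wpM2r ?(ltW s0)// ler_wpM2l ?sqr_ge0// lef_pV2 ?posrE//.
  by rewrite mulr_gt0.
- have := hstar_le_length geom a0 t0 atR; rewrite -sL => H.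
  rewrite (le_trans H)//.
  apply: (@le_trans _ _ (e * f (a + s / 2) * s)).
    rewrite ler_wpM2r ?(ltW s0)// (le_trans ft2)// ler_wpM2l ?(ltW e0)//.
  rewrite (_ : _ * s = 2 * e * (s / 2 * f (a + s / 2))); last by field.
  by rewrite ler_wpM2r// mulr_ge0 ?(ltW s20)// (le_trans (ltW fa)).
Qed.

(** The interface between the geodesics and the shells: the kernel bound and the comparison of
    neighbouring shells start from these five inequalities. *)
Definition step_bounds (A : R) : Prop := forall a s : R, 0 < a -> 0 < s -> a + s < Rmax ->
  let s' := next_radius f F a s in
  [/\ 0 < s', s' < s & forall tau, s' <= tau -> tau <= s ->
  [/\ f (a + tau) <= A * f (a + s'), s - s' <= A * Num.min tau (lam (a + tau)),
      Num.min tau (lam (a + tau)) <= A * (s - s'),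
      (s - s') * f (a + s') <= A * half_height a s tau &
      half_height a s tau <= A * ((s - s') * f (a + s'))]].

Lemma step_bounds_ex : exists2 A : R, 1 <= A & step_bounds A.
Proof.
have [A1 A11 H1] := step_bounds_large; have [A2 A21 H2] := step_bounds_small.
have A10 : 0 <= A1 := le_trans ler01 A11.
have A20 : 0 <= A2 := le_trans ler01 A21.
have weak (A B x y : R) : A <= B -> x <= A * y -> 0 <= y -> x <= B * y.
  by move=> AB xy y0; rewrite (le_trans xy)// ler_wpM2r.
exists (A1 + A2); first by rewrite (le_trans A11)// lerDl.
move=> a s a0 s0 asR s'.
have [t0 ts sL] := rstarP geom a0 s0 asR.
rewrite /half_height.
have E : s' = if lam a <= s then rstar f a s else s / 2 by [].
clearbody s'.
have s'0 : 0 < s' by rewrite E; case: ifP => // _; rewrite divr_gt0.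
have s's : s' < s by rewrite E; case: ifP => // _; lra.
split => // tau t1 t2.
have tau0 : 0 < tau := lt_le_trans s'0 t1.
have atau0 : 0 < a + tau by rewrite addr_gt0.
have atauR : a + tau < Rmax by rewrite (le_lt_trans _ asR)// lerD2l.
have as0 : 0 < a + s' by rewrite addr_gt0.
have asR' : a + s' < Rmax by rewrite (lt_trans _ asR)// ltrD2l.
have fs := f_gt0 geom as0 asR'.
have m0 : 0 <= Num.min tau (lam (a + tau)).
  by rewrite le_min (ltW tau0) ltW// (lam_gt0 geom).
have ss0 : 0 <= s - s' by rewrite subr_ge0 ltW.
have ssf0 : 0 <= (s - s') * f (a + s') by rewrite mulr_ge0// ltW.
have le1 : A1 <= A1 + A2 by rewrite lerDl.
have le2 : A2 <= A1 + A2 by rewrite lerDr.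
move: E; case: ifPn => [las|]; last rewrite -ltNge => las.
- move=> E; rewrite E in t1 m0 ss0 ssf0 fs *.
  have [h1 h2 h3 h4 h5] := H1 a s a0 s0 asR las tau t1 t2.
  split; [exact: weak le1 h1 (ltW fs)|exact: weak le1 h2 _|exact: weak le1 h3 _| |exact: weak le1
    h5 _].
  apply: (weak _ _ _ _ le1 h4).
  exact: ltW (hstar_gt0 geom a0 tau0 atauR).
- move=> E; rewrite E in t1 m0 ss0 ssf0 fs *.
  have [h1 h2 h3 h4 h5] := H2 a s a0 s0 asR las tau t1 t2.
  split; [exact: weak le2 h1 (ltW fs)|exact: weak le2 h2 _|exact: weak le2 h3 _| |exact: weak le2
    h5 _].
  apply: (weak _ _ _ _ le2 h4).
  apply: ltW; apply: (hstar_gt0 geom) => //.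
  by rewrite (lt_trans _ asR)// ltrD2l.
Qed.

End Step.

(** * Lipschitz functions in the plane *)

Section Mean.
Context {R : realType}.
Notation mu := (@lebesgue_measure R).

(** If [s] exceeded its mean everywhere on [D], the integral would be finite and [s] minus the mean
    would be a positive function of integral 0, hence zero almost everywhere, although [D] has
    positive measure. *)
Lemma exists_le_mean (D : set R) (del : R) (s : R -> \bar R) :
  measurable D -> mu D = del%:E -> 0 < del ->
  measurable_fun D s -> (forall u, D u -> (0 <= s u)%E) ->
  exists2 u, D u & (s u * del%:E <= \int[mu]_(v in D) s v)%E.
Proof.
move=> mD muD del0 ms s0; apply: contrapT => /forall2NP nH.
have H u : D u -> (\int[mu]_(v in D) s v < s u * del%:E)%E.
  by move=> Du; have [//|/negP] := nH u; rewrite -ltNge.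
have I0 : (0 <= \int[mu]_(v in D) s v)%E by exact: integral_ge0.
have [u0 Du0] : D !=set0.
  apply/set0P; apply/eqP => D0; move: muD; rewrite D0 measure0 => -[E].
  by rewrite -E ltxx in del0.
have Ifin : (\int[mu]_(v in D) s v)%E \is a fin_num.
  by rewrite ge0_fin_numE// (lt_le_trans (H u0 Du0))// leey.
set i := fine (\int[mu]_(v in D) s v)%E.
have iE : (\int[mu]_(v in D) s v)%E = i%:E by rewrite fineK.
have si u : D u -> ((i / del)%:E < s u)%E.
  move=> /H; rewrite iE; case: (s u) => [z| |] //=.
  - by rewrite -EFinM !lte_fin ltr_pdivrMr.
  - by rewrite ltry.
  - by rewrite gt0_mulNye ?lte_fin.
have ints : mu.-integrable D s.
  apply/integrableP; split => //.
  rewrite (_ : (\int[mu]_(x in D) `|s x|)%E = i%:E) ?ltry//.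
  by rewrite -iE; apply: eq_integral => v /set_mem Dv; rewrite gee0_abs// s0.
have intc : mu.-integrable D (EFin \o cst (i / del)).
  apply/integrableP; split; first by apply/measurable_EFinP; exact: measurable_cst.
  by rewrite /= integral_cst//= [X in (_ * X)%E]muD -EFinM ltry.
have I00 : (\int[mu]_(v in D) (s v - (i / del)%:E) = 0)%E.
  rewrite (_ : (fun v => _) = (fun v => s v - (EFin \o cst (i / del)%R) v)%E)// integralB// iE.
  by rewrite /= integral_cst//= [X in (_ * X)%E]muD -EFinM -EFinB divfK ?subrr// gt_eqF.
have pos v : D v -> (0 < s v - (i / del)%:E)%E by move=> Dv; rewrite sube_gt0 si.
have I01 : (\int[mu]_(v in D) `|s v - (i / del)%:E| = 0)%E.
  by rewrite -I00; apply: eq_integral => v /set_mem Dv; rewrite gee0_abs// ltW// pos.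
have mf : measurable_fun D (fun v => s v - (i / del)%:E)%E.
  by apply: emeasurable_funB => //; exact: measurable_cst.
have /(ae_eq_integral_abs mu mD mf) := I01 => -[N [mN N0 HN]].
have DN : D `<=` N.
  move=> v Dv; apply: HN => /=; move=> /(_ Dv) E.
  by have := pos v Dv; rewrite E ltxx.
have : (mu D <= mu N)%E by apply: le_measure => //; rewrite inE.
by rewrite N0 muD lee_fin leNgt del0.
Qed.

End Mean.

Section LipschitzPlane.
Context {R : realType}.
Notation mu := (@lebesgue_measure R).
Notation plane := (measurableTypeR R * measurableTypeR R)%type.
Variables (w : R * R -> R) (M : R).
Hypothesis M0 : 0 <= M.
Hypothesis wM : forall y z, `|w y - w z| <= M * `|y - z|.

(* As in McShane's extension, [w] is the infimum of the cones with vertices on its graph over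
  rational points. *)
Lemma measurable_lipschitz_plane : measurable_fun setT w.
Proof.
apply: (measurability _ (RGenInftyO.measurableE R)) => _ [_ [al ->] <-].
rewrite setTI.
pose cone (q : rat * rat) (y : R * R) := w (ratr q.1, ratr q.2)
  + M * Num.max `|y.1 - ratr q.1| `|y.2 - ratr q.2|.
have mcone q : measurable_fun setT (cone q).
  apply: measurable_funD => //; apply: measurable_funM => //.
  by apply: measurable_maxr; apply: measurableT_comp => //; apply: measurable_funB.
have -> : w @^-1` `]-oo, al[ = \bigcup_q (cone q @^-1` `]-oo, al[).
  apply/seteqP; split => y /=; rewrite in_itv/=.
    move=> wal.
    pose e := (al - w y) / (2 * M + 1) / 2.
    have M1 : 0 < 2 * M + 1 by rewrite ltr_wpDl// mulr_ge0.
    have e0 : 0 < e by rewrite !divr_gt0// subr_gt0.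
    have [|q1] := @rat_in_itvoo R y.1 (y.1 + e); first by rewrite ltrDl.
    have [|q2] := @rat_in_itvoo R y.2 (y.2 + e); first by rewrite ltrDl.
    rewrite !in_itv/= => /andP[h1 h2] /andP[h3 h4].
    exists (q1, q2) => //; rewrite /= in_itv/= /cone/=.
    have n1 : `|y.1 - ratr q1| <= e by rewrite ler_norml; apply/andP; split; lra.
    have n2 : `|y.2 - ratr q2| <= e by rewrite ler_norml; apply/andP; split; lra.
    have n3 : Num.max `|y.1 - ratr q1| `|y.2 - ratr q2| <= e by rewrite ge_max n1.
    have H1 : M * Num.max `|y.1 - ratr q1| `|y.2 - ratr q2| <= M * e by rewrite ler_wpM2l.
    have H2 : w (ratr q1, ratr q2) - w y <= M * e.
      rewrite (le_trans (ler_norm _))// (le_trans (wM _ _))// ler_wpM2l//.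
      by rewrite prod_normE/= ![`|ratr _ - _|]distrC.
    have : (2 * M + 1) * e < al - w y.
      rewrite /e (_ : _ * _ = (al - w y) / 2); last by field; rewrite gt_eqF.
      lra.
    lra.
  move=> [q _]; rewrite /= in_itv/= /cone; apply: le_lt_trans.
  rewrite -lerBlDl (le_trans (ler_norm _))// (le_trans (wM _ _))//.
pose qn (i : nat) : rat * rat := odflt (0, 0) (unpickle i).
have -> : \bigcup_q (cone q @^-1` `]-oo, al[) = \bigcup_i (cone (qn i) @^-1` `]-oo, al[).
  apply/seteqP; split => y [i _ H]; last by exists (qn i).
  by exists (pickle i) => //; rewrite /qn pickleK.
apply: bigcupT_measurable => i; rewrite -[X in measurable X]setTI.
exact: mcone.
Qed.

Lemma lipschitz_fst v s u : `|w (s, v) - w (u, v)| <= M * `|s - u|.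
Proof.
apply: (le_trans (wM _ _)); rewrite ler_wpM2l// prod_normE/= subrr normr0.
by rewrite ge_max lexx normr_ge0.
Qed.

Lemma lipschitz_snd v s u : `|w (v, s) - w (v, u)| <= M * `|s - u|.
Proof.
apply: (le_trans (wM _ _)); rewrite ler_wpM2l// prod_normE/= subrr normr0.
by rewrite ge_max lexx normr_ge0.
Qed.

Definition partial1 (y : R * R) : R := derive1 (fun s => w (s, y.2)) y.1.
Definition partial2 (y : R * R) : R := derive1 (fun s => w (y.1, s)) y.2.

Lemma measurable_partial1 : measurable_fun setT partial1.
Proof.
apply: (@measurable_lim_dnbhs0 R _ _
  (fun (y : R * R) h => h^-1 *: (w (h + y.1, y.2) - w (y.1, y.2)))).
  move=> h _; apply: measurable_funM => //; apply: measurable_funB.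
    apply: (@measurableT_comp _ _ _ _ _ _ w) => //; first exact: measurable_lipschitz_plane.
    apply/measurable_fun_pairP; split; [exact: (measurable_funD (measurable_cst h)
      measurable_fst)|exact: measurable_snd].
  by rewrite (_ : (fun y => _) = w)//; [exact: measurable_lipschitz_plane|apply/funext => -[]].
move=> s h h0; apply: cvgZ; first exact: cvgV.
apply: cvgB; last exact: cvg_cst.
have cw : continuous (fun u => w (u, s.2)) := lipschitz_continuous M0 (lipschitz_fst s.2).
apply: (@continuous_comp _ _ _ (fun h => h + s.1) (fun u => w (u, s.2))); last exact: cw.
by apply: cvgD; [exact: cvg_id|exact: cvg_cst].
Qed.

Lemma measurable_partial2 : measurable_fun setT partial2.
Proof.
apply: (@measurable_lim_dnbhs0 R _ _
  (fun (y : R * R) h => h^-1 *: (w (y.1, h + y.2) - w (y.1, y.2)))).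
  move=> h _; apply: measurable_funM => //; apply: measurable_funB.
    apply: (@measurableT_comp _ _ _ _ _ _ w) => //; first exact: measurable_lipschitz_plane.
    apply/measurable_fun_pairP; split; [exact: measurable_fst|exact: (measurable_funD
      (measurable_cst h) measurable_snd)].
  by rewrite (_ : (fun y => _) = w)//; [exact: measurable_lipschitz_plane|apply/funext => -[]].
move=> s h h0; apply: cvgZ; first exact: cvgV.
apply: cvgB; last exact: cvg_cst.
have cw : continuous (fun u => w (s.1, u)) := lipschitz_continuous M0 (lipschitz_snd s.1).
apply: (@continuous_comp _ _ _ (fun h => h + s.2) (fun u => w (s.1, u))); last exact: cw.
by apply: cvgD; [exact: cvg_id|exact: cvg_cst].
Qed.

Let pos1 (E : set plane) : plane -> \bar R := (fun y => `|partial1 y|%:E) \_ E.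
Let pos2 (E : set plane) : plane -> \bar R := (fun y => `|partial2 y|%:E) \_ E.

Lemma measurable_pos1 E : measurable E -> measurable_fun setT (pos1 E).
Proof.
move=> mE; apply/(measurable_restrictT _ mE); apply/measurable_EFinP.
apply: (@measurable_funTS _ _ plane R); apply: measurableT_comp => //.
exact: measurable_partial1.
Qed.

Lemma measurable_pos2 E : measurable E -> measurable_fun setT (pos2 E).
Proof.
move=> mE; apply/(measurable_restrictT _ mE); apply/measurable_EFinP.
apply: (@measurable_funTS _ _ plane R); apply: measurableT_comp => //.
exact: measurable_partial2.
Qed.

Lemma pos1_ge0 E y : (0 <= pos1 E y)%E.
Proof. by apply: erestrict_ge0 => z _; rewrite lee_fin. Qed.

Lemma pos2_ge0 E y : (0 <= pos2 E y)%E.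
Proof. by apply: erestrict_ge0 => z _; rewrite lee_fin. Qed.

Definition slice1 E (v : R) : \bar R := (\int[mu]_u pos1 E (u, v))%E.
Definition slice2 E (u : R) : \bar R := (\int[mu]_v pos2 E (u, v))%E.

Lemma measurable_slice1 E : measurable E -> measurable_fun setT (slice1 E).
Proof.
by move=> mE; apply: measurable_fun_fubini_tonelli_G;
   [exact: measurable_pos1|exact: pos1_ge0].
Qed.

Lemma measurable_slice2 E : measurable E -> measurable_fun setT (slice2 E).
Proof.
by move=> mE; apply: measurable_fun_fubini_tonelli_F;
   [exact: measurable_pos2|exact: pos2_ge0].
Qed.

Lemma integral_slice1 E : measurable E ->
  (\int[lebesgue2 R]_(y in E) `|partial1 y|%:E = \int[mu]_v slice1 E v)%E.
Proof.
move=> mE; rewrite integral_mkcond.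
exact: (fubini_tonelli2 (pos1 E) (measurable_pos1 mE) (pos1_ge0 E)).
Qed.

Lemma integral_slice2 E : measurable E ->
  (\int[lebesgue2 R]_(y in E) `|partial2 y|%:E = \int[mu]_u slice2 E u)%E.
Proof.
move=> mE; rewrite integral_mkcond.
exact: (fubini_tonelli1 (pos2 E) (measurable_pos2 mE) (pos2_ge0 E)).
Qed.

Lemma slice1_ge0 E v : (0 <= slice1 E v)%E.
Proof. by apply: integral_ge0 => u _; exact: pos1_ge0. Qed.

Lemma slice2_ge0 E v : (0 <= slice2 E v)%E.
Proof. by apply: integral_ge0 => u _; exact: pos2_ge0. Qed.

Lemma slice1_osc E v p q : (forall u, p <= u -> u < q -> E (u, v)) ->
  forall u u', p <= u -> u < q -> p <= u' -> u' < q ->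
  (`|w (u, v) - w (u', v)|%:E <= slice1 E v)%E.
Proof.
move=> Epq.
have H u u' : p <= u -> u <= u' -> u' < q -> (`|w (u', v) - w (u, v)|%:E <= slice1 E v)%E.
  move=> pu uu' u'q.
  apply: (le_trans (lipschitz_le_integral (lipschitz_fst v) uu')).
  rewrite /slice1 integral_mkcond; apply: ge0_le_integral_nonmeasurable => z _.
    by apply: erestrict_ge0 => t _; rewrite lee_fin.
  rewrite patchE; case: ifPn => [/set_mem/=|_]; last exact: pos1_ge0.
  rewrite in_itv/= => /andP[uz zu'].
  by rewrite /pos1 patchE mem_set// ?lexx//; apply: Epq;
    [exact: le_trans uz|exact: le_lt_trans u'q].
move=> u u' pu uq pu' u'q; case: (leP u u') => uu'; last by apply: H => //; exact: ltW.
by rewrite distrC; apply: H.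
Qed.

Lemma slice2_osc E u (A : set R) : is_interval A -> (forall v, A v -> E (u, v)) ->
  forall v v', A v -> A v' -> (`|w (u, v) - w (u, v')|%:E <= slice2 E u)%E.
Proof.
move=> iA AE.
have H v v' : A v -> A v' -> v <= v' -> (`|w (u, v') - w (u, v)|%:E <= slice2 E u)%E.
  move=> Av Av' vv'.
  apply: (le_trans (lipschitz_le_integral (lipschitz_snd u) vv')).
  rewrite /slice2 integral_mkcond; apply: ge0_le_integral_nonmeasurable => z _.
    by apply: erestrict_ge0 => t _; rewrite lee_fin.
  rewrite patchE; case: ifPn => [/set_mem/=|_]; last exact: pos2_ge0.
  rewrite in_itv/= => vzv'.
  by rewrite /pos2 patchE mem_set// ?lexx//; apply: AE; exact: (iA v v').
move=> v v' Av Av'; case: (leP v v') => vv'; last by apply: H => //; exact: ltW.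
by rewrite distrC; apply: H.
Qed.

(** By Fubini, some line in the strip of width 2 kap carries at most the mean of the slice
    integrals. Stated as a product, the bound makes sense for an infinite integral. *)
Lemma exists_horizontal_osc_le (E : set plane) p q x2 kap : measurable E -> 0 < kap ->
  (forall u v, p <= u -> u < q -> `|v - x2| < kap -> E (u, v)) ->
  exists2 v, `|v - x2| < kap & forall u u', p <= u -> u < q -> p <= u' -> u' < q ->
  ((`|w (u, v) - w (u', v)| * (2 * kap))%:E <= \int[lebesgue2 R]_(y in E) `|partial1 y|%:E)%E.
Proof.
move=> mE kap0 HE.
have muD : mu `]x2 - kap, x2 + kap[ = (2 * kap)%:E.
  rewrite lebesgue_measure_itv/= lte_fin.
  have -> : x2 - kap < x2 + kap by lra.
  by rewrite -EFinB; congr EFin; ring.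
have k2 : 0 < 2 * kap by rewrite mulr_gt0.
have [v] := exists_le_mean (measurable_itv _) muD k2
  (measurable_funS measurableT (@subsetT _ _) (measurable_slice1 mE)) (fun v _ => slice1_ge0 E v).
rewrite /= in_itv/= => vI Hv; have vk : `|v - x2| < kap by rewrite ltr_norml; lra.
exists v => // u u' pu uq pu' u'q.
rewrite integral_slice1// EFinM.
apply: (@le_trans _ _ (slice1 E v * (2 * kap)%:E)%E).
  apply: lee_wpmul2r; first by rewrite lee_fin ltW.
  by apply: (slice1_osc (p := p) (q := q)) => // z pz zq; exact: HE.
apply: (le_trans Hv); apply: ge0_subset_integral => //.
  exact: measurable_slice1.
by move=> z _; exact: slice1_ge0.
Qed.

Lemma exists_vertical_osc_le (E : set plane) p q x2 (h : R -> R) : measurable E -> p < q ->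
  (forall u v, p <= u -> u < q -> `|v - x2| < h u -> E (u, v)) ->
  exists2 u, p <= u /\ u < q & forall v v', `|v - x2| < h u -> `|v' - x2| < h u ->
  ((`|w (u, v) - w (u, v')| * (q - p))%:E <= \int[lebesgue2 R]_(y in E) `|partial2 y|%:E)%E.
Proof.
move=> mE pq HE.
have muD : mu `[p, q[ = (q - p)%:E by rewrite lebesgue_measure_itv/= lte_fin pq.
have qp0 : 0 < q - p by rewrite subr_gt0.
have [u] := exists_le_mean (measurable_itv _) muD qp0
  (measurable_funS measurableT (@subsetT _ _) (measurable_slice2 mE)) (fun v _ => slice2_ge0 E v).
rewrite /= in_itv/= => /andP[pu uq] Hu; exists u => // v v' vh v'h.
rewrite integral_slice2// EFinM.
apply: (@le_trans _ _ (slice2 E u * (q - p)%:E)%E).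
  apply: lee_wpmul2r; first by rewrite lee_fin ltW.
  apply: (slice2_osc (A := [set v | `|v - x2| < h u])) => //.
    move=> z z' /= + + t; rewrite !ltr_norml => /andP[? ?] /andP[? ?] /andP[? ?].
    apply/andP; split; lra.
  by move=> z /= zh; exact: HE.
apply: (le_trans Hu); apply: ge0_subset_integral => //.
  exact: measurable_slice2.
by move=> z _; exact: slice2_ge0.
Qed.

End LipschitzPlane.

(** * The kernel and the shells *)

Section Kernel.
Context {R : realType} (f F : R -> R) (Rmax C0 eps : R).
Hypothesis geom : geometry f F Rmax C0 eps.
Notation lam := (lam F).
Variable A : R.
Hypothesis A1 : 1 <= A.
Hypothesis stepA : step_bounds f F Rmax A.

Definition kernel (x y : R * R) : R :=
  dhat f F x y / fine (lebesgue2 R (control_ball f x (control_dist f x y))).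

(** With m = min(tau, lam y.1), the path running to the column of y and then vertically gives tau <=
    d <= tau + A^2 m. So [f] and [lam] at x.1 + d are comparable to their values at y.1, and the
    ball has measure at most K phi m^2. As m is at most both [dhat] and A l, the kernel is at least
    1 / (A K phi l). *)
Lemma kernel_ge : exists2 c : R, 0 < c & forall (x : R * R) (s : R) y,
  0 < x.1 -> 0 < s -> x.1 + s < Rmax -> Eset f F x s y ->
  x.1 + control_dist f x y < Rmax ->
  c / (f (x.1 + next_radius f F x.1 s) * (s - next_radius f F x.1 s)) <= kernel x y.
Proof.
have [n ln] := lam_growth geom.
have e0 := geom_eps geom.
have A0 : 0 < A := lt_le_trans ltr01 A1.
(* [N1] bounds the ratio of x.1 + d to y.1, and [N3] that of min(d, lam (x.1 + d)) to m; the 32 in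
   [K] is that of [ball_measure_le]. *)
pose N1 := 1 + A ^+ 2 / eps.
pose N3 := 1 + A ^+ 2 + N1 ^+ n.
have N10 : 0 < N1 by rewrite ltr_pwDl// divr_ge0 ?sqr_ge0// ltW.
have N2p : 0 < N1 ^+ n by rewrite exprn_gt0.
have N30 : 0 < N3 by rewrite /N3 addr_gt0// ltr_pwDl// sqr_ge0.
pose K := 32 * (A * expR (A ^+ 2)) * N3 ^+ 2.
have K0 : 0 < K by rewrite /K !mulr_gt0 ?exprn_gt0 ?expR_gt0.
exists (A * K)^-1; first by rewrite invr_gt0 mulr_gt0.
move=> x s y a0 s0 asR [ys1 ys2 yh] dR; set s' := next_radius _ _ _ _ in ys1 *.
set d := control_dist f x y in dR *.
have [s'0 s's H] := stepA a0 s0 asR; rewrite -/s' in s'0 s's H.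
pose tau := y.1 - x.1.
have uE : x.1 + tau = y.1 by rewrite /tau; ring.
have t1 : s' <= tau by rewrite /tau lerBrDl.
have t2 : tau <= s by rewrite /tau lerBlDl ltW.
have {H}[H1 H2 H3 H4 H5] := H _ t1 t2.
rewrite -/tau -/(half_height f F x.1 s tau) in yh.
rewrite uE in H1 H2 H3.
have tau0 : 0 < tau := lt_le_trans s'0 t1.
have u0 : 0 < y.1 by rewrite -uE addr_gt0.
have uR : y.1 < Rmax by rewrite -uE (le_lt_trans _ asR)// lerD2l.
have lu := lam_gt0 geom u0 uR.
have fu := f_gt0 geom u0 uR.
set m := Num.min tau (lam y.1) in H2 H3.
have m0 : 0 < m by rewrite lt_min tau0.
have mt : m <= tau by rewrite ge_min lexx.
have ml : m <= lam y.1 by rewrite ge_min lexx orbT.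
have b0 : 0 < x.1 + s' by rewrite addr_gt0.
have bR : x.1 + s' < Rmax by rewrite (lt_trans _ asR)// ltrD2l.
set phi := f (x.1 + s') in H1 H4 H5 *.
have phi0 : 0 < phi by exact: (f_gt0 geom).
have phiu : phi <= f y.1 by apply: (f_le geom) => //; rewrite -uE lerD2l.
set l := s - s' in H2 H3 H4 H5 *.
have l0 : 0 < l by rewrite subr_gt0.
have td : tau <= d.
  by apply: le_trans (control_dist_ge x y fu); rewrite ler_norm.
(* The vertical side has length at most A l phi with l <= A m and phi <= f(y.1), and is run at speed
   f(y.1). *)
have dt : d <= tau + A ^+ 2 * m.
  apply: (le_trans (control_dist_le x y fu)).
  rewrite subrr normr0 addr0 -/tau gtr0_norm// lerD2l ler_pdivrMr//.
  rewrite (le_trans (ltW yh))// (le_trans H5)//.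
  rewrite (_ : A ^+ 2 * m * f y.1 = A * (A * m * f y.1)); last by ring.
  rewrite ler_wpM2l ?(ltW A0)//.
  by apply: ler_pM => //; apply: ltW.
have d0 : 0 < d := lt_le_trans tau0 td.
have ad0 : 0 < x.1 + d by rewrite addr_gt0.
have uad : y.1 <= x.1 + d by rewrite -uE lerD2l.
have adu : x.1 + d <= y.1 + A ^+ 2 * m by rewrite -uE -addrA lerD2l.
have lad : lam (x.1 + d) <= N1 ^+ n * lam y.1.
  apply: ln => //; apply: (le_trans adu).
  rewrite /N1 mulrDl mul1r lerD2l -mulrA ler_wpM2l ?sqr_ge0//.
  by rewrite mulrC (le_trans ml)// (lam_le geom).
have ladm := lam_ndecr geom u0 uad dR.
have fad : f (x.1 + d) <= A * phi * expR (A ^+ 2).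
  apply: (le_trans (f_ratio geom u0 uad dR)).
  apply: ler_pM => //; rewrite ?expR_ge0 ?(ltW fu)//.
  rewrite ler_expR ler_pdivrMr//.
  apply: (@le_trans _ _ (A ^+ 2 * m)); first by rewrite lerBlDl.
  by rewrite ler_wpM2l ?sqr_ge0.
have mind : Num.min d (lam (x.1 + d)) <= N3 * m.
  rewrite ge_min /m; case: (leP tau (lam y.1)) => tl; apply/orP.
    left; move: dt; rewrite /m (min_l tl) => dt.
    rewrite (le_trans dt)// /N3 !mulrDl mul1r lerDl mulr_ge0// ltW//.
  right; rewrite (le_trans lad)// /N3 mulrDl lerDr mulr_ge0 ?(ltW lu)//.
  by rewrite addr_ge0 ?sqr_ge0.
have mdh : m <= dhat f F x y.
  by rewrite /dhat -/d le_min (le_trans mt td) (le_trans ml ladm).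
have fad0 := f_gt0 geom ad0 dR.
have mind0 : 0 <= Num.min d (lam (x.1 + d)).
  by rewrite le_min (ltW d0) (le_trans _ ladm)// ltW.
have ble := ball_measure_le geom a0 d0 dR.
have bgt := ball_measure_gt0 geom a0 d0 dR.
rewrite /kernel -/d.
have Bfin : lebesgue2 R (control_ball f x d) \is a fin_num.
  by rewrite ge0_fin_numE ?(ltW bgt)// (le_lt_trans ble)// ltry.
set B := fine (lebesgue2 R (control_ball f x d)).
have B0 : 0 < B by rewrite fine_gt0// bgt/= -ge0_fin_numE// ltW.
have BK : B <= K * phi * m ^+ 2.
  rewrite -lee_fin fineK//; apply: (le_trans ble); rewrite lee_fin.
  have -> : K * phi * m ^+ 2 = 32 * (A * phi * expR (A ^+ 2)) * (N3 * m) ^+ 2.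
    by rewrite /K; ring.
  by apply: ler_pM; rewrite ?mulr_ge0 ?sqr_ge0 ?(ltW fad0)// ?ler_wpM2l// lerXn2r ?nnegrE//
    mulr_ge0 ?ltW.
rewrite ler_pdivlMr// mulrAC (ler_pdivrMr _ _ (mulr_gt0 phi0 l0)) mulrC.
rewrite (ler_pdivrMr _ _ (mulr_gt0 A0 K0)).
apply: (le_trans BK).
rewrite (_ : K * phi * m ^+ 2 = (K * phi * m) * m); last by ring.
rewrite (_ : _ * (A * K) = (K * phi * (A * l)) * dhat f F x y); last by ring.
have Kphi0 : 0 < K * phi by rewrite mulr_gt0.
apply: ler_pM => //; [by rewrite ltW// mulr_gt0|exact: ltW|].
by rewrite ler_wpM2l// ltW.
Qed.

End Kernel.

Section UnderGraph.
Context {R : realType}.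
Notation plane := (measurableTypeR R * measurableTypeR R)%type.

Lemma measurable_around_graph (D : set R) (h : R -> R) (c : R) :
  measurable D -> measurable_fun D h ->
  measurable ([set y | D y.1 /\ `|y.2 - c| < h y.1] : set plane).
Proof.
move=> mD mh.
have mDT : measurable (D `*` setT : set plane) by exact: measurableX.
have -> : ([set y | D y.1 /\ `|y.2 - c| < h y.1] : set plane) =
    (D `*` setT) `&` (fun y : plane => h y.1 - `|y.2 - c|) @^-1` `]0, +oo[.
  apply/seteqP; split => y /=; rewrite in_itv/= andbT subr_gt0.
    by move=> [].
  by move=> [[]].
suff mg : @measurable_fun _ _ plane R (D `*` setT) (fun y : plane => h y.1 - `|y.2 - c|).
  by apply: mg.
apply: measurable_funB.
  apply: (@measurable_comp _ _ _ plane (measurableTypeR R) R D h _ fst) => //.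
    by move=> _ [z [Dz _]] <-.
  by apply: measurable_funTS; exact: measurable_fst.
apply: (@measurable_funTS _ _ plane R).
apply: (@measurableT_comp _ _ _ _ _ _ (@Num.norm R R)) => //.
by apply: measurable_funB => //; exact: measurable_snd.
Qed.

End UnderGraph.

Section Shells.
Context {R : realType} (f F : R -> R) (Rmax C0 eps : R).
Hypothesis geom : geometry f F Rmax C0 eps.
Notation lam := (lam F).
Notation plane := (measurableTypeR R * measurableTypeR R)%type.
Variable A : R.
Hypothesis A1 : 1 <= A.
Hypothesis stepA : step_bounds f F Rmax A.
Variables (x : R * R) (r : R).
Hypotheses (a0 : 0 < x.1) (r0 : 0 < r) (arR : x.1 + r < Rmax).
Notation a := (x.1).
Notation rk := (radius_seq f F a r).

Lemma radius_bounds k : 0 < rk k /\ rk k <= r.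
Proof.
elim: k => [//|k [rk0 rkr]].
have akR : a + rk k < Rmax by rewrite (le_lt_trans _ arR)// lerD2l.
have [s'0 s's _] := stepA a0 rk0 akR.
by rewrite /radius_seq iterS; split => //; rewrite (le_trans (ltW s's)).
Qed.

Lemma radius_gt0 k : 0 < rk k. Proof. by have [] := radius_bounds k. Qed.

Lemma radius_lt_Rmax k : a + rk k < Rmax.
Proof. by have [_ ?] := radius_bounds k; rewrite (le_lt_trans _ arR)// lerD2l. Qed.

Lemma radius_decr k : rk k.+1 < rk k.
Proof. by have [] := stepA a0 (radius_gt0 k) (radius_lt_Rmax k). Qed.

Lemma radius_nonincr j k : (j <= k)%N -> rk k <= rk j.
Proof.
move=> /subnKC <-; elim: (k - j)%N => [|n IH]; first by rewrite addn0.
by rewrite addnS (le_trans _ IH)// ltW// radius_decr.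
Qed.

Lemma radius_bounds_step k tau : rk k.+1 <= tau -> tau <= rk k ->
  [/\ f (a + tau) <= A * f (a + rk k.+1), rk k - rk k.+1 <= A * Num.min tau (lam (a + tau)),
      Num.min tau (lam (a + tau)) <= A * (rk k - rk k.+1),
      (rk k - rk k.+1) * f (a + rk k.+1) <= A * half_height f F a (rk k) tau &
      half_height f F a (rk k) tau <= A * ((rk k - rk k.+1) * f (a + rk k.+1))].
Proof. by have [_ _] := stepA a0 (radius_gt0 k) (radius_lt_Rmax k); apply. Qed.

(** If all radii stayed above [del], every step would be at least min(del, lam a) / A, and some
    radius would become negative. *)
Lemma radius_lt_ex del : 0 < del -> exists k, rk k < del.
Proof.
move=> del0; apply: contrapT => /forallNP nH.
have H k : del <= rk k by rewrite leNgt; exact/negP.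
have A0 : 0 < A := lt_le_trans ltr01 A1.
have aR : a < Rmax by rewrite (lt_trans _ arR)// ltrDl.
have la := lam_gt0 geom a0 aR.
pose e := Num.min del (lam a) / A.
have e0 : 0 < e by rewrite divr_gt0// lt_min del0.
have dec k : rk k <= r - k%:R * e.
  elim: k => [|k IH]; first by rewrite mul0r subr0.
  have [_ _ H3 _ _] := radius_bounds_step (lexx _) (ltW (radius_decr k)).
  have : e <= rk k - rk k.+1.
    rewrite /e ler_pdivrMr// mulrC; apply: le_trans H3.
    rewrite le_min !ge_min H/=; apply/orP; right.
    apply: (lam_ndecr geom) => //; last exact: (radius_lt_Rmax k.+1).
    by rewrite lerDl ltW// (radius_gt0 k.+1).
  by rewrite -natr1 mulrDl mul1r; lra.
have := archi_boundP (divr_ge0 (ltW r0) (ltW e0)).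
set n := Num.bound _; rewrite ltr_pdivrMr// => rn.
by have := lt_le_trans (radius_gt0 n) (dec n); lra.
Qed.

Let phi k := f (a + rk k.+1).
Let ell k := rk k - rk k.+1.

(** Both shells border the abscissa a + r_{k+1}, so both widths are compared with the same minimum
    there, at the cost of A^2. The third factor A allows for the change of [f]. *)
Lemma shell_ratio k : phi k * ell k <= A ^+ 3 * (phi k.+1 * ell k.+1) /\
  phi k.+1 * ell k.+1 <= A ^+ 3 * (phi k * ell k).
Proof.
have A0 : 0 < A := lt_le_trans ltr01 A1.
have pos j : 0 < phi j.
  by rewrite (f_gt0 geom)// ?radius_lt_Rmax// addr_gt0// radius_gt0.
have lpos j : 0 < ell j by rewrite subr_gt0 radius_decr.
have [_ H2 H3 _ _] := radius_bounds_step (lexx _) (ltW (radius_decr k)).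
have [K1 K2 K3 _ _] := radius_bounds_step (ltW (radius_decr k.+1)) (lexx _).
set m := Num.min _ _ in H2 H3 K2 K3.
rewrite -/(phi k) -/(phi k.+1) in K1.
rewrite -/(ell k) -/(ell k.+1) in H2 H3 K2 K3.
split.
  rewrite (_ : A ^+ 3 * _ = (A * phi k.+1) * (A * (A * ell k.+1))); last by ring.
  apply: ler_pM => //; [exact: ltW|exact: ltW|].
  by apply: (le_trans H2); rewrite ler_wpM2l// ltW.
have H4 : ell k.+1 <= A ^+ 2 * ell k.
  by apply: (le_trans K2); rewrite expr2 -mulrA ler_wpM2l// ltW.
have H5 : phi k.+1 <= phi k.
  apply: (f_le geom); rewrite ?lerD2l ?radius_lt_Rmax ?addr_gt0 ?radius_gt0//.
  exact: ltW (radius_decr _).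
rewrite (_ : A ^+ 3 * _ = (A * phi k) * (A ^+ 2 * ell k)); last by ring.
apply: ler_pM => //; [exact: ltW|exact: ltW|].
by apply: (le_trans H5); rewrite ler_peMl// ltW.
Qed.

Lemma shell_half_height k u : a + rk k.+1 <= u -> u <= a + rk k ->
  phi k * ell k / A <= half_height f F a (rk k) (u - a) /\
  half_height f F a (rk k) (u - a) <= A ^+ 2 * (phi k * ell k / A).
Proof.
move=> u1 u2; have A0 : 0 < A := lt_le_trans ltr01 A1.
have [||_ _ _ H1 H2] := @radius_bounds_step k (u - a).
- by rewrite lerBrDl.
- by rewrite lerBlDl.
split; first by rewrite ler_pdivrMr// mulrC [_ * A]mulrC.
apply: (le_trans H2); rewrite le_eqVlt; apply/orP; left; apply/eqP.
by rewrite /phi /ell; field; rewrite gt_eqF.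
Qed.

Definition shell k : set plane := [set y | (a + rk k.+1 <= y.1 /\ y.1 < a + rk k) /\
  `|y.2 - x.2| < half_height f F a (rk k) (y.1 - a)].

Lemma shellE k : shell k = Eset f F x (rk k).
Proof. by apply/seteqP; split => y; [move=> [[? ?] ?]|move=> [? ? ?]]. Qed.

Lemma measurable_shell k : measurable (shell k).
Proof.
pose D : set R := `[a + rk k.+1, a + rk k[%classic.
have -> : shell k = [set y : plane | D y.1 /\
    `|y.2 - x.2| < (fun u => half_height f F a (rk k) (u - a)) y.1].
  by apply/seteqP; split => y; rewrite /shell /D/= in_itv/= => -[/andP ? ?].
apply: (measurable_around_graph (h := fun u => half_height f F a (rk k) (u - a)));
  first exact: measurable_itv.
rewrite /half_height; case: (lam a <= rk k); last exact: measurable_cst.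
apply: (@measurable_of_continuous_itv _ _ a) => [|u u1 u2].
  by rewrite ltrDl radius_gt0.
apply: continuous_comp; first by apply: cvgB; [exact: cvg_id|exact: cvg_cst].
apply: (hstar_continuous geom a0).
  by rewrite subr_gt0.
by rewrite addrC subrK (lt_trans u2)// radius_lt_Rmax.
Qed.

End Shells.

(** * Chaining through the shells *)

Section Chain.
Context {R : realType}.
Notation mu := (@lebesgue_measure R).
Notation plane := (measurableTypeR R * measurableTypeR R)%type.
Variables (w : R * R -> R) (M : R).
Hypothesis M0 : 0 <= M.
Hypothesis wM : forall y z, `|w y - w z| <= M * `|y - z|.

Definition around_graph (p q x2 : R) (h : R -> R) : set plane :=
  [set y | (p <= y.1 /\ y.1 < q) /\ `|y.2 - x2| < h y.1].

Section OneSet.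
Variables (p q x2 kap K : R) (h : R -> R).
Hypotheses (pq : p < q) (kap0 : 0 < kap).
Hypothesis h_ge : forall u, p <= u -> u < q -> kap <= h u.
Hypothesis h_le : forall u, p <= u -> u < q -> h u <= K.
Let E := around_graph p q x2 h.
Hypothesis mE : measurable E.

Let K0 : 0 < K.
Proof. exact: lt_le_trans kap0 (le_trans (h_ge (lexx _) pq) (h_le (lexx _) pq)). Qed.

Lemma mu_strip (k : R) : 0 < k -> mu `]x2 - k, x2 + k[ = (2 * k)%:E.
Proof.
move=> k0; rewrite lebesgue_measure_itv/= lte_fin.
have -> : x2 - k < x2 + k by lra.
by rewrite -EFinB; congr EFin; ring.
Qed.

Lemma around_graph_measure_ge : (((q - p) * (2 * kap))%:E <= lebesgue2 R E)%E.
Proof.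
have <- : lebesgue2 R (`[p, q[%classic `*` `]x2 - kap, x2 + kap[%classic) =
    ((q - p) * (2 * kap))%:E.
  rewrite lebesgue2_rect; [|exact: measurable_itv|exact: measurable_itv].
  by rewrite [X in (_ * X)%E]mu_strip// lebesgue_measure_itv/= lte_fin pq -EFinB -EFinM.
apply: lebesgue2_le => y [/=]; rewrite !in_itv/= => /andP[y1 y2] /andP[y3 y4].
split => //; apply: lt_le_trans (h_ge y1 y2).
by rewrite ltr_norml; apply/andP; split; lra.
Qed.

Lemma around_graph_measure_fin : (lebesgue2 R E < +oo)%E.
Proof.
apply: (@le_lt_trans _ _ (lebesgue2 R (`[p, q[%classic `*` `]x2 - K, x2 + K[%classic))).
  apply: lebesgue2_le => y [[y1 y2] /=]; rewrite !in_itv/= y1 y2.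
  move=> yh; split => //.
  have := lt_le_trans yh (h_le y1 y2); rewrite ltr_norml => /andP[? ?].
  by apply/andP; split; lra.
rewrite lebesgue2_rect; [|exact: measurable_itv|exact: measurable_itv].
by rewrite [X in (_ * X)%E]mu_strip// lebesgue_measure_itv/= lte_fin pq -EFinB -EFinM ltry.
Qed.

Lemma around_graph_integrable : (lebesgue2 R).-integrable E (EFin \o w).
Proof.
apply: measurable_bounded_integrable => //; first exact: around_graph_measure_fin.
  apply: measurable_funTS; exact: (measurable_lipschitz_plane M0 wM).
exists (`|w (p, x2)| + M * ((q - p) + K)); split; first exact: num_real.
move=> z zl y [[y1 y2] yh]; apply/ltW/(le_lt_trans _ zl).
rewrite -[w y](subrK (w (p, x2))) addrC (le_trans (ler_normD _ _))// lerD2l.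
apply: (le_trans (wM _ _)); rewrite ler_wpM2l// prod_normE/= ge_max.
have yK := lt_le_trans yh (h_le y1 y2).
rewrite ger0_norm ?subr_ge0//; apply/andP; split.
  by rewrite ler_wpDr ?(ltW K0)// lerD2r ltW.
by rewrite (le_trans (ltW yK))// lerDr subr_ge0 ltW.
Qed.

(** The slice integral depends on y.1 only, and the vertical sections of [E] have length at most 2
    K. *)
Lemma integral_slice2_fst :
  (\int[lebesgue2 R]_(y in E) slice2 w E y.1 <=
   (2 * K)%:E * \int[lebesgue2 R]_(y in E) `|partial2 w y|%:E)%E.
Proof.
rewrite (integral_slice2 M0 wM mE) integral_mkcond.
have ms := measurable_slice2 M0 wM mE.
pose g : plane -> \bar R := (fun y : plane => slice2 w E y.1) \_ E.
have g0 y : (0 <= g y)%E by apply: erestrict_ge0 => z _; exact: slice2_ge0.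
have mg : measurable_fun setT g.
  apply/(measurable_restrictT _ mE); apply: measurable_funTS.
  by apply: (@measurableT_comp _ _ _ _ _ _ (slice2 w E)) => //; exact: measurable_fst.
rewrite -/g (fubini_tonelli1 g mg g0).
rewrite muleC -ge0_integralZr//; first last.
- by rewrite lee_fin mulr_ge0// ltW.
- by move=> u _; exact: slice2_ge0.
apply: ge0_le_integral_nonmeasurable => u _; first by apply: integral_ge0 => v _; exact: g0.
rewrite /fubini_F -(mu_strip K0) -integral_cst//.
rewrite [leRHS]integral_mkcond.
apply: ge0_le_integral_nonmeasurable => v _; first exact: g0.
rewrite /g !patchE; case: ifPn => [/set_mem[[/= y1 y2] yh]|_].
  rewrite mem_set// /= in_itv/=.
  have := lt_le_trans yh (h_le y1 y2); rewrite ltr_norml => /andP[? ?].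
  by apply/andP; split; lra.
by case: ifPn => // _; exact: slice2_ge0.
Qed.

(** Integrate Q - w <= slice2 over [E]: since [w] has integral 0, the left side gives Q times the
    measure of [E], and [integral_slice2_fst] bounds the right side. *)
Lemma zero_mean_bound (Q : R) : 0 < Q -> (\int[lebesgue2 R]_(y in E) (w y)%:E = 0)%E ->
  (forall y, E y -> ((Q - w y)%:E <= slice2 w E y.1)%E) ->
  ((Q * ((q - p) * (2 * kap)))%:E <=
   (2 * K)%:E * \int[lebesgue2 R]_(y in E) `|partial2 w y|%:E)%E.
Proof.
move=> Q0 w0 H; apply: le_trans integral_slice2_fst.
have iw := around_graph_integrable.
have icQ : (lebesgue2 R).-integrable E (EFin \o cst Q).
  apply: measurable_bounded_integrable => //; first exact: around_graph_measure_fin.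
  by exists Q; split; [exact: num_real|move=> z Qz y _ /=; rewrite gtr0_norm// ltW].
have IQ : (\int[lebesgue2 R]_(y in E) (Q - w y)%:E = Q%:E * lebesgue2 R E)%E.
  under eq_integral do rewrite EFinB.
  rewrite (integralB mE icQ iw) [X in (_ - X)%E]w0 sube0 /=.
  by rewrite integral_cst.
apply: (@le_trans _ _ (Q%:E * lebesgue2 R E)%E).
  by rewrite EFinM lee_wpmul2l ?lee_fin ?(ltW Q0)//; exact: around_graph_measure_ge.
rewrite -IQ integralE -[leRHS]sube0; apply: leeB; last exact: integral_ge0.
apply: ge0_le_integral_nonmeasurable => y Ey //.
by rewrite funeposE ge_max H//; exact: slice2_ge0.
Qed.

End OneSet.

Section Shells.
(** An abstract version of the shells: [b] are their bounding abscissas, [kap] their half heights up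
    to the factor B, and [eps k] is the share of the k-th shell in the total [T]. *)
Variables (x1 x2 B T : R) (b kap eps : nat -> R) (h : nat -> R -> R).
Hypothesis B1 : 1 <= B.
Hypothesis b_decr : forall k, b k.+1 < b k.
Hypothesis b_gt : forall k, x1 < b k.
Hypothesis b_lim : forall del, 0 < del -> exists k, b k < x1 + del.
Hypothesis kap0 : forall k, 0 < kap k.
Hypothesis kap_le : forall k, kap k <= B * kap k.+1.
Hypothesis kap_ge : forall k, kap k.+1 <= B * kap k.
Hypothesis h_ge : forall k u, b k.+1 <= u -> u < b k -> kap k <= h k u.
Hypothesis h_le : forall k u, b k.+1 <= u -> u < b k -> h k u <= B * kap k.
Let E k := around_graph (b k.+1) (b k) x2 (h k).
Hypothesis mE : forall k, measurable (E k).
Hypothesis eps0 : forall k, 0 <= eps k.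
Hypothesis int1 : forall k,
  (\int[lebesgue2 R]_(y in E k) `|partial1 w y|%:E <= (B * kap k * eps k)%:E)%E.
Hypothesis int2 : forall k,
  (\int[lebesgue2 R]_(y in E k) `|partial2 w y|%:E <= (B * (b k - b k.+1) * eps k)%:E)%E.
Hypothesis epsT : forall N, \sum_(k < N) eps k <= T.
Hypothesis w0 : (\int[lebesgue2 R]_(y in E 0) (w y)%:E = 0)%E.

Let Bgt0 : 0 < B. Proof. exact: lt_le_trans ltr01 B1. Qed.
Let BB2 : B <= B ^+ 2. Proof. by rewrite expr2 ler_peMl// ltW. Qed.

Lemma chain_vertical k : exists2 u, b k.+1 <= u /\ u < b k & forall v v',
  `|v - x2| < kap k -> `|v' - x2| < kap k -> w (u, v) - w (u, v') <= B * eps k.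
Proof.
have [|u [u1 u2] H] := exists_vertical_osc_le M0 wM (x2 := x2) (h := h k) (mE k) (b_decr k).
  by move=> u v u1 u2 vh; split.
exists u => // v v' vk v'k; have hk := h_ge u1 u2.
have := le_trans (H v v' (lt_le_trans vk hk) (lt_le_trans v'k hk)) (int2 k).
rewrite lee_fin mulrAC ler_pM2r ?subr_gt0//; apply: le_trans; exact: ler_norm.
Qed.

Lemma chain_horizontal k : exists2 v, `|v - x2| < kap k /\ `|v - x2| < kap k.+1 &
  forall u u', b k.+2 <= u -> u < b k -> b k.+2 <= u' -> u' < b k ->
  w (u, v) - w (u', v) <= B ^+ 2 * (eps k + eps k.+1).
Proof.
(* The strip of half height [km] runs inside both sets, so the chosen height [v] can serve on the
   vertical segments of both. One factor B comes from [int1], the other from kap <= B km. *)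
pose km := Num.min (kap k) (kap k.+1).
have km0 : 0 < km by rewrite lt_min !kap0.
have kmB : kap k <= B * km /\ kap k.+1 <= B * km.
  rewrite /km; case: (leP (kap k) (kap k.+1)) => kk; split => //.
  - by rewrite ler_peMl// ltW.
  - by rewrite ler_peMl// ltW.
have [|||v] := @exists_horizontal_osc_le _ w M M0 wM (E k `|` E k.+1) (b k.+2) (b k) x2 km.
- exact: measurableU.
- exact: km0.
- move=> u v u1 u2; rewrite lt_min => /andP[v1 v2]; case: (ltP u (b k.+1)) => ub.
    by right; split => //; exact: lt_le_trans (h_ge u1 ub).
  by left; split => //; exact: lt_le_trans (h_ge ub u2).
rewrite lt_min => /andP[v1 v2] H; exists v => // u u' u1 u2 u3 u4.
have := H u u' u1 u2 u3 u4; rewrite ge0_integral_setU//; first last.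
- apply/eqP; rewrite -subset0 => y [[[y1 y2] _] [[y3 y4] _]].
  by have := lt_le_trans y4 y1; rewrite ltxx.
- apply: (@measurable_funTS _ _ plane); apply/measurable_EFinP.
  by apply: measurableT_comp => //; exact: (measurable_partial1 M0 wM).
move=> /le_trans/(_ (leeD (int1 k) (int1 k.+1))); rewrite -EFinD lee_fin => H1.
have H2 : B * kap k * eps k + B * kap k.+1 * eps k.+1 <= B ^+ 2 * (eps k + eps k.+1) * km.
  rewrite (_ : _ * km = B * (B * km) * eps k + B * (B * km) * eps k.+1); last by ring.
  by apply: lerD; rewrite ler_wpM2r// ler_wpM2l ?(ltW Bgt0)//; case: kmB.
have H3 := le_trans H1 H2.
set D := w (u, v) - _ in H3 *.
have D1 : D <= `|D| by exact: ler_norm.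
have D2 := normr_ge0 D.
have : `|D| * km <= B ^+ 2 * (eps k + eps k.+1) * km.
  apply: le_trans H3; rewrite ler_wpM2l//; lra.
by rewrite ler_pM2r// => /(le_trans D1).
Qed.

(* Were [w] much larger than 0 on a horizontal segment of the first set, its oscillation
   on the vertical lines would contradict the zero mean. *)
Lemma chain_base : exists2 u, b 1 <= u /\ u < b 0 & forall z,
  `|z - x2| < kap 0 -> w (u, z) <= 3 * B ^+ 2 * eps 0.
Proof.
have [u [u1 u2] Hu] := chain_vertical 0.
have [||v vk] := @exists_horizontal_osc_le _ w M M0 wM (E 0) (b 1) (b 0) x2 (kap 0) (mE 0).
- exact: kap0.
- by move=> u' v u1' u2' v1; split => //; exact: lt_le_trans (h_ge u1' u2').
move=> Hv; exists u => // z zk.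
have Be : B * eps 0 <= B ^+ 2 * eps 0 by rewrite ler_wpM2r.
have Be0 : 0 <= B * eps 0 by rewrite mulr_ge0// ltW.
have Hv' u' : b 1 <= u' -> u' < b 0 -> w (u, v) - w (u', v) <= B * eps 0.
  move=> u1' u2'; have := le_trans (Hv u u' u1 u2 u1' u2') (int1 0).
  rewrite lee_fin (_ : _ * (2 * _) = (2 * `|w (u, v) - w (u', v)|) * kap 0); last by ring.
  rewrite [leRHS]mulrAC ler_pM2r//; have := ler_norm (w (u, v) - w (u', v)).
  by have := normr_ge0 (w (u, v) - w (u', v)); lra.
have := Hu z v zk vk.
set m := w (u, v) in Hv' *.
(* On the horizontal segment at height [v], [w] is at least [Q]. From Q <= B^2 eps 0, adding B eps 0
   for each of the two moves gives the constant 3. *)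
pose Q := m - B * eps 0.
suff : Q <= B ^+ 2 * eps 0 by rewrite /Q; lra.
case: (leP Q 0) => [Q0|Q0]; first by rewrite (le_trans Q0)// mulr_ge0// sqr_ge0.
have HQ : ((Q * ((b 0 - b 1) * (2 * kap 0)))%:E <=
    (2 * (B * kap 0))%:E * \int[lebesgue2 R]_(y in E 0) `|partial2 w y|%:E)%E.
  apply: (zero_mean_bound (b_decr 0) (kap0 0) (@h_ge 0) (@h_le 0) (mE 0) Q0 w0).
  move=> y [[y1 y2] yh]; apply: le_trans (slice2_osc M0 wM (A := [set t | `|t - x2| < h 0 y.1])
    (v := v) (v' := y.2) _ _ _ _).
  - rewrite lee_fin; apply: le_trans (ler_norm _); rewrite -surjective_pairing.
    by rewrite lerD2r /Q; have := Hv' _ y1 y2; lra.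
  - move=> t t' /= + + s; rewrite !ltr_norml => /andP[? ?] /andP[? ?] /andP[? ?].
    by apply/andP; split; lra.
  - by move=> t th; split.
  - exact: lt_le_trans (h_ge y1 y2).
  - by [].
have kap00 := kap0 0; have l0 : 0 < b 0 - b 1 by rewrite subr_gt0.
have K0 : (0 <= (2 * (B * kap 0))%:E)%E by rewrite lee_fin ltW// !mulr_gt0.
have := le_trans HQ (lee_wpmul2l K0 (int2 0)).
rewrite -EFinM lee_fin.
rewrite (_ : Q * _ = Q * (2 * (b 0 - b 1) * kap 0)); last by ring.
rewrite (_ : 2 * (B * kap 0) * _ = (B ^+ 2 * eps 0) * (2 * (b 0 - b 1) * kap 0)); last by ring.
by rewrite ler_pM2r// !mulr_gt0.
Qed.

(** To pass to the next set, go up or down the old vertical segment to the common height [v], along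
    the horizontal segment to the new vertical one, and along that to z. The induction hypothesis,
    valid for all heights, absorbs the first move; the other two cost at most 2 B^2 (eps N + eps
    N.+1). *)
Lemma chain_bound N : exists2 u, b N.+1 <= u /\ u < b N & forall z,
  `|z - x2| < kap N ->
  w (u, z) <= 3 * B ^+ 2 * eps 0 + 2 * B ^+ 2 * \sum_(k < N) (eps k + eps k.+1).
Proof.
elim: N => [|N [u [u1 u2] IH]].
  have [u u12 H] := chain_base; exists u => // z zk.
  by rewrite big_ord0 mulr0 addr0 H.
have [u' [u1' u2'] Hu'] := chain_vertical N.+1.
have [v [v1 v2] Hv] := chain_horizontal N.
exists u' => // z zk; rewrite big_ord_recr/= mulrDr.
have H1 := Hu' z v zk v2.
have H2 : w (u', v) - w (u, v) <= B ^+ 2 * (eps N + eps N.+1).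
  apply: Hv => //; first exact: lt_trans (b_decr _).
  by apply: le_trans u1; exact: ltW.
have H3 := IH v v1.
have H4 : B * eps N.+1 <= B ^+ 2 * (eps N + eps N.+1).
  by apply: ler_pM; rewrite ?(ltW Bgt0)// lerDr.
lra.
Qed.

Lemma chain_le : w (x1, x2) <= 7 * B ^+ 2 * T.
Proof.
have B20 : 0 <= B ^+ 2 by exact: sqr_ge0.
(* Each [eps k] occurs at most twice in the sum, so 7 = 3 + 2 * 2. *)
have sumT N : 3 * B ^+ 2 * eps 0 + 2 * B ^+ 2 * \sum_(k < N) (eps k + eps k.+1) <= 7 * B ^+ 2 * T.
  have h1 : eps 0 <= T by have := epsT 1; rewrite big_ord1.
  have h2 : \sum_(k < N) (eps k + eps k.+1) <= 2 * T.
    rewrite big_split/= mulrDl mul1r lerD ?epsT//.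
    apply: le_trans (epsT N.+1); rewrite big_ord_recl/=.
    by rewrite lerDr.
  have -> : 7 * B ^+ 2 * T = 3 * B ^+ 2 * T + 2 * B ^+ 2 * (2 * T) by ring.
  by apply: lerD; rewrite ler_wpM2l// mulr_ge0.
apply/ler_addgt0Pr => e e0.
(* Far along the chain the column is so close to x1 that the Lipschitz bound costs at most e. *)
have [k bk] : exists k, b k < x1 + e / (M + 1).
  by apply: b_lim; rewrite divr_gt0// ltr_wpDl.
have [u [u1 u2] Hu] := chain_bound k.
have H1 : w (u, x2) <= 7 * B ^+ 2 * T.
  by apply: le_trans (sumT k); apply: Hu; rewrite subrr normr0.
have H2 : w (x1, x2) - w (u, x2) <= M * `|x1 - u|.
  by apply: le_trans (lipschitz_fst M0 wM x2 x1 u); exact: ler_norm.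
have ux : x1 < u := lt_le_trans (b_gt _) u1.
have H3 : M * `|x1 - u| <= e.
  rewrite ltr0_norm ?subr_lt0// opprB.
  apply: (@le_trans _ _ (M * (e / (M + 1)))); first by rewrite ler_wpM2l//; lra.
  rewrite mulrA ler_pdivrMr ?ltr_wpDl// mulrC ler_wpM2l ?(ltW e0)//; lra.
lra.
Qed.

End Shells.
End Chain.

(** The sum of the restricted [G k] has at most one nonzero term at each point and lies below [g] on
    [D]. Measurability of the [G k] serves to exchange sum and integral; the comparison with [g] is
    pure monotonicity. *)
Lemma sum_integral_disjoint_le d (T : measurableType d) (R : realType)
  (mu : {measure set T -> \bar R}) (D : set T) (E : nat -> set T) (g : T -> \bar R)
  (G : nat -> T -> \bar R) (N : nat) :
  (forall k, measurable (E k)) -> (forall j k y, E j y -> E k y -> j = k) ->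
  (forall k, E k `<=` D) ->
  (forall k, measurable_fun (E k) (G k)) -> (forall k y, (0 <= G k y)%E) ->
  (forall y, D y -> (0 <= g y)%E) -> (forall k y, E k y -> (G k y <= g y)%E) ->
  (\sum_(k < N) \int[mu]_(y in E k) G k y <= \int[mu]_(y in D) g y)%E.
Proof.
move=> mE dE ED mG G0 g0 Gg.
pose H (k : 'I_N) := G k \_ (E k).
have H0 k y : (0 <= H k y)%E by apply: erestrict_ge0 => z _; exact: G0.
rewrite (eq_bigr (fun k => \int[mu]_y H k y)%E); last first.
  by move=> k _; rewrite integral_mkcond.
rewrite -ge0_integral_sum//; last first.
  by move=> k; apply/(measurable_restrictT _ (mE k)).
rewrite [leRHS]integral_mkcond; apply: ge0_le_integral_nonmeasurable => y _.
  by apply: sume_ge0 => k _; exact: H0.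
have [[j Ej]|nE] := pselect (exists j : 'I_N, E j y).
  rewrite (bigD1 j)//= big1 ?adde0 => [|k kj]; last first.
    rewrite /H patchE; case: ifPn => // /set_mem Ek.
    by rewrite (val_inj (dE _ _ _ Ek Ej)) eqxx in kj.
  rewrite /H !patchE (mem_set Ej) mem_set; first exact: Gg.
  exact: ED Ej.
rewrite big1 => [|k _]; first by apply: erestrict_ge0.
rewrite /H patchE; case: ifPn => // /set_mem Ek.
by exfalso; apply: nE; exists k.
Qed.

Section NormGradA.
Context {R : realType} (f : R -> R).

(** On a shell, [phi] is a constant lower bound for [f]; the maximum lets each partial derivative be
    recovered from the minorant by one multiplication. *)
Lemma norm_gradA_ge (w : R * R -> R) (y : R * R) (phi : R) : 0 <= phi -> phi <= f y.1 ->
  Num.max `|partial1 w y| (phi * `|partial2 w y|) <= norm_gradA f w y.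
Proof.
move=> phi0 phif; rewrite ge_max /norm_gradA -/(partial1 w y) -/(partial2 w y).
apply/andP; split.
  by rewrite -sqrtr_sqr ler_wsqrtr// lerDl sqr_ge0.
apply: (@le_trans _ _ (f y.1 * `|partial2 w y|)); first by rewrite ler_wpM2r.
rewrite -{1}(ger0_norm (le_trans phi0 phif)) -normrM -sqrtr_sqr ler_wsqrtr//.
by rewrite lerDr sqr_ge0.
Qed.

End NormGradA.

Theorem lemma83 (R : realType) (f F : R -> R) (Rmax C0 eps : R)
    (geom : geometry f F Rmax C0 eps) :
  exists2 C : R, 0 < C &
    forall (x : R * R) (r : R) (w : R * R -> R),
      0 < x.1 -> 0 < r ->
      x.1 + r < Rmax ->
      (forall y, Gamma f F x r y -> x.1 + control_dist f x y < Rmax) ->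
      [lipschitz w y | y in setT] ->
      (\int[lebesgue2 R]_(y in Eset f F x (radius_seq f F x.1 r 1)) (w y)%:E
        = 0)%E ->
      ((w x)%:E <=
        C%:E * \int[lebesgue2 R]_(y in Gamma f F x r)
          (norm_gradA f w y *
            (dhat f F x y /
              fine (lebesgue2 R (control_ball f x (control_dist f x y)))))%:E)%E.
Proof.
pose plane := (measurableTypeR R * measurableTypeR R)%type.
have [A A1 stepA] := step_bounds_ex geom.
have [c c0 kerc] := kernel_ge geom A1 stepA.
have A0 : 0 < A := lt_le_trans ltr01 A1.
(* A^3 compares neighbouring half heights and dominates the A^2 between the two bounds on one half
   height; A / c converts integrals of the minorant [G] into integrals of the partial
   derivatives. *)
pose B := A ^+ 3 + A / c.
have Ac0 : 0 < A / c by rewrite divr_gt0.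
have A31 : 1 <= A ^+ 3 by exact: exprn_ege1.
have B1 : 1 <= B by rewrite /B; lra.
have A3B : A ^+ 3 <= B by rewrite lerDl ltW.
have AcB : A / c <= B by rewrite lerDr (le_trans ler01).
exists (7 * B ^+ 2); first by rewrite mulr_gt0// exprn_gt0// (lt_le_trans ltr01).
move=> x r w a0 r0 arR dR lipw w0.
have [M M0 wM] := lipschitz_ex lipw.
have {}wM y z : `|w y - w z| <= M * `|y - z| by exact: wM.
set g := fun y => (norm_gradA f w y * _)%:E.
have gE y : g y = (norm_gradA f w y * kernel f F x y)%:E by [].
pose rk := radius_seq f F x.1 r.
have rk0 k : 0 < rk k := radius_gt0 stepA a0 r0 arR k.
have rkR k : x.1 + rk k < Rmax := radius_lt_Rmax stepA a0 r0 arR k.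
have rkd k : rk k.+1 < rk k := radius_decr stepA a0 r0 arR k.
(* Gamma and the chain start with E(x, r_1), so the k-th set of the chain is the shell of index k +
   1, whose inner radius has index k + 2. *)
pose phi k := f (x.1 + rk k.+2).
pose ell k := rk k.+1 - rk k.+2.
have phi0 k : 0 < phi k by rewrite (f_gt0 geom) ?rkR// addr_gt0.
have ell0 k : 0 < ell k by rewrite subr_gt0.
pose E k := shell f F x r k.+1.
have mE k : measurable (E k) := measurable_shell geom stepA a0 r0 arR k.+1.
have EGamma k : E k `<=` Gamma f F x r.
  by move=> y; rewrite /E shellE => Ey; exists k.+1.
have kerE k y : E k y -> c / (phi k * ell k) <= kernel f F x y.
  move=> Ey; have := dR _ (EGamma _ _ Ey) => dyR.
  by move: Ey; rewrite /E shellE => /(kerc x _ y a0 (rk0 _) (rkR _)) /(_ dyR).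
have phif k y : E k y -> phi k <= f y.1.
  move=> [[y1 y2] _]; apply: (f_le geom) => //; first by rewrite addr_gt0.
  exact: (lt_trans y2 (rkR k.+1)).
have ker0 y : Gamma f F x r y -> 0 <= kernel f F x y.
  move=> [[//|k] _]; rewrite -shellE => /kerE; apply: le_trans.
  by rewrite divr_ge0 ?mulr_ge0 ?ltW.
(* [kernel] is not known to be measurable: [G k] is a measurable minorant of the
   integrand. *)
pose G k y := c / (phi k * ell k) * Num.max `|partial1 w y| (phi k * `|partial2 w y|).
have cpl k : 0 < c / (phi k * ell k) by rewrite divr_gt0// mulr_gt0.
have G0 k y : 0 <= G k y by rewrite mulr_ge0 ?(ltW (cpl k))// le_max normr_ge0.
have mG k : measurable_fun (E k) (EFin \o G k).
  apply/measurable_EFinP; apply: (@measurable_funTS _ _ plane R).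
  apply: measurable_funM => //; apply: measurable_maxr.
    by apply: measurableT_comp => //; exact: (measurable_partial1 M0 wM).
  apply: measurable_funM => //.
  by apply: measurableT_comp => //; exact: (measurable_partial2 M0 wM).
have Gg k y : E k y -> ((G k y)%:E <= g y)%E.
  move=> Ey; rewrite gE lee_fin mulrC.
  apply: ler_pM; [exact: ltW|by rewrite le_max normr_ge0|exact: kerE|].
  by apply: norm_gradA_ge; [exact: ltW|exact: phif].
have g0 y : Gamma f F x r y -> (0 <= g y)%E.
  by move=> Gy; rewrite gE lee_fin mulr_ge0 ?sqrtr_ge0// ker0.
have dE j k y : E j y -> E k y -> j = k.
  have H i l : (i < l)%N -> E i y -> E l y -> False.
    move=> il [[y1 _] _] [[_ y2] _].
    have := radius_nonincr stepA a0 r0 arR (il : (i.+2 <= l.+1)%N).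
    by have := le_lt_trans y1 y2; rewrite ltrD2l ltNge => /negP.
  by move=> Ej Ek; case: (ltngtP j k) => // jk; exfalso; [exact: H Ej Ek|exact: H Ek Ej].
have sumG N := sum_integral_disjoint_le (lebesgue2 R) N mE dE EGamma mG
  (fun k y => G0 k y) g0 Gg.
set I := (\int[lebesgue2 R]_(y in Gamma f F x r) g y)%E in sumG *.
have I0 : (0 <= I)%E by exact: integral_ge0.
have C0' : 0 < 7 * B ^+ 2 by rewrite mulr_gt0// exprn_gt0// (lt_le_trans ltr01).
(* An infinite integral makes the claim trivial; otherwise its value serves as the total [T] of the
   chain. *)
have [Ifin|/negbTE Iinf] := boolP (I \is a fin_num); last first.
  have -> : I = +oo%E by move: I0 Iinf; case: (I).
  by rewrite gt0_muley ?lte_fin// leey.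
pose ee k := fine (\int[lebesgue2 R]_(y in E k) (EFin \o G k) y)%E.
have eeE k : (\int[lebesgue2 R]_(y in E k) (G k y)%:E = (ee k)%:E)%E.
  rewrite fineK// ge0_fin_numE; last by apply: integral_ge0 => y _; rewrite lee_fin.
  rewrite (@le_lt_trans _ _ I)// -?ge0_fin_numE//.
  apply: le_trans (sumG k.+1); rewrite big_ord_recr/= leeDr//.
  by apply: sume_ge0 => i _; apply: integral_ge0 => y _; rewrite lee_fin.
have intG k (D : plane -> R) K : 0 <= K -> (forall y, `|D y| <= K * G k y) ->
    (\int[lebesgue2 R]_(y in E k) `|D y|%:E <= (K * ee k)%:E)%E.
  move=> K0 DG; rewrite EFinM -eeE -ge0_integralZl_EFin//; last first.
    by move=> y _; rewrite lee_fin.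
  by apply: ge0_le_integral_nonmeasurable => y _; rewrite -?EFinM lee_fin.
have ee0 k : 0 <= ee k.
  by apply: fine_ge0; apply: integral_ge0 => y _; rewrite lee_fin.
rewrite -(fineK Ifin) -EFinM lee_fin.
rewrite (surjective_pairing x).
(* The half height of reference is the lower bound of [shell_half_height]; the upper bound exceeds
   it by the factor A^2 <= B. *)
apply: (@chain_le R w M M0 wM x.1 x.2 B (fine I) (fun k => x.1 + rk k.+1)
  (fun k => phi k * ell k / A) ee
  (fun k u => half_height f F x.1 (rk k.+1) (u - x.1)) B1) => //.
- by move=> k; rewrite ltrD2l.
- by move=> k; rewrite ltrDl.
- move=> del del0; have [k kd] := radius_lt_ex geom A1 stepA a0 r0 arR del0.
  by exists k; rewrite ltrD2l (lt_trans _ kd).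
- by move=> k; rewrite divr_gt0// mulr_gt0.
- move=> k; rewrite mulrA ler_pM2r ?invr_gt0//.
  have [H _] := shell_ratio geom A1 stepA a0 r0 arR k.+1.
  by apply: (le_trans H); rewrite ler_wpM2r// ltW// (mulr_gt0 (phi0 k.+1) (ell0 k.+1)).
- move=> k; rewrite mulrA ler_pM2r ?invr_gt0//.
  have [_ H] := shell_ratio geom A1 stepA a0 r0 arR k.+1.
  by apply: (le_trans H); rewrite ler_wpM2r// ltW// (mulr_gt0 (phi0 k) (ell0 k)).
- move=> k u u1 u2.
  by have [] := shell_half_height A1 stepA a0 r0 arR (k := k.+1) u1 (ltW u2).
- move=> k u u1 u2.
  have [_ H] := shell_half_height A1 stepA a0 r0 arR (k := k.+1) u1 (ltW u2).
  have k0 : 0 <= phi k * ell k / A by rewrite ltW// divr_gt0// mulr_gt0.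
  apply: (le_trans H); apply: (ler_wpM2r k0).
  by apply: le_trans A3B; rewrite ler_weXn2l.
- move=> k.
  (* By the first entry of the maximum, |partial1| <= (phi ell / c) G, and this coefficient is A / c
     times the half height of reference. *)
  have H : (A / c) * (phi k * ell k / A) = phi k * ell k / c.
    by field; rewrite !gt_eqF.
  apply: (@le_trans _ _ ((A / c * (phi k * ell k / A)) * ee k)%:E); last first.
    rewrite lee_fin (ler_wpM2r (ee0 k))// (ler_wpM2r _ AcB)// ltW// divr_gt0//.
    exact: mulr_gt0 (phi0 k) (ell0 k).
  rewrite H; apply: intG => [|y]; first by rewrite divr_ge0 ?mulr_ge0 ?ltW.
  rewrite /G mulrA (_ : phi k * ell k / c * (c / (phi k * ell k)) = 1); last first.
    by field; rewrite !gt_eqF.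
  by rewrite mul1r le_max lexx.
(* The second entry of the maximum carries phi, which cancels against the denominator and leaves
   |partial2| <= (ell / c) G. *)
- move=> k; rewrite (_ : x.1 + _ - _ = ell k); last by rewrite /ell; ring.
  apply: (@le_trans _ _ (c^-1 * ell k * ee k)%:E); last first.
    rewrite lee_fin !ler_wpM2r ?(ltW (ell0 k))//.
    by rewrite (le_trans _ AcB)// ler_peMl// invr_ge0 ltW.
  apply: intG => [|y]; first by rewrite mulr_ge0 ?invr_ge0 ?ltW.
  rewrite /G mulrA (_ : c^-1 * ell k * (c / (phi k * ell k)) = (phi k)^-1); last first.
    by field; rewrite !gt_eqF.
  rewrite -[leLHS](mulKf (lt0r_neq0 (phi0 k))) ler_wpM2l ?invr_ge0 ?(ltW (phi0 k))//.
  by rewrite le_max lexx orbT.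
- move=> N; rewrite -lee_fin (fineK Ifin) -sumEFin; apply: le_trans (sumG N).
  by apply: lee_sum => k _; rewrite -eeE.
- by rewrite -shellE in w0.
Qed.
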